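(* Let $n\geq 2$ and $\delta\in(0,1)$. For $\varepsilon\in(0,1)$ let $U_{\varepsilon}=B_1\setminus\overline{B_{1-\varepsilon}}\subset\mathbb{R}^{2n}$ be the open spherical shell, equipped with the standard symplectic form. Then the function $(0,1)\ni\varepsilon\mapsto c_{\delta}(U_{\varepsilon})$, where $c_\delta$ is the $\delta$-shell capacity, is discontinuous at $\varepsilon=\delta$.
   Context: $\mathbb{R}^{2n}$ has coordinates $(x_1,y_1,\ldots,x_n,y_n)$ and standard symplectic form $\omega_{\mathrm{st}}=\sum_j \mathrm{d}x_j\wedge \mathrm{d}y_j$; open subsets carry its restriction. $B_r\subset\mathbb{R}^{2n}$ is the open ball of radius $r$ centred at $0$. For $\delta\in(0,1)$ let $A_{\delta}=\overline{B_1}\setminus B_{1-\delta}\subset\mathbb{R}^{2n}$ be the closed spherical shell, and $rA_\delta=\overline{B_r}\setminus B_{r(1-\delta)}$ for $r>0$. The $\delta$-shell capacity of a symplectic manifold $(V,\omega)$ of dimension $2n$ is $$c_{\delta}(V,\omega)=\sup\{\pi r^2\mid \text{there is a symplectic embedding } rA_{\delta}\hookrightarrow (V,\omega)\}.$$ A symplectic embedding of the closed shell $rA_\delta$ means a symplectic embedding of some open neighbourhood of $rA_\delta$ in $\mathbb{R}^{2n}$ into $(V,\omega)$. *)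

(* Defs.v *)
From HB Require Import structures.
From mathcomp Require Import all_boot all_order all_algebra.
From mathcomp Require Import all_classical all_reals all_analysis.
Set Implicit Arguments.
Unset Strict Implicit.
Unset Printing Implicit Defensive.
Import Order.TTheory GRing.Theory Num.Theory.
Import numFieldNormedType.Exports.
Local Open Scope classical_set_scope.
Local Open Scope ring_scope.

Section Smooth.
Variables (R : realType) (m k : nat).
Implicit Types (f : 'rV[R]_m -> 'rV[R]_k) (W : set 'rV[R]_m).

Definition iter_partial f (s : seq 'I_m) : 'rV[R]_m -> 'rV[R]_k :=
  foldr (fun i g => 'D_(delta_mx 0 i) g) f s.

(* On an open set W this is C^oo: the partial derivatives of all orders exist
   and are continuous at every point of W.  Values of f off W are irrelevant. *)
Definition smooth_on W f :=
  forall (s : seq 'I_m) x, W x ->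
    {for x, continuous (iter_partial f s)} /\
    forall i, derivable (iter_partial f s) x (delta_mx 0 i).

Definition smooth_embedding W f :=
  [/\ smooth_on W f,
      forall x, W x -> injective ('d f x) &
      exists g : 'rV[R]_k -> 'rV[R]_m,
        (forall x, W x -> g (f x) = x) /\ {within f @` W, continuous g}].

End Smooth.

(* R^2n is 'rV[R]_(n * 2).  Since mxvec_index enumerates the entries of an
   n x 2 matrix row by row, the coordinates come in the order
   (x_1, y_1, ..., x_n, y_n). *)
Section Symplectic.
Variables (R : realType) (n : nat).
Implicit Types (u v : 'rV[R]_(n * 2)) (W V : set 'rV[R]_(n * 2)).

Definition coord_x v (j : 'I_n) : R := v 0 (mxvec_index j (0 : 'I_2)).
Definition coord_y v (j : 'I_n) : R := v 0 (mxvec_index j (1 : 'I_2)).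

Definition omega_st u v : R :=
  \sum_(j < n) (coord_x u j * coord_y v j - coord_x v j * coord_y u j).

Definition symplectic_embedding W V (f : 'rV[R]_(n * 2) -> 'rV[R]_(n * 2)) :=
  [/\ smooth_embedding W f,
      f @` W `<=` V &
      forall x u v, W x -> omega_st ('d f x u) ('d f x v) = omega_st u v].

(* The library norm on row vectors is the sup norm (it induces the same
   topology), so Euclidean balls are defined separately. *)
Definition eucl_norm v : R := Num.sqrt (\sum_i v 0 i ^+ 2).

Definition eucl_ball (r : R) : set 'rV[R]_(n * 2) := [set v | eucl_norm v < r].

(* closed_shell d r is r A_d *)
Definition closed_shell (d r : R) : set 'rV[R]_(n * 2) :=
  closure (eucl_ball r) `\` eucl_ball (r * (1 - d)).

Definition open_shell (e : R) : set 'rV[R]_(n * 2) :=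
  eucl_ball 1 `\` closure (eucl_ball (1 - e)).

Definition shell_embeds (d r : R) V :=
  exists (W : set 'rV[R]_(n * 2)) (f : 'rV[R]_(n * 2) -> 'rV[R]_(n * 2)),
    [/\ open W, closed_shell d r `<=` W & symplectic_embedding W V f].

(* The capacity of an open subset V of R^2n with the restricted form; it may
   be +oo.  For nonempty open V the set of radii is nonempty, so the value -oo
   of ereal_sup on the empty set does not occur. *)
Definition shell_capacity (d : R) V : \bar R :=
  ereal_sup [set (pi * r ^+ 2)%:E | r in [set r | 0 < r /\ shell_embeds d r V]].

End Symplectic.

(* Main.v *)
(* For eps > delta the inclusions of r A_delta into U_eps with r < 1 close to 1
   show that the capacity of U_eps is at least pi. For eps < delta a symplectic
   embedding phi of r A_delta into U_eps satisfies r^2n + (1 - eps)^2n <= 1, so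
   that the capacity of U_eps stays below a constant smaller than pi.

   The inequality is a comparison of volumes. Let chi be a radial cutoff which
   is 1 inside the shell and 0 outside it. Since phi is symplectic,
   d chi = sum_i alpha_i d phi_i with alpha_i given by Poisson brackets, and
   the vector field p |-> (int alpha_j(x) delta(phi x - p) dx)_j, the
   push-forward of d chi, is the gradient of a compactly supported function h,
   which continues chi o phi^-1 by constants across the complement of the image
   (h is made smooth by mollifying delta). If lambda is the standard primitive
   of omega, then phi^* lambda - lambda is closed on the shell, and its integral
   against the radial d chi vanishes because the rotation fields form a perfect
   Lie algebra; hence h and chi have the same integral. Moreover h vanishes off
   B_1 and is constant on B_(1 - eps). According to the side of the shell on
   which phi puts B_(1 - eps), varying chi shows that the volume of B_(1 - eps)
   is at most that of B_(r (1 - delta)), which is impossible as r <= 1 and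
   eps < delta, or that the volumes of B_r and B_(1 - eps) add up to at most the
   volume of B_1. *)

Require Import Defs.
From HB Require Import structures.
From mathcomp Require Import all_boot all_order all_algebra.
From mathcomp Require Import all_classical all_reals all_analysis.
From mathcomp Require Import ring lra.
Import Order.TTheory GRing.Theory Num.Theory.
Import numFieldNormedType.Exports.
Local Open Scope classical_set_scope.
Local Open Scope ring_scope.

Set Implicit Arguments.
Unset Strict Implicit.
Unset Printing Implicit Defensive.

(** The inverse of [phi] is never differentiated or integrated against: its regularity and the
    topology of the complement of the image are replaced by estimates. All integrals are iterated
    integrals of continuous functions over cubes, and the only changes of variables are affine; the
    Jacobian of [phi] enters through the limit of a kernel rescaled at one point, as a linear map
    whose determinant has modulus one. Two features of the proof result from this. The complement of
    the image is not split into components: [h] is compared with [chi] at a nearest point [X p] of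
    the shell, with an error that tends to zero, and the position of the hole is read off from the
    radius of [X 0]. And balls are replaced by radial cutoffs that lose a factor [q < 1] at each
    use, so that powers of [q] accumulate until [q] is moved to 1 at the end. A third coordinate,
    hence [n >= 2], is essential: in the plane the angular form is closed on the annulus and pairs
    nontrivially with [d chi], and a planar annulus can indeed be mapped to one of equal area around
    a hole of another size. *)

Section Continuity.
Variables (R : realType) (T : topologicalType).
Implicit Types f g : T -> R.

Lemma ctsC (c : R) : continuous (fun _ : T => c).
Proof. by move=> x; exact: cvg_cst. Qed.

Lemma ctsD f g : continuous f -> continuous g -> continuous (fun x => f x + g x).
Proof. by move=> cf cg x; apply: cvgD; [exact: cf|exact: cg]. Qed.

Lemma ctsN f : continuous f -> continuous (fun x => - f x).
Proof. by move=> cf x; apply: cvgN; exact: cf. Qed.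

Lemma ctsB f g : continuous f -> continuous g -> continuous (fun x => f x - g x).
Proof. by move=> cf cg; apply: ctsD => //; exact: ctsN. Qed.

Lemma ctsM f g : continuous f -> continuous g -> continuous (fun x => f x * g x).
Proof. by move=> cf cg x; apply: cvgM; [exact: cf|exact: cg]. Qed.

Lemma cts_norm f : continuous f -> continuous (fun x => `|f x|).
Proof. by move=> cf x; apply: cvg_norm; exact: cf. Qed.

Lemma cts_sum (I : Type) (r : seq I) (P : pred I) (F : I -> T -> R) :
  (forall i, P i -> continuous (F i)) -> continuous (fun x => \sum_(i <- r | P i) F i x).
Proof.
move=> cF; elim: r => [|i r IH].
  have -> : (fun x => \sum_(i <- [::] | P i) F i x) = fun=> 0.
    by apply/funext => x; rewrite big_nil.
  exact: ctsC.
have -> : (fun x => \sum_(i <- i :: r | P i) F i x) =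
          fun x => +%R (if P i then F i x else 0) (\sum_(i <- r | P i) F i x).
  by apply/funext => x; rewrite big_cons; case: ifP => //; rewrite add0r.
by apply: ctsD => //; case: (P i) (cF i) => [/(_ isT)|_] //; exact: ctsC.
Qed.

End Continuity.

Lemma cts_comp (T U V : topologicalType) (f : T -> U) (g : U -> V) :
  continuous f -> continuous g -> continuous (fun x => g (f x)).
Proof. by move=> cf cg x; apply: continuous_comp; [exact: cf|exact: cg]. Qed.

Lemma cts_id (T : topologicalType) : continuous (fun x : T => x).
Proof. by move=> x; exact: cvg_id. Qed.

Lemma cts_pair (T U V : topologicalType) (f : T -> U) (g : T -> V) :
  continuous f -> continuous g -> continuous (fun x => (f x, g x)).
Proof. by move=> cf cg x; apply: cvg_pair; [exact: cf|exact: cg]. Qed.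

(** * Integrals of continuous functions of one variable, by primitives *)

Section Primitive.
Variable R : realType.
Implicit Types (f g F G : R -> R) (a b x y C : R).

Lemma is_derive_cont F (x d : R) : is_derive x 1 F d -> {for x, continuous F}.
Proof.
by move=> [dF _]; apply: differentiable_continuous; apply/derivable1_diffP.
Qed.

Lemma increment_le F f a b C : (forall x, is_derive x 1 F (f x)) ->
  (forall x, a <= x <= b -> `|f x| <= C) -> a <= b -> `|F b - F a| <= C * (b - a).
Proof.
move=> dF fC ab.
have cF : {within `[a, b], continuous F}.
  apply: continuous_subspaceT => x; exact: is_derive_cont (dF x).
have [c] := MVT_segment ab (fun x _ => dF x) cF.
rewrite in_itv /= => cab ->; rewrite normrM [`|b - a|]ger0_norm ?subr_ge0 //.
by rewrite ler_wpM2r ?subr_ge0 // fC.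
Qed.

(** [Num.min] and [Num.max] admit the endpoints in either order, which makes the integral below
    oriented. *)
Lemma primitive_unique F G f a b :
  (forall x, Num.min a b < x < Num.max a b -> is_derive x 1 F (f x)) ->
  (forall x, Num.min a b < x < Num.max a b -> is_derive x 1 G (f x)) ->
  {for a, continuous F} -> {for b, continuous F} ->
  {for a, continuous G} -> {for b, continuous G} ->
  F b - F a = G b - G a.
Proof.
wlog ab : a b / a <= b => [H|].
  move=> dF dG ca cb da db; have [ab|/ltW ab] := leP a b; first exact: H.
  by rewrite -[LHS]opprB -[RHS]opprB; congr (- _); apply: H => //; rewrite minC maxC.
rewrite (min_idPl ab) (max_idPr ab) => dF dG ca cb da db.
have dFG x : x \in `]a, b[ -> is_derive x 1 (F - G) 0.
  rewrite in_itv/= => xab; rewrite -(subrr (f x)).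
  by apply: is_deriveB; [apply: dF|apply: dG].
have cFG : {within `[a, b], continuous (F - G)}.
  have cc x : a <= x <= b -> {for x, continuous (F - G)}.
    move=> /andP[ax xb]; apply: continuousB.
    + have := ax; rewrite le_eqVlt => /orP[/eqP <- //|ax'].
      have := xb; rewrite le_eqVlt => /orP[/eqP -> //|xb'].
      by apply/is_derive_cont/dF; rewrite ax'.
    + have := ax; rewrite le_eqVlt => /orP[/eqP <- //|ax'].
      have := xb; rewrite le_eqVlt => /orP[/eqP -> //|xb'].
      by apply/is_derive_cont/dG; rewrite ax'.
  apply/continuous_in_subspaceT => x; rewrite inE /= in_itv /= => /cc; exact.
have [c _] := MVT_segment ab dFG cFG.
rewrite mul0r => /eqP; rewrite subr_eq0 /= => /eqP e.
have -> : F b = G b + (F - G) b by rewrite /GRing.sub_fun /= addrC subrK.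
rewrite e /=; have -> : (F - G) a = F a - G a by [].
by lra.
Qed.

Lemma primitive_ex f : continuous f -> exists F, forall x, is_derive x 1 F (f x).
Proof.
move=> cf.
(* The integral from [-n - 1] has derivative [f] to the right of that point, hence near every [x]
   with [|x| < n]. Normalised at 0, these local primitives agree where they overlap, and [F] patches
   them together. *)
pose P (n : nat) (x : R) := \int[lebesgue_measure]_(t in `[(- (n%:R) - 1 : R), x]) f t.
have dP n x : - n%:R - 1 < x -> is_derive x 1 (P n) (f x).
  move=> nx.
  have xx : x < x + 1 by rewrite ltrDl.
  have fi : lebesgue_measure.-integrable `[- n%:R - 1, x + 1] (EFin \o f).
    apply: continuous_compact_integrable; first exact: segment_compact.
    exact: continuous_subspaceT.
  have [dF <-] := continuous_FTC1_closed xx fi nx (cf x).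
  by rewrite derive1E; apply: DeriveDef.
pose k (x : R) := Num.bound `|x|.
pose F x := P (k x) x - P (k x) 0.
have FE n x : `|x| < n%:R -> F x = P n x - P n 0.
  move=> xn; rewrite /F.
  have H (m : nat) y : `|x| < m%:R -> Num.min 0 x < y < Num.max 0 x -> - m%:R - 1 < y.
    move=> xm /andP[+ _]; rewrite gt_min => /orP[y0|yx].
      by apply: lt_trans y0; rewrite -opprD oppr_lt0 ltr_wpDl.
    apply: lt_trans yx; rewrite ltrBlDr; move: xm; rewrite ltr_norml => /andP[].
    by move=> /lt_trans + _; apply; rewrite ltrDl.
  have xk : `|x| < (k x)%:R by exact: archi_boundP.
  have H0 (m : nat) : - m%:R - 1 < 0 :> R by rewrite -opprD oppr_lt0 ltr_wpDl.
  have Hx (m : nat) : `|x| < m%:R -> - m%:R - 1 < x.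
    rewrite ltr_norml => /andP[+ _]; apply: le_lt_trans.
    by rewrite lerBlDr lerDl.
  apply: (@primitive_unique _ _ f).
  - by move=> y yx; apply/dP/(H _ _ xk yx).
  - by move=> y yx; apply/dP/(H _ _ xn yx).
  - exact/is_derive_cont/dP.
  - by apply/is_derive_cont/dP/Hx.
  - exact/is_derive_cont/dP.
  - by apply/is_derive_cont/dP/Hx.
exists F => x.
have E : \forall y \near x, P (k x) y - P (k x) 0 = F y.
  have xk : `|x| < (k x)%:R by exact: archi_boundP.
  near=> y; rewrite (FE (k x)) //; near: y.
  exact: (cvgr_lt _ (@norm_continuous R R x)).
apply: near_eq_is_derive E _ => //; rewrite ?oner_neq0 //.
rewrite -[X in is_derive _ _ _ X]subr0; apply: is_deriveB.
apply: dP; rewrite ltrBlDr.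
have := archi_boundP (normr_ge0 x); rewrite ltr_norml => /andP[+ _].
by move=> /lt_trans -> //; rewrite ltrDl.
Unshelve. all: by end_near. Qed.

Definition prim f : R -> R := xget (fun=> 0) [set F | forall x, is_derive x 1 F (f x)].

(** The oriented integral is the increment of a chosen primitive, so that linearity, additivity and
    substitution become derivative rules plus uniqueness of primitives. If [f] has no primitive,
    [prim f] is the default 0. *)
Definition int a b f := prim f b - prim f a.

Lemma primP f x : continuous f -> is_derive x 1 (prim f) (f x).
Proof. by move=> /primitive_ex ex; rewrite /prim; case: xgetP => [F _|]; [exact|case: ex => F dF /(_ F)]. Qed.

Lemma intE F f a b : continuous f -> (forall x, is_derive x 1 F (f x)) ->
  int a b f = F b - F a.
Proof.
move=> cf dF; apply: (@primitive_unique _ _ f).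
- by move=> x _; exact: primP.
- exact: is_derive_cont (primP _ cf).
- exact: is_derive_cont (primP _ cf).
- exact: is_derive_cont.
- exact: is_derive_cont.
Qed.

Lemma intD f g a b : continuous f -> continuous g ->
  int a b (fun x => f x + g x) = int a b f + int a b g.
Proof.
move=> cf cg; have dF x : is_derive x 1 (prim f + prim g) (f x + g x).
  by apply: is_deriveD; exact: primP.
rewrite (intE _ _ _ dF); last exact: ctsD.
by rewrite /int /= opprD addrACA.
Qed.

Lemma intZ c f a b : continuous f -> int a b (fun x => c * f x) = c * int a b f.
Proof.
move=> cf; have dF x : is_derive x 1 (c *: prim f) (c * f x).
  by apply: is_deriveZ; exact: primP.
rewrite (intE _ _ _ dF); last by apply: ctsM => //; exact: ctsC.
by rewrite /int /= mulrBr.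
Qed.

Lemma int_cst c a b : int a b (fun=> c) = c * (b - a).
Proof.
have dF x : is_derive x 1 (c *: id) c.
  rewrite -[X in is_derive _ _ _ X]mulr1.
  by apply: (@is_deriveZ _ _ _ id); exact: is_derive_id.
by rewrite (intE _ _ _ dF) ?mulrBr // => x; exact: cvg_cst.
Qed.

Lemma intC f a b : int a b f = - int b a f.
Proof. by rewrite /int opprB. Qed.

Lemma int_split c f a b : int a b f = int a c f + int c b f.
Proof. by rewrite /int; lra. Qed.

Lemma int_bound f a b C : continuous f -> a <= b ->
  (forall x, a <= x <= b -> `|f x| <= C) -> `|int a b f| <= C * (b - a).
Proof. by move=> cf ab fC; apply: (@increment_le _ f) => // x; exact: primP. Qed.

Lemma int_boundC f a b C : continuous f ->
  (forall x, Num.min a b <= x <= Num.max a b -> `|f x| <= C) ->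
  `|int a b f| <= C * `|b - a|.
Proof.
move=> cf; have [ab|/ltW ba] := leP a b => fC.
  by rewrite [`|b - a|]ger0_norm ?subr_ge0 // int_bound.
by rewrite intC normrN (distrC b a) [`|a - b|]ger0_norm ?subr_ge0 // int_bound.
Qed.

Lemma int_ge0 f a b : continuous f -> a <= b ->
  (forall x, a <= x <= b -> 0 <= f x) -> 0 <= int a b f.
Proof.
move=> cf ab f0; have cF : {within `[a, b], continuous (prim f)}.
  by apply: continuous_subspaceT => x; exact: is_derive_cont (primP x cf).
have [c] := MVT_segment ab (fun x _ => primP x cf) cF.
by rewrite in_itv /int /= => /f0 fc ->; rewrite mulr_ge0 ?subr_ge0.
Qed.

Lemma eq_int f g a b : continuous f -> continuous g -> a <= b ->
  (forall x, a <= x <= b -> f x = g x) -> int a b f = int a b g.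
Proof.
move=> cf cg ab fg; apply/eqP; rewrite -subr_eq0 -normr_le0.
have cgN : continuous (fun x => -1 * g x).
  by apply: ctsM => //; exact: ctsC.
rewrite -[- int a b g]mulN1r -intZ // -intD //.
rewrite -(mul0r (b - a)); apply: int_bound => //.
  exact: ctsD.
by move=> x /fg ->; rewrite mulN1r subrr normr0.
Qed.

Lemma is_derive_int f a x : continuous f -> is_derive x 1 (int a ^~ f) (f x).
Proof.
move=> cf; rewrite -[X in is_derive _ _ _ X]subr0.
by apply: is_deriveB; exact: primP.
Qed.

Lemma int_shift f c a b : continuous f ->
  int a b (fun x => f (x + c)) = int (a + c) (b + c) f.
Proof.
move=> cf; have dF x : is_derive x 1 (fun x => prim f (x + c)) (f (x + c)).
  rewrite -[X in is_derive _ _ _ X]mulr1.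
  apply: (@is_derive1_comp _ (prim f) (fun x => x + c)); first exact: primP.
  by rewrite -[X in is_derive _ _ _ X]addr0; apply: is_deriveD.
rewrite (intE _ _ _ dF) //.
by apply: (@cts_comp _ _ _ (fun x => x + c)) => //; apply: ctsD; [exact: cts_id|exact: ctsC].
Qed.

Lemma int_scale f c a b : continuous f ->
  c * int a b (fun x => f (c * x)) = int (c * a) (c * b) f.
Proof.
move=> cf.
have cfc : continuous (fun x => f (c * x)).
  by apply: (@cts_comp _ _ _ (fun x => c * x)) => //; apply: ctsM; [exact: ctsC|exact: cts_id].
have dF x : is_derive x 1 (fun x => prim f (c * x)) (c * f (c * x)).
  rewrite mulrC.
  apply: (@is_derive1_comp _ (prim f) (fun x => c * x)); first exact: primP.
  rewrite -[X in is_derive _ _ _ X]mulr1.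
  by apply: (@is_deriveZ _ _ _ id); exact: is_derive_id.
rewrite -intZ // (intE _ _ _ dF) //; by apply: ctsM => //; exact: ctsC.
Qed.

Lemma is_derive_eps F x d :
  (forall e, 0 < e -> exists2 r, 0 < r &
     forall s, `|s| < r -> `|F (x + s) - F x - s * d| <= e * `|s|) ->
  is_derive x 1 F d.
Proof.
move=> H; have cv : h^-1 *: (F (h *: 1 + x) - F x) @[h --> 0^'] --> d.
  apply/cvgrPdist_le => e e0; have [r r0 rH] := H _ e0.
  near=> h; rewrite [h *: 1]mulr1.
  have h0 : h != 0 by near: h; exact: nbhs_dnbhs_neq.
  have hr : `|h| < r by near: h; exact: dnbhs0_lt.
  have hp : 0 < `|h| by rewrite normr_gt0.
  have -> : h + x = x + h by rewrite addrC.
  rewrite distrC -(ler_pM2r hp) -normrM mulrBl [_ *: _]mulrC mulfVK // (mulrC d).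
  exact: rH.
apply: DeriveDef; first by apply/cvg_ex; exists d.
exact: cvg_lim cv.
Unshelve. all: by end_near. Qed.

End Primitive.

(** * Functionals bounded for the sup norm on a compact set *)

Section Functional.
Variables (R : realType) (T : topologicalType).
Implicit Types (f g : T -> R) (c B e : R).

(* A linear functional bounded for the sup norm over K; linearity is only
   required on continuous functions. *)
Definition bounded_functional (K : set T) (C : R) (L : (T -> R) -> R) :=
  [/\ 0 <= C,
      forall f g, continuous f -> continuous g ->
        L (fun x => f x + g x) = L f + L g,
      forall c f, continuous f -> L (fun x => c * f x) = c * L f &
      forall f B, continuous f -> 0 <= B -> (forall x, K x -> `|f x| <= B) ->
        `|L f| <= C * B].

Variables (K : set T) (C : R) (L : (T -> R) -> R).
Hypotheses (cK : compact K) (bL : bounded_functional K C L).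

Lemma blfD f g : continuous f -> continuous g ->
  L (fun x => f x + g x) = L f + L g.
Proof. by case: bL => _ + _ _; exact. Qed.

Lemma blfZ c f : continuous f -> L (fun x => c * f x) = c * L f.
Proof. by case: bL => _ _ + _; exact. Qed.

Lemma blfB f g : continuous f -> continuous g ->
  L (fun x => f x - g x) = L f - L g.
Proof.
move=> cf cg; rewrite -[- L g]mulN1r -blfZ // -blfD //.
  by congr L; apply/funext => x; rewrite mulN1r.
by apply: ctsM => //; exact: ctsC.
Qed.

Lemma blf_bound f B : continuous f -> 0 <= B -> (forall x, K x -> `|f x| <= B) ->
  `|L f| <= C * B.
Proof. by case: bL => _ _ _; exact. Qed.

Lemma section_cts (P Q : topologicalType) (F : Q -> P -> R) p :
  continuous (fun z => F z.1 z.2) -> continuous (F ^~ p).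
Proof.
move=> cF; apply: (@cts_comp _ _ _ (fun x => (x, p)) (fun z => F z.1 z.2)) => //.
by apply: cts_pair; [exact: cts_id|move=> x; exact: cvg_cst].
Qed.

Lemma section_cts2 (P Q : topologicalType) (F : Q -> P -> R) q :
  continuous (fun z => F z.1 z.2) -> continuous (F q).
Proof.
move=> cF; apply: (@cts_comp _ _ _ (fun x => (q, x)) (fun z => F z.1 z.2)) => //.
by apply: cts_pair; [move=> x; exact: cvg_cst|exact: cts_id].
Qed.

(** A tube lemma: continuity at each [(x, p)] is made uniform in [x] by compactness of [A]. *)
Lemma compact_uniform (Q : topologicalType) (A : set Q) (P : topologicalType)
    (F : Q -> P -> R) (p : P) e : compact A ->
  continuous (fun z => F z.1 z.2) -> 0 < e ->
  \forall p' \near p, forall x, A x -> `|F x p' - F x p| <= e.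
Proof.
move=> cA cF e0; have /compact_near_coveringP cov := cA.
apply: (cov P (nbhs p) (fun p' x => `|F x p' - F x p| <= e)) => x _.
have cG : continuous (fun z => `|F z.1 z.2 - F z.1 p|).
  apply/cts_norm/ctsB => //.
  apply: (@cts_comp _ _ _ (fun z => (z.1, p)) (fun z => F z.1 z.2)) => //.
  by apply: cts_pair; [move=> z; exact: cvg_fst|move=> z; exact: cvg_cst].
have xe : `|F (x, p).1 (x, p).2 - F (x, p).1 p| < e by rewrite /= subrr normr0.
have := cvgr_le _ (cG (x, p)) _ xe.
move=> [[U V] [xU pV] UV]; exists (U, V) => //= z /UV.
Qed.

Lemma blf_continuous (P : topologicalType) (F : T -> P -> R) :
  continuous (fun z => F z.1 z.2) -> continuous (fun p => L (F ^~ p)).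
Proof.
move=> cF p; apply/cvgrPdist_le => e e0.
have C0 : 0 <= C by case: bL.
(* The bound [C] may be 0, hence the denominator [C + 1]. *)
have d0 : 0 < e / (C + 1) by rewrite divr_gt0 // ltr_wpDl.
have := compact_uniform p cK cF d0; apply: filterS => p' H.
rewrite distrC -blfB; [|exact: section_cts|exact: section_cts].
apply: (@le_trans _ _ (C * (e / (C + 1)))).
  apply: blf_bound => //; last exact: ltW.
  by apply: ctsB; exact: section_cts.
rewrite mulrCA -{2}[e]mulr1; apply: ler_wpM2l; first exact: ltW.
by rewrite ler_pdivrMr ?ltr_wpDl // mul1r lerDl.
Qed.

End Functional.

(** * Exchange of functionals with integrals and derivatives *)

Section Exchange.
Variable R : realType.

Lemma int_functional (a b : R) : a <= b ->
  bounded_functional `[a, b]%classic (b - a) (int a b).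
Proof.
move=> ab; split; [by rewrite subr_ge0|by move=> *; exact: intD|by move=> *; exact: intZ|].
move=> f B cf _ fB; rewrite mulrC; exact: int_bound.
Qed.

Lemma int_continuous (P : topologicalType) (F : R -> P -> R) (a b : R) :
  continuous (fun z => F z.1 z.2) -> continuous (fun p => int a b (F ^~ p)).
Proof.
move=> cF; have H (u v : R) : u <= v -> continuous (fun p => int u v (F ^~ p)).
  by move=> uv; apply: (blf_continuous (@segment_compact _ u v) (int_functional uv)).
have [|/ltW /H ba] := leP a b; first exact: H.
have -> : (fun p => int a b (F ^~ p)) = fun p => - int b a (F ^~ p).
  by apply/funext => p; rewrite intC.
exact: ctsN.
Qed.

Variables (T : topologicalType) (K : set T) (C : R) (L : (T -> R) -> R).
Hypotheses (cK : compact K) (bL : bounded_functional K C L).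

Lemma cts_swap (P Q : topologicalType) (F : P -> Q -> R) :
  continuous (fun z => F z.1 z.2) -> continuous (fun z => F z.2 z.1).
Proof.
move=> cF; apply: (@cts_comp _ _ _ (fun z => (z.2, z.1)) (fun z => F z.1 z.2)) => //.
by apply: cts_pair; [move=> z; exact: cvg_snd|move=> z; exact: cvg_fst].
Qed.

(** Both sides vanish for [b = a] and have the same derivative in [b]. For the left side that
    derivative comes from the continuity of [F x t] in [t], uniform over the compact set [K]. *)
Lemma blf_int (F : T -> R -> R) (a b : R) :
  continuous (fun z => F z.1 z.2) ->
  L (fun x => int a b (F x)) = int a b (fun t => L (F ^~ t)).
Proof.
move=> cF; pose G t := L (fun x => int a t (F x)).
have cLF : continuous (fun t => L (F ^~ t)) by exact: (blf_continuous cK bL).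
have cI (u v : R) : continuous (fun x => int u v (F x)).
  by apply: (@int_continuous _ (fun t x => F x t)); exact: cts_swap.
have C0 : 0 <= C by case: bL.
have dG (t : R) : is_derive t 1 G (L (F ^~ t)).
  apply: is_derive_eps => e e0.
  have d0 : 0 < e / (C + 1) by rewrite divr_gt0 // ltr_wpDl.
  have := compact_uniform t cK cF d0 => /nbhs_ballP[r /= r0 rH].
  exists r => // s sr; rewrite /G -(blfB bL) //.
  have -> : (fun x => int a (t + s) (F x) - int a t (F x)) =
            fun x => int t (t + s) (F x).
    by apply/funext => x; rewrite (int_split t) addrC addKr.
  rewrite -(blfZ bL); last exact: section_cts.
  have cs : continuous (fun x => s * F x t).
    by apply: ctsM; [exact: ctsC|exact: (@section_cts _ _ _ F t)].
  rewrite -(blfB bL) //.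
  apply: (@le_trans _ _ (C * (e / (C + 1) * `|s|))).
    apply: (blf_bound bL); first exact: ctsB.
      by rewrite mulr_ge0 // ltW.
    move=> x Kx.
    have -> : int t (t + s) (F x) - s * F x t = int t (t + s) (fun u => F x u - F x t).
      have -> : s * F x t = int t (t + s) (fun=> F x t).
        by rewrite int_cst [t + s]addrC addrK mulrC.
      rewrite -[X in _ - X]mul1r -mulNr -intZ; last exact: ctsC.
      rewrite -intD; last 2 first.
      - exact: section_cts2.
      - by apply: ctsM; exact: ctsC.
      by congr int; apply/funext => u; rewrite mulN1r.
    have -> : `|s| = `|(t + s) - t| by rewrite [t + s]addrC addrK.
    apply: int_boundC; first by apply: ctsB; [exact: section_cts2|exact: ctsC].
    move=> u tu; apply: rH => //; rewrite /ball /=; apply: le_lt_trans sr.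
    move: tu; case: (leP t (t + s)) => ts /andP[u1 u2].
      rewrite lerDl in ts; rewrite distrC [`|s|]ger0_norm // ger0_norm ?subr_ge0 //.
      by rewrite lerBlDl.
    rewrite gtrDl in ts; rewrite [`|s|]ltr0_norm // ger0_norm ?subr_ge0 //.
    by move: u1; lra.
  rewrite mulrA ler_wpM2r // mulrA ler_pdivrMr ?ltr_wpDl //.
  by rewrite mulrC ler_wpM2l ?lerDl // ltW.
have Ga : G a = 0.
  rewrite /G.
  have -> : (fun x => int a a (F x)) = fun x => 0 * F x a.
    by apply/funext => x; rewrite /int subrr mul0r.
  by rewrite (blfZ bL) ?mul0r //; exact: section_cts.
by rewrite (intE _ _ cLF dG) Ga subr0.
Qed.

(* Differentiation under the functional: write the increment of [F x] as the
   integral of its derivative and exchange. *)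
Lemma blf_derive (F F' : T -> R -> R) (t : R) :
  continuous (fun z => F z.1 z.2) -> continuous (fun z => F' z.1 z.2) ->
  (forall x (t : R), is_derive t 1 (F x) (F' x t)) ->
  is_derive t 1 (fun t => L (F ^~ t)) (L (F' ^~ t)).
Proof.
move=> cF cF' dF.
have -> : (fun t => L (F ^~ t)) =
          (fun t => L (F ^~ 0) + int 0 t (fun t => L (F' ^~ t))).
  apply/funext => u; rewrite -blf_int //.
  have -> : L (fun x => int 0 u (F' x)) = L (fun x => F x u - F x 0).
    congr L; apply/funext => x; rewrite (intE _ _ _ (dF x)) //.
    exact: section_cts2.
  by rewrite (blfB bL) ?subrKC //; exact: section_cts.
rewrite -[X in is_derive _ _ _ X]add0r; apply: is_deriveD.
by apply: is_derive_int; exact: (blf_continuous cK bL).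
Qed.

End Exchange.

(** * Iterated integrals over cubes *)

Section Rows.
Variables (R : realType) (m : nat).
Local Notation V := 'rV[R]_m.
Implicit Types (x y : V) (i j : 'I_m) (t M B c : R) (f g : V -> R).

Lemma norm_rV_le x B : 0 <= B -> (`|x| <= B) = [forall i, `|x 0 i| <= B].
Proof.
move=> B0; rewrite [`|x|]mx_normrE; apply/idP/forallP => [/bigmax_leP[_ H] i|H].
  exact: (H (0, i)).
by apply/bigmax_leP; split=> // -[a b] _; rewrite /= ord1.
Qed.

Lemma norm_rV_lt x B : 0 < B -> (`|x| < B) = [forall i, `|x 0 i| < B].
Proof.
move=> B0; rewrite [`|x|]mx_normrE; apply/idP/forallP => [/bigmax_ltP[_ H] i|H].
  exact: (H (0, i)).
by apply/bigmax_ltP; split=> // -[a b] _; rewrite /= ord1.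
Qed.

Lemma coord_le x i : `|x 0 i| <= `|x|.
Proof. by have := norm_rV_le x (normr_ge0 x); rewrite lexx => /esym/forallP. Qed.

Lemma cts_coord i : continuous (fun x => x 0 i).
Proof. exact: coord_continuous. Qed.

Lemma cts_rV (T : topologicalType) (f : T -> V) :
  (forall i, continuous (fun z => f z 0 i)) -> continuous f.
Proof.
move=> cf z; apply/cvgrPdist_lt => e e0.
have H i : \forall z' \near z, `|f z 0 i - f z' 0 i| < e.
  by have /cvgrPdist_lt := cf i z; apply.
have H' : \forall z' \near z, forall i, `|f z 0 i - f z' 0 i| < e by exact: filter_forall.
apply: filterS H' => z' zz'.
by rewrite norm_rV_lt //; apply/forallP => i; rewrite !mxE.
Qed.

Definition upd x i t : V := \row_j (if j == i then t else x 0 j).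

Lemma updE x i t j : upd x i t 0 j = if j == i then t else x 0 j.
Proof. by rewrite mxE. Qed.

Lemma upd_id x i : upd x i (x 0 i) = x.
Proof. by apply/rowP => j; rewrite updE; case: eqP => // ->. Qed.

Lemma updC x i j s t : i != j -> upd (upd x i s) j t = upd (upd x j t) i s.
Proof.
move=> ij; apply/rowP => k; rewrite !updE.
by have [->|//] := eqVneq k j; rewrite eq_sym (negbTE ij).
Qed.

Lemma cts_upd (T : topologicalType) (f : T -> V) (g : T -> R) i :
  continuous f -> continuous g -> continuous (fun z => upd (f z) i (g z)).
Proof.
move=> cf cg; apply: cts_rV => j.
have -> : (fun z => upd (f z) i (g z) 0 j) = if j == i then g else fun z => f z 0 j.
  by apply/funext => z; rewrite updE; case: ifP.
case: ifP => // _; apply: (@cts_comp _ _ _ f (fun x : V => x 0 j)) => //.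
exact: cts_coord.
Qed.

Lemma upd_shift x i t h : h *: delta_mx 0 i + upd x i t = upd x i (h + t).
Proof.
apply/rowP => j; rewrite !mxE eqxx /=.
by case: eqP => _; rewrite ?mulr1 // mulr0 add0r.
Qed.

Definition box M : set V := [set x | `|x| <= M].

Lemma box_compact M : compact (box M).
Proof.
apply: bounded_closed_compact.
  exists M; split; first exact: num_real.
  move=> u Mu x /= xM; exact/(le_trans xM)/ltW.
apply: (@closed_comp _ _ (fun x : V => `|x|) [set t | t <= M]).
  by move=> x _; exact: norm_continuous.
exact: closed_le.
Qed.

Lemma box_upd M x i t : box M x -> `|t| <= M -> box M (upd x i t).
Proof.
rewrite /box /= => xM tM; have M0 := le_trans (normr_ge0 t) tM.
rewrite norm_rV_le //; apply/forallP => j; rewrite updE; case: ifP => // _.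
exact: le_trans (coord_le x j) xM.
Qed.

(** Integrating one coordinate yields again a function on the whole space, constant in that
    coordinate. Once all coordinates are integrated, the base point 0 in [IT] is therefore
    immaterial. *)
Definition Int M i (f : V -> R) x := int (- M) M (fun t => f (upd x i t)).
Definition ItS M (s : seq 'I_m) (f : V -> R) := foldr (Int M) f s.
Definition IT M (f : V -> R) := ItS M (enum 'I_m) f 0.

Lemma ItS_joint (Q : topologicalType) M s (F : Q -> V -> R) :
  continuous (fun z => F z.1 z.2) -> continuous (fun z => ItS M s (F z.1) z.2).
Proof.
move=> cF; elim: s => [//|i s IH] /=.
apply: (@int_continuous _ _ (fun t z => ItS M s (F z.1) (upd z.2 i t))).
apply: (@cts_comp _ _ _ (fun w => (w.2.1, upd w.2.2 i w.1)) (fun z => ItS M s (F z.1) z.2)) => //.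
apply: cts_pair.
  by apply: (@cts_comp _ _ _ snd fst) => z; [exact: cvg_snd|exact: cvg_fst].
apply: cts_upd; last by move=> z; exact: cvg_fst.
by apply: (@cts_comp _ _ _ snd snd) => z; exact: cvg_snd.
Qed.

Lemma ItS_cts M s f : continuous f -> continuous (ItS M s f).
Proof.
move=> cf; apply: (@section_cts2 _ _ _ (fun _ : R => ItS M s f) 0).
apply: (@ItS_joint R M s (fun _ => f)).
by apply: (@cts_comp _ _ _ snd f) => // z; exact: cvg_snd.
Qed.

Lemma cts_updt f x i : continuous f -> continuous (fun t => f (upd x i t)).
Proof.
move=> cf; apply: (@cts_comp _ _ _ (fun t => upd x i t) f) => //.
by apply: cts_upd; [move=> z; exact: cvg_cst|exact: cts_id].
Qed.

(** The base point has to lie in the box because the coordinates outside [s] are still read off from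
    it. With all coordinates integrated the constant is the volume of the cube. *)
Lemma ItS_functional M s x : 0 <= M -> box M x ->
  bounded_functional (box M) ((M + M) ^+ size s) (fun f => ItS M s f x).
Proof.
move=> M0; elim: s x => [|i s IH] x xM /=.
  split=> // f B _ _ fB; rewrite expr0 mul1r; exact: fB.
have IHt t : `|t| <= M -> _ := fun tM => IH _ (box_upd i xM tM).
have MM : - M <= M by rewrite ge0_cp.
have cI f : continuous f -> continuous (fun t => ItS M s f (upd x i t)).
  by move=> cf; apply/cts_updt/ItS_cts.
split.
- by rewrite exprn_ge0 // addr_ge0.
- move=> f g cf cg; rewrite /Int -intD; [|exact: cI|exact: cI].
  apply: eq_int => //.
  + apply: cI; exact: ctsD.
  + by apply: ctsD; exact: cI.
  + by move=> t; rewrite -ler_norml => /IHt /blfD; apply.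
- move=> c f cf; rewrite /Int -intZ; [|exact: cI].
  apply: eq_int => //.
  + by apply: cI; apply: ctsM => //; exact: ctsC.
  + by apply: ctsM; [exact: ctsC|exact: cI].
  + by move=> t; rewrite -ler_norml => /IHt /blfZ; apply.
- move=> f B cf B0 fB.
  have -> : (M + M) ^+ (size s).+1 * B = ((M + M) ^+ size s * B) * (M - - M).
    by rewrite opprK exprS; ring.
  apply: int_bound => //; first exact: cI.
  by move=> t; rewrite -ler_norml => /IHt /blf_bound; apply.
Qed.

Lemma box0 M : 0 <= M -> box M 0.
Proof. by rewrite /box /= normr0. Qed.

Lemma IT_functional M : 0 <= M -> bounded_functional (box M) ((M + M) ^+ m) (IT M).
Proof.
move=> M0; have := ItS_functional (enum 'I_m) M0 (box0 M0).
by rewrite -cardE card_ord.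
Qed.

Lemma ITD M f g : 0 <= M -> continuous f -> continuous g ->
  IT M (fun x => f x + g x) = IT M f + IT M g.
Proof. by move=> M0 cf cg; rewrite (blfD (IT_functional M0)). Qed.

Lemma ITZ M c f : 0 <= M -> continuous f ->
  IT M (fun x => c * f x) = c * IT M f.
Proof. by move=> M0 cf; rewrite (blfZ (IT_functional M0)). Qed.

Lemma ITB M f g : 0 <= M -> continuous f -> continuous g ->
  IT M (fun x => f x - g x) = IT M f - IT M g.
Proof. by move=> M0 cf cg; rewrite (blfB (IT_functional M0)). Qed.

Lemma IT0 M : 0 <= M -> IT M (fun=> 0) = 0.
Proof.
move=> M0; rewrite -[RHS](mul0r (IT M (fun=> 0))) -ITZ //; last exact: ctsC.
by congr IT; apply/funext => x; rewrite mul0r.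
Qed.

Lemma IT_bound M f B : 0 <= M -> continuous f -> 0 <= B ->
  (forall x, box M x -> `|f x| <= B) -> `|IT M f| <= (M + M) ^+ m * B.
Proof. by move=> M0 *; apply: (blf_bound (IT_functional M0)). Qed.

Lemma IT_sum M (I : Type) (r : seq I) (P : pred I) (F : I -> V -> R) : 0 <= M ->
  (forall k, P k -> continuous (F k)) ->
  IT M (fun x => \sum_(k <- r | P k) F k x) = \sum_(k <- r | P k) IT M (F k).
Proof.
move=> M0 cF; elim: r => [|i r IH].
  have -> : (fun x => \sum_(k <- [::] | P k) F k x) = fun=> 0.
    by apply/funext => x; rewrite big_nil.
  by rewrite IT0 // big_nil.
rewrite big_cons -IH; case: ifPn => Pi.
  rewrite -ITD //; last exact: cts_sum; last exact: cF.
  by congr IT; apply/funext => x; rewrite big_cons Pi.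
by congr IT; apply/funext => x; rewrite big_cons (negbTE Pi).
Qed.

Lemma ItS_ge0 M s f x : 0 <= M -> box M x -> continuous f ->
  (forall x, box M x -> 0 <= f x) -> 0 <= ItS M s f x.
Proof.
move=> M0 + cf f0; elim: s x => [|i s IH] x xM /=; first exact: f0.
apply: int_ge0; [exact/cts_updt/ItS_cts|by rewrite ge0_cp|].
by move=> t; rewrite -ler_norml => tM; apply: IH; exact: box_upd.
Qed.

Lemma IT_ge0 M f : 0 <= M -> continuous f -> (forall x, box M x -> 0 <= f x) ->
  0 <= IT M f.
Proof. by move=> M0; exact: ItS_ge0 (box0 M0). Qed.

Lemma IT_le M f g : 0 <= M -> continuous f -> continuous g ->
  (forall x, box M x -> f x <= g x) -> IT M f <= IT M g.
Proof.
move=> M0 cf cg fg; rewrite -subr_ge0 -ITB //; apply: IT_ge0 => //.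
  exact: ctsB.
by move=> x /fg; rewrite subr_ge0.
Qed.

(** Fubini for two coordinates, an instance of [blf_int] whose functional is the integral in the
    other variable. *)
Lemma IntC M i j f : 0 <= M -> continuous f -> Int M i (Int M j f) = Int M j (Int M i f).
Proof.
move=> M0 cf; have [->//|ij] := eqVneq i j; apply/funext => x.
have MM : - M <= M by rewrite ge0_cp.
rewrite /Int; transitivity (int (- M) M (fun t => int (- M) M (fun u => f (upd (upd x i u) j t)))).
  rewrite (@blf_int _ _ _ _ _ (@segment_compact _ (- M) M) (int_functional MM)
    (fun t u => f (upd (upd x i t) j u))) //.
  apply: (@cts_comp _ _ _ (fun z => upd (upd x i z.1) j z.2) f) => //.
  apply: cts_upd; last by move=> z; exact: cvg_snd.
  by apply: cts_upd; [move=> z; exact: cvg_cst|move=> z; exact: cvg_fst].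
by congr int; apply/funext => t; congr int; apply/funext => u; rewrite updC.
Qed.

Lemma ItS_Int M s i f : 0 <= M -> continuous f ->
  ItS M s (Int M i f) = Int M i (ItS M s f).
Proof.
move=> M0 cf; elim: s => [//|j s IH] /=; rewrite IH IntC //; exact: ItS_cts.
Qed.

(** Any chosen coordinate can be made the innermost one, so that [eq_IT_Int] reduces identities
    between multiple integrals to a single variable. *)
Lemma IT_inner M i f : 0 <= M -> continuous f ->
  IT M f = ItS M (rem i (enum 'I_m)) (Int M i f) 0.
Proof.
move=> M0 cf; rewrite /IT; have : i \in enum 'I_m by rewrite mem_enum.
elim: (enum 'I_m) => [//|j s IH]; rewrite inE /=.
have [<- _|ji] := eqVneq j i; first by rewrite ItS_Int.
move=> /= is_.
suff -> : ItS M s f = ItS M (rem i s) (Int M i f) by [].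
rewrite ItS_Int // {IH}; elim: s is_ => [//|k s IH].
rewrite inE /=; have [<-//|ki] := eqVneq k i.
move=> /= /IH ->.
by rewrite IntC //; exact: ItS_cts.
Qed.

Lemma eq_IT_Int M i f g : 0 <= M -> continuous f -> continuous g ->
  Int M i f = Int M i g -> IT M f = IT M g.
Proof. by move=> M0 cf cg fg; rewrite !(IT_inner i) // fg. Qed.

(** With a multiple integral as the functional [L], this is Fubini for the double integral of a
    kernel. *)
Lemma blf_ItS (T : topologicalType) (K : set T) C L M s (F : T -> V -> R) x :
  compact K -> bounded_functional K C L -> continuous (fun z => F z.1 z.2) ->
  L (fun z => ItS M s (F z) x) = ItS M s (fun p => L (F ^~ p)) x.
Proof.
move=> cK bL cF; elim: s x => [//|i s IH] x /=.
rewrite /Int (blf_int cK bL) //.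
  by congr int; apply/funext => t; exact: IH.
apply: (@cts_comp _ _ _ (fun w => (w.1, upd x i w.2)) (fun z => ItS M s (F z.1) z.2)).
  apply: cts_pair => [z|]; first exact: cvg_fst.
  by apply: cts_upd => z; [exact: cvg_cst|exact: cvg_snd].
exact: ItS_joint.
Qed.

Definition vanish M (f : V -> R) := forall x, M <= `|x| -> f x = 0.

Lemma vanishM M f g : vanish M f -> vanish M (fun x => f x * g x).
Proof. by move=> vf x /vf ->; rewrite mul0r. Qed.

Lemma IT_widen M M' f : 0 <= M -> M <= M' -> continuous f -> vanish M f ->
  IT M' f = IT M f.
Proof.
move=> M0 MM' cf vf; rewrite /IT.
(* The second conjunct makes the induction work: a partial integral vanishes as soon as some
   coordinate not yet integrated has modulus at least [M], so the added intervals contribute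
   nothing. *)
suff H s x : uniq s -> ItS M' s f x = ItS M s f x /\
    ((exists2 i, i \notin s & M <= `|x 0 i|) -> ItS M s f x = 0).
  by have [] := H (enum 'I_m) 0 (enum_uniq _).
have N1 : - M' <= - M by rewrite lerN2.
have N2 : - M <= M by rewrite ge0_cp.
elim: s x => [|i s IH] x /=; first by split=> // -[i _ /le_trans Mx]; apply/vf/Mx/coord_le.
move=> /andP[is_ us].
have cs : continuous (fun t => ItS M s f (upd x i t)) by apply/cts_updt/ItS_cts.
have zi t : M <= `|t| -> ItS M s f (upd x i t) = 0.
  by move=> Mt; apply: (IH _ us).2; exists i => //; rewrite updE eqxx.
split.
  rewrite /Int.
  have -> : (fun t => ItS M' s f (upd x i t)) = fun t => ItS M s f (upd x i t).
    by apply/funext => t; exact: (IH _ us).1.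
  rewrite (int_split (- M)) (int_split M _ (- M)).
  have -> : int (- M') (- M) (fun t => ItS M s f (upd x i t)) = int (- M') (- M) (fun=> 0).
    apply: eq_int => //; first exact: ctsC.
    by move=> t /andP[_ tM]; rewrite zi // ler_normr [M <= - t]lerNr tM orbT.
  have -> : int M M' (fun t => ItS M s f (upd x i t)) = int M M' (fun=> 0).
    apply: eq_int => //; first exact: ctsC.
    by move=> t /andP[tM _]; rewrite zi // ler_normr tM.
  by rewrite !int_cst !mul0r add0r addr0.
move=> [j]; rewrite inE negb_or => /andP[ji js] Mj.
rewrite /Int (_ : (fun _ => _) = fun=> 0) ?int_cst ?mul0r //.
apply/funext => t; apply: (IH _ us).2; exists j => //.
by rewrite updE (negbTE ji).
Qed.

End Rows.

(** * Factorisation of invertible matrices into maps that move one coordinate *)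

Section ElementaryGeneration.
Variable F : fieldType.

(** Right multiplication by this matrix changes only the coordinate [j] of a row vector, so that
    one-dimensional substitution applies to it. *)
Definition axis_mx m (w : 'cV[F]_m) (j : 'I_m) : 'M[F]_m :=
  1%:M + w *m (delta_mx 0 j : 'rV[F]_m).

Inductive axis_generated m : 'M[F]_m -> Prop :=
| axis_generated1 : axis_generated 1%:M
| axis_generatedM (w : 'cV[F]_m) j (A : 'M[F]_m) : 1 + w j 0 != 0 -> axis_generated A ->
    axis_generated (axis_mx w j *m A).

Lemma axis_mxE m (w : 'cV[F]_m) j i k :
  axis_mx w j i k = (i == k)%:R + w i 0 * (k == j)%:R.
Proof. by rewrite !mxE big_ord1 !mxE eqxx. Qed.

Lemma det_axis m (w : 'cV[F]_m) j : \det (axis_mx w j) = 1 + w j 0.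
Proof.
rewrite (expand_det_row _ j) (bigD1 j) //= big1 ?addr0; last first.
  move=> k kj; rewrite axis_mxE eq_sym (negbTE kj) mulr0 addr0.
  by rewrite mul0r.
rewrite axis_mxE eqxx mulr1 /cofactor (_ : row' _ _ = 1%:M); last first.
  by apply/matrixP => i k; rewrite !mxE big_ord1 !mxE eqxx (inj_eq lift_inj)
     [lift j k == j]eq_sym (negbTE (neq_lift j k)) mulr0 addr0.
by rewrite det1 mulr1 -signr_odd oddD addbb mulr1.
Qed.

Lemma axis_generated_mul m (A B : 'M[F]_m) :
  axis_generated A -> axis_generated B -> axis_generated (A *m B).
Proof.
move=> gA gB; elim: gA => [|w j C wj _ IH]; first by rewrite mul1mx.
by rewrite -mulmxA; exact: axis_generatedM.
Qed.

Lemma axis_generated_axis m (w : 'cV[F]_m) j :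
  1 + w j 0 != 0 -> axis_generated (axis_mx w j).
Proof.
by move=> wj; rewrite -[axis_mx _ _]mulmx1; apply: axis_generatedM => //; constructor.
Qed.

Lemma delta_rshift m (j : 'I_m) :
  delta_mx 0 (rshift 1 j) = row_mx 0 (delta_mx 0 j) :> 'rV[F]_(1 + m).
Proof.
apply/rowP => k; rewrite !mxE eqxx /=; case: splitP => l kl.
  rewrite !mxE; case: eqP => // kj; move: kl; rewrite kj /= ord1 => /eqP.
  by rewrite addnC addn1.
rewrite !mxE eqxx; congr (_%:R); congr nat_of_bool.
apply/eqP/eqP => [kj|lj]; last by apply/val_inj; rewrite /= kl lj.
by apply/val_inj; move: kl; rewrite kj /= => /addnI.
Qed.

Lemma axis_generated_lift m (A : 'M[F]_m) :
  axis_generated A -> axis_generated (block_mx (1%:M : 'M[F]_1) 0 0 A).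
Proof.
elim=> [|w j B wj _ IH]; first by rewrite -scalar_mx_block; constructor.
have -> : block_mx 1%:M 0 0 (axis_mx w j *m B) =
    axis_mx (col_mx 0 w) (rshift 1 j) *m block_mx (1%:M : 'M[F]_1) 0 0 B.
  have -> : axis_mx (col_mx 0 w) (rshift 1 j) = block_mx (1%:M : 'M[F]_1) 0 0 (axis_mx w j).
    by rewrite /axis_mx delta_rshift mul_col_row !mul0mx mulmx0 scalar_mx_block add_block_mx
         !addr0.
  by rewrite mulmx_block !mul1mx !mul0mx !mulmx0 !addr0 !add0r.
by apply: axis_generatedM => //; rewrite mxE (unsplitK (inr j : 'I_1 + 'I_m)).
Qed.

Lemma axis_generated_urow m (b : 'rV[F]_m) :
  axis_generated (block_mx (1%:M : 'M[F]_1) b 0 1%:M).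
Proof.
rewrite [b]row_sum_delta.
apply: (big_ind (fun x => axis_generated (block_mx (1%:M : 'M[F]_1) x 0 (1%:M : 'M[F]_m)))).
- by rewrite -scalar_mx_block; constructor.
- move=> x y gx gy.
  have -> : block_mx (1%:M : 'M[F]_1) (x + y) 0 (1%:M : 'M[F]_m) =
    block_mx 1%:M y 0 1%:M *m block_mx 1%:M x 0 1%:M.
    by rewrite mulmx_block !mul1mx !mul0mx !mulmx1 !mulmx0 !addr0 !add0r.
  exact: axis_generated_mul.
- move=> j _.
  have -> : block_mx (1%:M : 'M[F]_1) (b 0 j *: delta_mx 0 j) 0 (1%:M : 'M[F]_m) =
     axis_mx (col_mx (b 0 j)%:M 0) (rshift 1 j).
    rewrite /axis_mx delta_rshift mul_col_row !mul0mx mulmx0 scalar_mx_block add_block_mx mul_scalar_mx.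
    by rewrite !addr0 add0r.
  apply: axis_generated_axis.
  by rewrite mxE (unsplitK (inr j : 'I_1 + 'I_m)) mxE addr0 oner_neq0.
Qed.

(** Block elimination: the first column of [A] goes into one axis factor [S], and what remains is
    block triangular with the Schur complement [D], which the induction hypothesis covers. *)
Lemma axis_generated_pivot m (A : 'M[F]_(1 + m)) :
  (forall B : 'M[F]_m, B \in unitmx -> axis_generated B) ->
  A \in unitmx -> A 0 0 != 0 -> axis_generated A.
Proof.
move=> IH uA a0; pose a := A 0 0.
pose b := a^-1 *: ursubmx A; pose c := dlsubmx A; pose D := drsubmx A - c *m b.
pose S := axis_mx (col_mx (a - 1)%:M c) 0.
have SE : S = block_mx a%:M 0 c 1%:M.
  have -> : S = 1%:M + col_mx (a - 1)%:M c *m row_mx 1%:M 0.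
    congr (_ + _ *m _); apply/rowP => k; rewrite !mxE eqxx /=.
    case: splitP => l kl; rewrite !mxE ?ord1; last first.
      by case: eqP => // k0; move: kl; rewrite k0.
    by rewrite eqxx (_ : k = 0) ?eqxx //; apply/val_inj; rewrite /= kl ord1.
  rewrite mul_col_row !mulmx0 !mulmx1 scalar_mx_block add_block_mx !addr0 add0r.
  by congr block_mx; rewrite -raddfD /= subrKC.
have AE : A = S *m block_mx 1%:M b 0 D.
  rewrite SE mulmx_block !mulmx1 !mulmx0 !mul0mx !mul1mx !addr0.
  rewrite -[LHS]submxK; congr block_mx.
  - by apply/matrixP => i j; rewrite !ord1 !mxE eqxx !lshift0.
  - by rewrite mul_scalar_mx scalerA mulfV // scale1r.
  - by rewrite addrC subrK.
have gS : axis_generated S.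
  apply: axis_generated_axis; rewrite -det_axis -/S SE det_lblock det1 mulr1.
  by rewrite det_scalar expr1.
have uD : D \in unitmx.
  move: uA; rewrite AE unitmx_mul => /andP[_]; rewrite !unitmxE.
  by rewrite det_ublock det1 mul1r.
rewrite AE; apply: axis_generated_mul => //.
have -> : block_mx 1%:M b 0 D = block_mx (1%:M : 'M[F]_1) 0 0 D *m block_mx 1%:M b 0 1%:M.
  by rewrite mulmx_block !mul1mx !mul0mx !mulmx0 mulmx1 !addr0 !add0r.
by apply: axis_generated_mul; [exact/axis_generated_lift/IH|exact: axis_generated_urow].
Qed.

Lemma unitmx_axis_generated m (A : 'M[F]_m) : A \in unitmx -> axis_generated A.
Proof.
elim: m A => [|m IH] A uA.
  by rewrite (_ : A = 1%:M); [constructor|apply/matrixP => -[]].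
have [A0|] := eqVneq (A 0 0) 0; last exact: axis_generated_pivot.
have [j Aj] : exists j, A j 0 != 0.
  apply/existsP; apply: contraT; rewrite negb_exists => /forallP H.
  move: uA; rewrite unitmxE (expand_det_col _ 0) big1 ?unitr0 // => i _.
  by have /negPn/eqP -> := H i; rewrite mul0r.
have j0 : j != 0 by apply: contraNneq Aj => ->; rewrite A0.
have uS (t : F) : 1 + (t *: delta_mx 0 0 : 'cV[F]_m.+1) j 0 != 0.
  by rewrite !mxE (negbTE j0) /= mulr0 addr0 oner_neq0.
(* The inner factor adds row [j] to row 0 and so creates a nonzero pivot; the outer factor undoes
   this. *)
have AE : A = axis_mx (- 1 *: delta_mx 0 0) j *m (axis_mx (1 *: delta_mx 0 0) j *m A).
  rewrite mulmxA (_ : _ *m axis_mx _ _ = 1%:M) ?mul1mx //.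
  rewrite /axis_mx mulmxDl !mulmxDr !mul1mx mulmx1 -addrA.
  rewrite mulmxA -[_ *m _ *m (_ *: _)]mulmxA -scalemxAr.
  rewrite mul_delta_mx_cond (negbTE j0) mulr0n scaler0 mulmx0 mul0mx addr0.
  by rewrite scale1r scaleN1r mulNmx subrr addr0.
rewrite AE; apply: axis_generatedM => //.
apply: axis_generated_pivot => //.
  rewrite unitmx_mul uA andbT unitmxE det_axis unitfE; exact: uS.
rewrite mxE (bigD1 0) //= (bigD1 j) //= big1 ?addr0; last first.
  move=> k /andP[k0 kj]; rewrite axis_mxE !mxE eqxx (negbTE kj) eq_sym (negbTE k0).
  by rewrite mulr0 addr0 mul0r.
rewrite !axis_mxE A0 mulr0 add0r [0 == j]eq_sym (negbTE j0) add0r !mxE !eqxx.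
by rewrite !mulr1 mul1r.
Qed.

End ElementaryGeneration.

(** * Linear changes of variables *)

Section LinearChange.
Variable R : realType.

Lemma int_supported (g : R -> R) (p q p' q' : R) : continuous g ->
  (forall t, t <= p \/ q <= t -> g t = 0) ->
  (forall t, t <= p' \/ q' <= t -> g t = 0) -> int p q g = int p' q' g.
Proof.
move=> cg g0 g0'.
have z u v : (forall t, Num.min u v <= t <= Num.max u v -> g t = 0) -> int u v g = 0.
  move=> H; apply/eqP; rewrite -normr_le0 -(mul0r `|v - u|).
  by apply: int_boundC => // t /H ->; rewrite normr0.
rewrite (int_split p') (int_split q' g p') addrA z ?add0r; last first.
  move=> t /andP[_]; rewrite le_max => /orP[] ?; [apply: g0|apply: g0']; by left.
rewrite [X in _ + X]z ?addr0 // => t /andP[+ _].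
by rewrite ge_min => /orP[] ?; [apply: g0'|apply: g0]; right.
Qed.

Lemma int_affine (g : R -> R) (a c M : R) : continuous g -> a != 0 -> 0 <= M ->
  (forall t, M <= `|t| -> g t = 0) -> (forall t, M <= `|t| -> g (a * t + c) = 0) ->
  `|a| * int (- M) M (fun t => g (a * t + c)) = int (- M) M g.
Proof.
move=> cg a0 M0 g0 ga0.
have E : a * int (- M) M (fun t => g (a * t + c)) = int (a * - M + c) (a * M + c) g.
  rewrite (@int_scale _ (fun t => g (t + c))) ?(@int_shift _ g) //.
  by apply: (@cts_comp _ _ _ (fun t => t + c)) => //; apply: ctsD; [exact: cts_id|exact: ctsC].
have g1 t : t <= - M \/ M <= t -> g t = 0.
  by case=> tM; apply: g0; rewrite ler_normr ?tM // lerNr tM orbT.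
have g2 t : t <= - `|a| * M + c \/ `|a| * M + c <= t -> g t = 0.
  move=> H; have -> : t = a * ((t - c) / a) + c by rewrite mulrC divfK // subrK.
  apply: ga0; rewrite normrM normfV ler_pdivlMr ?normr_gt0 // ler_normr.
  by apply/orP; case: H => H; [right|left]; rewrite mulrC; lra.
(* For [a < 0] the affine map reverses the interval; the orientation of [int] absorbs the sign, and
   [|a|] results. *)
move: E; have [a_gt|a_lt|/esym/eqP] := ltgtP 0 a; last by rewrite (negbTE a0).
- rewrite gtr0_norm // => ->; apply: int_supported => // t H.
  by apply: g2; rewrite gtr0_norm // mulNr -mulrN.
- rewrite ltr0_norm // mulNr => ->; rewrite -intC; apply: int_supported => // t H.
  by apply: g2; rewrite ltr0_norm // opprK mulNr -mulrN.
Qed.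

Variable m : nat.
Implicit Types (x : 'rV[R]_m) (A B : 'M[R]_m) (f : 'rV[R]_m -> R) (M : R).

Lemma mulmx_norm x A : `|x *m A| <= `|x| * (\sum_i \sum_j `|A i j|).
Proof.
have S0 : 0 <= \sum_i \sum_j `|A i j| by rewrite !sumr_ge0 // => i _; rewrite sumr_ge0.
rewrite norm_rV_le ?mulr_ge0 //; apply/forallP => j; rewrite mxE.
apply: (le_trans (ler_norm_sum _ _ _)); rewrite mulr_sumr; apply: ler_sum => i _.
rewrite normrM ler_pM ?coord_le // (bigD1 j) //= lerDl sumr_ge0 //.
Qed.

Lemma cts_mulmx A : continuous (fun x => x *m A).
Proof.
apply: cts_rV => j.
have -> : (fun x => (x *m A) 0 j) = fun x => \sum_i x 0 i * A i j.
  by apply/funext => x; rewrite mxE.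
by apply: cts_sum => i _; apply: ctsM; [exact: cts_coord|exact: ctsC].
Qed.

Lemma vanish_unit A f M : 0 <= M -> A \in unitmx -> vanish M f ->
  exists2 M', M <= M' & vanish M' (fun x => f (x *m A)).
Proof.
move=> M0 uA vf; pose C := \sum_i \sum_j `|invmx A i j|.
exists (Num.max M (M * C)); first by rewrite le_max lexx.
move=> x; rewrite ge_max => /andP[Mx MCx].
(* [C = 0] makes the inverse of [A] zero, which happens only in dimension 0. *)
have [C0|C0] := eqVneq C 0.
  have := mulmx_norm (x *m A) (invmx A); rewrite mulmxK // -/C C0 mulr0 normr_le0.
  by move=> /eqP x0; apply: vf; move: Mx; rewrite x0 mul0mx !normr0.
apply: vf; have C_gt : 0 < C.
  by rewrite lt_neqAle eq_sym C0 /C !sumr_ge0 // => i _; rewrite sumr_ge0.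
rewrite -(ler_pM2r C_gt); apply: le_trans MCx _.
by have := mulmx_norm (x *m A) (invmx A); rewrite mulmxK.
Qed.

Definition changes_by A := forall f M, 0 <= M -> continuous f -> vanish M f ->
  vanish M (fun x => f (x *m A)) -> `|\det A| * IT M (fun x => f (x *m A)) = IT M f.

Lemma vanish_le M M' f : M <= M' -> vanish M f -> vanish M' f.
Proof. by move=> MM vf x /(le_trans MM); exact: vf. Qed.

Lemma changes_mul A B : A \in unitmx -> B \in unitmx ->
  changes_by A -> changes_by B -> changes_by (A *m B).
Proof.
move=> uA uB cA cB f M M0 cf vf vfAB.
have cfB : continuous (fun x => f (x *m B)) by apply: cts_comp => //; exact: cts_mulmx.
have cfAB : continuous (fun x => f (x *m A *m B)).
  by apply: (@cts_comp _ _ _ (fun x => x *m A) (fun x => f (x *m B))) => //; exact: cts_mulmx.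
have EAB : (fun x => f (x *m (A *m B))) = fun x => f (x *m A *m B).
  by apply/funext => x; rewrite mulmxA.
(* The intermediate function may be nonzero outside the given cube, so both changes are carried out
   in a larger one. *)
have [M' MM' vfB] := vanish_unit M0 uB vf.
have M'0 := le_trans M0 MM'.
rewrite EAB in vfAB *.
rewrite -(IT_widen M0 MM' cf vf) -(IT_widen M0 MM' cfAB vfAB) det_mulmx normrM.
rewrite (mulrC `|\det A|) -mulrA (cA (fun x => f (x *m B)) M') //; last exact: vanish_le vfAB.
by rewrite cB //; exact: vanish_le vf.
Qed.

(** On lines parallel to the axis [j] the map is affine with slope [1 + w j 0], which is also its
    determinant. *)
Lemma changes_axis (w : 'cV[R]_m) j : 1 + w j 0 != 0 -> changes_by (axis_mx w j).
Proof.
move=> wj f M M0 cf vf vfA; rewrite det_axis.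
have cfA : continuous (fun x => f (x *m axis_mx w j)) by apply: cts_comp => //; exact: cts_mulmx.
rewrite -ITZ //; apply: (@eq_IT_Int _ _ _ j) => //.
  by apply: ctsM => //; exact: ctsC.
apply/funext => x; rewrite /Int.
pose c := \sum_(i | i != j) x 0 i * w i 0.
have E t : upd x j t *m axis_mx w j = upd x j ((1 + w j 0) * t + c).
  apply/rowP => k; rewrite !mxE (bigD1 j) //= axis_mxE updE eqxx.
  have [->|kj] := eqVneq k j.
    rewrite /= ?eqxx mulr1 [t * _]mulrC; congr (_ + _); apply: eq_bigr => i ij.
    by rewrite axis_mxE updE (negbTE ij) add0r eqxx mulr1.
  rewrite /= mulr0 addr0 mulr0 add0r (bigD1 k) //= big1 ?addr0.
    by rewrite axis_mxE updE eqxx (negbTE kj) mulr0 addr0 mulr1.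
  move=> i /andP[ij ik]; rewrite axis_mxE (negbTE ik) (negbTE kj) mulr0 addr0.
  by rewrite mulr0.
have -> : (fun t => `|1 + w j 0| * f (upd x j t *m axis_mx w j)) =
    fun t => `|1 + w j 0| * f (upd x j ((1 + w j 0) * t + c)).
  by apply/funext => t; rewrite E.
have cg : continuous (fun t => f (upd x j t)) by exact: cts_updt.
rewrite intZ; last first.
  apply: (@cts_comp _ _ _ (fun t => (1 + w j 0) * t + c) (fun t => f (upd x j t))) => //.
  by apply: ctsD; [apply: ctsM; [exact: ctsC|exact: cts_id]|exact: ctsC].
have cu y t : M <= `|t| -> M <= `|upd y j t|.
  by move=> Mt; apply: le_trans Mt _; have := coord_le (upd y j t) j; rewrite updE eqxx.
apply: (int_affine (g := fun t => f (upd x j t))) => // t Mt; first exact/vf/cu.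
by have := vfA _ (cu x _ Mt); rewrite E.
Qed.

Lemma changes_unit A : A \in unitmx -> changes_by A.
Proof.
move=> /unitmx_axis_generated; elim=> [|w j B wj gB cB].
  move=> f M M0 cf vf _; rewrite det1 normr1 mul1r.
  by congr IT; apply/funext => x; rewrite mulmx1.
have uw : axis_mx w j \in unitmx by rewrite unitmxE det_axis unitfE.
apply: changes_mul => //; last exact: changes_axis.
elim: gB => [|v k D vk _ uD]; first exact: unitmx1.
by rewrite unitmx_mul uD unitmxE det_axis unitfE vk.
Qed.

Lemma IT_mulmx A f M : `|\det A| = 1 -> 0 <= M -> continuous f -> vanish M f ->
  vanish M (fun x => f (x *m A)) -> IT M (fun x => f (x *m A)) = IT M f.
Proof.
move=> dA M0 cf vf vfA; rewrite -(changes_unit _ M0 cf vf vfA) ?dA ?mul1r //.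
by rewrite unitmxE unitfE -normr_gt0 dA.
Qed.

Lemma IT_dilate (b : R) f M : 0 < b -> 0 <= M -> continuous f -> vanish M f ->
  vanish M (fun x => f (b^-1 *: x)) -> IT M (fun x => f (b^-1 *: x)) = b ^+ m * IT M f.
Proof.
move=> b0 M0 cf vf vfb.
have E : (fun x => f (b^-1 *: x)) = fun x => f (x *m b^-1%:M).
  by apply/funext => x; rewrite mul_mx_scalar.
rewrite E in vfb *; have ub : (b^-1)%:M \in @unitmx R m.
  by rewrite unitmxE det_scalar unitfE expf_neq0 // invr_neq0 // gt_eqF.
rewrite -[in RHS](changes_unit ub M0 cf vf vfb) det_scalar.
rewrite ger0_norm ?exprn_ge0 ?invr_ge0 ?ltW // mulrA -exprMn divff ?gt_eqF //.
by rewrite expr1n mul1r.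
Qed.

End LinearChange.

(** * Differentiability and partial derivatives *)

Section PartialCalculus.
Variables (R : realType) (m : nat).
Local Notation V := 'rV[R]_m.
Implicit Types (x v : V) (i j : 'I_m) (t : R) (f g : V -> R) (c : 'I_m -> R).

Definition linear_form c (h : V) : R := \sum_i h 0 i * c i.

Fact linear_form_is_linear c : linear (linear_form c).
Proof.
move=> a u v; rewrite /linear_form /= scaler_sumr -big_split /=.
by apply: eq_bigr => i _; rewrite !mxE mulrDl -mulrA.
Qed.

HB.instance Definition _ c :=
  GRing.isLinear.Build R V R _ (linear_form c) (linear_form_is_linear c).

Lemma cts_linear_form c : continuous (linear_form c).
Proof. by apply: cts_sum => i _; apply: ctsM; [exact: cts_coord|exact: ctsC]. Qed.

Definition D i f : V -> R := 'D_(delta_mx 0 i) f.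

Lemma is_derive_upd f x i t : derivable f (upd x i t) (delta_mx 0 i) ->
  is_derive t 1 (fun t => f (upd x i t)) (D i f (upd x i t)).
Proof.
have E : (fun h : R => h^-1 *: (((fun t => f (upd x i t)) \o shift t) (h *: 1) - f (upd x i t))) =
         fun h => h^-1 *: ((f \o shift (upd x i t)) (h *: delta_mx 0 i) - f (upd x i t)).
  by apply/funext => h; rewrite /= upd_shift [h *: 1]mulr1.
move=> df; apply: DeriveDef; first by rewrite /derivable E.
by rewrite /D /derive E.
Qed.

Lemma derivable_upd f x i t :
  derivable (fun t => f (upd x i t)) t 1 -> derivable f (upd x i t) (delta_mx 0 i).
Proof.
have E : (fun h : R => h^-1 *: (((fun t => f (upd x i t)) \o shift t) (h *: 1) - f (upd x i t))) =
         fun h => h^-1 *: ((f \o shift (upd x i t)) (h *: delta_mx 0 i) - f (upd x i t)).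
  by apply/funext => h; rewrite /= upd_shift [h *: 1]mulr1.
by rewrite /derivable E.
Qed.

(* Change the coordinates one at a time and apply the mean value theorem to
   each of the increments. *)
Lemma partial_increment f x (e r : R) : 0 < e -> 0 < r ->
  (forall y i, `|y - x| < r -> derivable f y (delta_mx 0 i)) ->
  (forall y i, `|y - x| < r -> `|D i f y - D i f x| <= e) ->
  forall h, `|h| < r ->
    `|f (x + h) - f x - \sum_i h 0 i * D i f x| <= e * \sum_i `|h 0 i|.
Proof.
move=> e0 r0 df Df h hr.
pose z (s : seq 'I_m) : V := \row_j (if j \in s then x 0 j + h 0 j else x 0 j).
suff H s : uniq s ->
    `|f (z s) - f x - \sum_(i <- s) h 0 i * D i f x| <= e * \sum_(i <- s) `|h 0 i|.
  have := H (index_enum 'I_m) (index_enum_uniq _).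
  rewrite (_ : z _ = x + h) //; apply/rowP => j.
  by rewrite !mxE mem_index_enum.
elim: s => [_|i s IH /= /andP[is_ us]].
  rewrite !big_nil (_ : z _ = x) ?subrr ?subr0 ?normr0 ?mulr0 //.
  by apply/rowP => j; rewrite mxE.
rewrite !big_cons.
have zE : z (i :: s) = upd (z s) i (x 0 i + h 0 i).
  by apply/rowP => j; rewrite !mxE in_cons; case: eqP => [->|].
have zi : z s = upd (z s) i (x 0 i).
  apply/rowP => j; rewrite !mxE; case: eqP => // ->.
  by rewrite (negbTE is_).
have zr t : `|t| <= `|h 0 i| -> `|upd (z s) i (x 0 i + t) - x| < r.
  move=> th; apply: le_lt_trans hr; rewrite norm_rV_le //; apply/forallP => j.
  rewrite !mxE; have [->|ji] := eqVneq j i.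
    by rewrite addrC addKr; apply: le_trans th (coord_le _ _).
  by case: ifP => _; rewrite ?subrr ?normr0 // addrC addKr coord_le.
pose F t := f (upd (z s) i (x 0 i + t)) - t * D i f x.
have dF t : `|t| <= `|h 0 i| ->
    is_derive t 1 F (D i f (upd (z s) i (x 0 i + t)) - D i f x).
  move=> th; apply: is_deriveB.
    rewrite -[X in is_derive _ _ _ X]mulr1.
    apply: (@is_derive1_comp _ (fun t => f (upd (z s) i t)) (fun t => x 0 i + t)).
      by apply: is_derive_upd; apply/df/zr.
    by rewrite -[X in is_derive _ _ _ X]add0r; apply: is_deriveD.
  rewrite -[X in is_derive _ _ _ X]mul1r.
  have -> : (fun t => t * D i f x) = D i f x *: id.
    by apply/funext => u; rewrite mulrC.
  by rewrite mul1r -[X in is_derive _ _ _ X]mulr1; apply: is_deriveZ.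
have mvt a b : a <= b -> `|a| <= `|h 0 i| -> `|b| <= `|h 0 i| ->
    `|F b - F a| <= e * `|b - a|.
  move=> ab ha hb.
  have le t : t \in `[a, b] -> `|t| <= `|h 0 i|.
    rewrite in_itv /= => /andP[a1 b1]; move: ha hb; rewrite !ler_norml.
    by move=> /andP[? ?] /andP[? ?]; apply/andP; split; lra.
  have cF : {within `[a, b], continuous F}.
    apply/continuous_in_subspaceT => t; rewrite inE /= => /le /dF.
    exact: is_derive_cont.
  have dF' t : t \in `]a, b[ -> is_derive t 1 F (D i f (upd (z s) i (x 0 i + t)) - D i f x).
    by move=> /subset_itv_oo_cc /le; exact: dF.
  have [t /le th ->] := MVT_segment ab dF' cF.
  by rewrite normrM ler_wpM2r //; apply/Df/zr.
have step : `|F (h 0 i) - F 0| <= e * `|h 0 i|.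
  have [h0|/ltW h0] := leP 0 (h 0 i).
    by rewrite -[X in _ <= e * `|X|]subr0; apply: mvt; rewrite ?normr0.
  by have := mvt _ _ h0; rewrite distrC sub0r normrN normr0; apply.
move: step; rewrite {1 2}/F -zE addr0 -zi mul0r subr0 => step.
rewrite mulrDr.
have -> : f (z (i :: s)) - f x - (h 0 i * D i f x + \sum_(j <- s) h 0 j * D j f x) =
  (f (z (i :: s)) - h 0 i * D i f x - f (z s)) +
  (f (z s) - f x - \sum_(j <- s) h 0 j * D j f x) by ring.
by apply: le_trans (ler_normD _ _) (lerD step (IH us)).
Qed.

(** Continuity of the partial derivatives is asked at [x] alone, so that the criterion also serves
    functions that are regular only on an open set. *)
Lemma differentiable_partial f x :
  (\forall y \near x, forall i, derivable f y (delta_mx 0 i)) ->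
  (forall i, {for x, continuous (D i f)}) -> differentiable f x.
Proof.
move=> df cD; pose df0 := linear_form (fun i => D i f x).
suff E : (f : V -> R^o) \o shift x = cst (f x) + (df0 : V -> R^o) +o_ (0 : V) (id : V -> V).
  have dE := diff_unique (@cts_linear_form _) E.
  apply/diff_locallyP; rewrite dE; split; last exact: E.
  exact: cts_linear_form.
apply/eqaddoP => e e0.
have m1 : 0 < (m%:R + 1 : R) by rewrite ltr_wpDl.
have d0 : 0 < e / (m%:R + 1) by rewrite divr_gt0.
have Hi i : \forall y \near x, `|D i f y - D i f x| <= e / (m%:R + 1).
  have /cvgrPdist_le/(_ _ d0) := cD i.
  by apply: filterS => y; rewrite distrC.
have H : \forall y \near x, forall i, `|D i f y - D i f x| <= e / (m%:R + 1).
  by apply: (@filter_forall _ _ (fun i y => `|D i f y - D i f x| <= e / (m%:R + 1)) (nbhs x)).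
have [r /= r0 rH] := (nbhs_ballP _ _).1 (filterI df H).
have B y : `|y - x| < r -> ball x r y by rewrite -ball_normE /= distrC.
have inc := @partial_increment f x _ r d0 r0 (fun y i yr => (rH y (B y yr)).1 i)
    (fun y i yr => (rH y (B y yr)).2 i).
apply/nbhs_ballP; exists r => //= h; rewrite -ball_normE /= sub0r normrN => hr.
rewrite !fctE /= [h + x]addrC opprD addrA; apply: (le_trans (inc h hr)).
rewrite -mulrA ler_pM2l // mulrC ler_pdivrMr //.
apply: (@le_trans _ _ (\sum_(i < m) `|h|)).
  by apply: ler_sum => i _; exact: coord_le.
by rewrite sumr_const card_ord -[leLHS]mulr_natr ler_wpM2l // lerDl.
Qed.

(** Regularity is tracked to second order on the whole space: brackets of [C2] functions are [C1],
    which is what integration by parts consumes. *)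
Definition C1 f := (forall x, differentiable f x) /\ forall i, continuous (D i f).
Definition C2 f := C1 f /\ forall i, C1 (D i f).

Lemma C1_partial f : (forall i x, derivable f x (delta_mx 0 i)) ->
  (forall i, continuous (D i f)) -> C1 f.
Proof.
move=> df cD; split=> // x; apply: differentiable_partial => [|i]; last exact: cD.
by near=> y => i.
Unshelve. all: by end_near. Qed.

Lemma C1_cts f : C1 f -> continuous f.
Proof. by move=> [df _] x; exact: differentiable_continuous. Qed.

Lemma C1_derivable f x v : C1 f -> derivable f x v.
Proof. by move=> [df _]; exact: diff_derivable. Qed.

Lemma C1_D f i : C1 f -> continuous (D i f).
Proof. by case. Qed.

Lemma C2_C1 f : C2 f -> C1 f. Proof. by case. Qed.

Lemma C2_D f i : C2 f -> C1 (D i f). Proof. by case. Qed.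

Lemma C1_upd f x i t : C1 f -> is_derive t 1 (fun t => f (upd x i t)) (D i f (upd x i t)).
Proof. by move=> cf; apply: is_derive_upd; exact: C1_derivable. Qed.

Lemma D_cst (a : R) i : D i (fun=> a) = fun=> 0.
Proof. by apply/funext => x; exact: derive_cst. Qed.

Lemma D_add f g i : C1 f -> C1 g ->
  D i (fun x => f x + g x) = fun x => D i f x + D i g x.
Proof. by move=> cf cg; apply/funext => x; apply: deriveD; exact: C1_derivable. Qed.

Lemma D_opp f i : C1 f -> D i (fun x => - f x) = fun x => - D i f x.
Proof. by move=> cf; apply/funext => x; apply: deriveN; exact: C1_derivable. Qed.

Lemma D_mul f g i : C1 f -> C1 g ->
  D i (fun x => f x * g x) = fun x => D i f x * g x + f x * D i g x.
Proof.
move=> cf cg; apply/funext => x; rewrite [LHS]deriveM; try exact: C1_derivable.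
by rewrite addrC [_ *: _]mulrC.
Qed.

Lemma D_coord i j : D i (fun x => x 0 j) = fun=> (i == j)%:R.
Proof.
apply/funext => x; rewrite /D deriveE; last exact: differentiable_coord.
have lin : linear (fun x : V => x 0 j) by move=> a u v; rewrite !mxE.
pose L := GRing.isLinear.Build R V R _ (fun x : V => x 0 j) lin.
pose l : {linear V -> R} := HB.pack (fun x : V => x 0 j) L.
rewrite (@diff_lin _ _ _ l x) /=; last exact: cts_coord.
by rewrite mxE eqxx eq_sym.
Qed.

Lemma C1_cst (a : R) : C1 (fun=> a).
Proof. by split=> [x|i]; [exact: differentiable_cst|rewrite D_cst; exact: ctsC]. Qed.

Lemma C1_add f g : C1 f -> C1 g -> C1 (fun x => f x + g x).
Proof.
move=> cf cg; split=> [x|i].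
  by apply: differentiableD; [case: cf|case: cg].
by rewrite D_add //; apply: ctsD; exact: C1_D.
Qed.

Lemma C1_opp f : C1 f -> C1 (fun x => - f x).
Proof.
move=> cf; split=> [x|i]; first by apply: differentiableN; case: cf.
by rewrite D_opp //; apply: ctsN; exact: C1_D.
Qed.

Lemma C1_sub f g : C1 f -> C1 g -> C1 (fun x => f x - g x).
Proof. by move=> cf cg; apply: C1_add => //; exact: C1_opp. Qed.

Lemma C1_mul f g : C1 f -> C1 g -> C1 (fun x => f x * g x).
Proof.
move=> cf cg; split=> [x|i].
  by apply: differentiableM; [case: cf|case: cg].
rewrite D_mul //; apply: ctsD; apply: ctsM;
  by [exact: C1_D|exact: C1_cts].
Qed.

Lemma C1_coord j : C1 (fun x => x 0 j).
Proof.
split=> [x|i]; first exact: differentiable_coord.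
by rewrite D_coord; exact: ctsC.
Qed.

Lemma C2_cst (a : R) : C2 (fun=> a).
Proof. by split=> [|i]; [|rewrite D_cst]; exact: C1_cst. Qed.

Lemma C2_coord j : C2 (fun x => x 0 j).
Proof. by split=> [|i]; [exact: C1_coord|rewrite D_coord; exact: C1_cst]. Qed.

Lemma C2_add f g : C2 f -> C2 g -> C2 (fun x => f x + g x).
Proof.
move=> [cf cDf] [cg cDg]; split=> [|i]; first exact: C1_add.
by rewrite D_add //; apply: C1_add.
Qed.

Lemma C2_opp f : C2 f -> C2 (fun x => - f x).
Proof.
move=> [cf cDf]; split=> [|i]; first exact: C1_opp.
by rewrite D_opp //; apply: C1_opp.
Qed.

Lemma C2_mul f g : C2 f -> C2 g -> C2 (fun x => f x * g x).
Proof.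
move=> [cf cDf] [cg cDg]; split=> [|i]; first exact: C1_mul.
by rewrite D_mul //; apply: C1_add; apply: C1_mul.
Qed.

Lemma C1_sum (I : Type) (s : seq I) (F : I -> V -> R) :
  (forall k, C1 (F k)) -> C1 (fun x => \sum_(k <- s) F k x) /\
  forall i, D i (fun x => \sum_(k <- s) F k x) = fun x => \sum_(k <- s) D i (F k) x.
Proof.
move=> cF; elim: s => [|k s [IH IHD]].
  have -> : (fun x => \sum_(k <- [::]) F k x) = fun=> 0.
    by apply/funext => x; rewrite big_nil.
  split=> [|i]; first exact: C1_cst.
  by rewrite D_cst; apply/funext => x; rewrite big_nil.
have -> : (fun x => \sum_(k <- k :: s) F k x) = fun x => F k x + \sum_(k <- s) F k x.
  by apply/funext => x; rewrite big_cons.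
split=> [|i]; first exact: C1_add.
by rewrite D_add // IHD; apply/funext => x; rewrite big_cons.
Qed.

Lemma C2_sum (I : Type) (s : seq I) (F : I -> V -> R) :
  (forall k, C2 (F k)) -> C2 (fun x => \sum_(k <- s) F k x).
Proof.
move=> cF; have [cS DS] := C1_sum s (fun k => C2_C1 (cF k)).
by split=> // i; rewrite DS; apply: (proj1 (C1_sum s _)) => k; exact: C2_D.
Qed.

Definition deriv_of (g g' : R -> R) := forall t, is_derive t 1 g (g' t).

Lemma D_comp (g g' : R -> R) f i : deriv_of g g' -> C1 f ->
  D i (fun x => g (f x)) = fun x => g' (f x) * D i f x.
Proof.
move=> dg cf; apply/funext => x.
have dc : is_derive (x 0 i) 1 (fun t => g (f (upd x i t)))
    (g' (f (upd x i (x 0 i))) * D i f (upd x i (x 0 i))).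
  apply: (@is_derive1_comp _ g (fun t => f (upd x i t))); first exact: dg.
  exact: C1_upd.
have df : derivable (fun x => g (f x)) (upd x i (x 0 i)) (delta_mx 0 i).
  by apply: derivable_upd; case: dc.
have [_ e1] := is_derive_upd df; have [_ e2] := dc.
by move: e2; rewrite e1 upd_id.
Qed.

Lemma C1_comp (g g' : R -> R) f : deriv_of g g' -> continuous g' -> C1 f ->
  C1 (fun x => g (f x)).
Proof.
move=> dg cg' cf; split=> [x|i].
  apply: (@differentiable_comp _ _ _ _ f g); first by case: cf.
  by apply/derivable1_diffP; case: (dg (f x)).
rewrite (D_comp _ dg) //; apply: ctsM; last exact: C1_D.
by apply: (@cts_comp _ _ _ f g') => //; exact: C1_cts.
Qed.

Lemma C2_comp (g g' g'' : R -> R) f : deriv_of g g' -> deriv_of g' g'' ->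
  continuous g'' -> C2 f -> C2 (fun x => g (f x)).
Proof.
move=> dg dg' cg'' [cf cDf].
have cg' : continuous g' by move=> t; exact: is_derive_cont (dg' t).
split=> [|i]; first exact: C1_comp dg _ _.
rewrite (D_comp _ dg) //; apply: C1_mul => //; exact: C1_comp dg' _ _.
Qed.

Lemma diff_partial f x v : differentiable f x -> 'd f x v = \sum_i v 0 i * D i f x.
Proof.
move=> df; rewrite [v in LHS]row_sum_delta linear_sum /=; apply: eq_bigr => i _.
by rewrite linearZ /= /D deriveE.
Qed.

End PartialCalculus.

(** * The chain rule along curves *)

Section ChainRule.
Variables (R : realType) (m : nat).
Local Notation V := 'rV[R]_m.
Implicit Types (x v p : V) (i j : 'I_m) (t M : R) (f g : V -> R).

Lemma differentiable_rV (U : normedModType R) (h : U -> V) (u : U) :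
  (forall i, differentiable (fun z => h z 0 i) u) -> differentiable h u.
Proof.
move=> dh.
have -> : h = \sum_(i < m) (fun z => h z 0 i *: delta_mx 0 i).
  by apply/funext => z; rewrite fct_sumE -row_sum_delta.
by apply: differentiable_sum => i; apply: differentiableZl.
Qed.

Lemma chain_curve f (h : R -> V) (h' : 'I_m -> R) t :
  differentiable f (h t) -> (forall i, is_derive t 1 (fun u => h u 0 i) (h' i)) ->
  is_derive t 1 (fun u => f (h u)) (\sum_i h' i * D i f (h t)).
Proof.
move=> df dh.
have dht : differentiable h t.
  by apply: differentiable_rV => i; apply/derivable1_diffP; case: (dh i).
have dfh : differentiable (fun u => f (h u)) t by exact: (differentiable_comp dht df).
apply: DeriveDef; first exact/derivable1_diffP.
rewrite deriveE // (@diff_comp _ _ _ _ h f) //= diff_partial //.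
apply: eq_bigr => i _; congr (_ * _).
rewrite -deriveE // derive_mx; last exact/derivable1_diffP.
by rewrite mxE; case: (dh i).
Qed.

End ChainRule.

(** * Integration by parts, derivatives under the integral, symmetry of second derivatives *)

Section Calculus.
Variables (R : realType) (m : nat).
Local Notation V := 'rV[R]_m.
Implicit Types (x v p : V) (i j : 'I_m) (t M : R) (f g : V -> R).

Lemma D_upd (k : V -> R) i x (d : R) :
  is_derive (x 0 i) 1 (fun t => k (upd x i t)) d ->
  derivable k x (delta_mx 0 i) /\ D i k x = d.
Proof.
move=> [dk dE]; have dk' := derivable_upd dk.
have [_ e] := is_derive_upd dk'; rewrite upd_id in dk' e.
by split=> //; rewrite -e dE.
Qed.

Lemma chain_map k (f : 'rV[R]_k -> R) (h : V -> 'rV[R]_k) : C1 f ->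
  (forall l, C1 (fun x => h x 0 l)) ->
  C1 (fun x => f (h x)) /\
  forall i, D i (fun x => f (h x)) =
    fun x => \sum_l D i (fun x => h x 0 l) x * D l f (h x).
Proof.
move=> cf ch.
have cth : continuous h by apply: cts_rV => l; exact: C1_cts.
have dfh i x : derivable (fun x => f (h x)) x (delta_mx 0 i) /\
    D i (fun x => f (h x)) x = \sum_l D i (fun x => h x 0 l) x * D l f (h x).
  apply: D_upd.
  have := @chain_curve _ _ f (fun t => h (upd x i t))
    (fun l => D i (fun x => h x 0 l) (upd x i (x 0 i))) (x 0 i).
  rewrite upd_id; apply; first by case: cf.
  move=> l; have := @C1_upd _ _ (fun x => h x 0 l) x i (x 0 i) (ch l).
  by rewrite upd_id.
have DE i : D i (fun x => f (h x)) =
    fun x => \sum_l D i (fun x => h x 0 l) x * D l f (h x).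
  by apply/funext => x; case: (dfh i x).
split=> //; apply: C1_partial => [i x|i]; first by case: (dfh i x).
rewrite DE; apply: cts_sum => l _; apply: ctsM; first exact: C1_D.
by apply: (@cts_comp _ _ _ h) => //; exact: C1_D.
Qed.

Lemma Int_D f i M x : C1 f -> Int M i (D i f) x = f (upd x i M) - f (upd x i (- M)).
Proof.
move=> cf; rewrite /Int (intE _ _ _ (fun t => C1_upd x i t cf)) //.
by apply: cts_updt; exact: C1_D.
Qed.

Lemma IT_D f i M : 0 <= M -> C1 f -> vanish M f -> IT M (D i f) = 0.
Proof.
move=> M0 cf vf; rewrite -(IT0 m M0); apply: (@eq_IT_Int _ _ _ i) => //.
- exact: C1_D.
- exact: ctsC.
apply/funext => x; rewrite Int_D // [in RHS]/Int int_cst mul0r !vf ?subrr //.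
  by have := coord_le (upd x i (- M)) i; rewrite updE eqxx normrN ger0_norm.
by have := coord_le (upd x i M) i; rewrite updE eqxx ger0_norm.
Qed.

Lemma C1_blf (T : topologicalType) (K : set T) C L (F : T -> V -> R) :
  compact K -> bounded_functional K C L ->
  continuous (fun z => F z.1 z.2) -> (forall z, C1 (F z)) ->
  (forall j, continuous (fun z => D j (F z.1) z.2)) ->
  C1 (fun p => L (F ^~ p)) /\
  forall j, D j (fun p => L (F ^~ p)) = fun p => L (fun z => D j (F z) p).
Proof.
move=> cK bL cF c1F cDF.
have dL j p : derivable (fun p => L (F ^~ p)) p (delta_mx 0 j) /\
    D j (fun p => L (F ^~ p)) p = L (fun z => D j (F z) p).
  apply: D_upd.
  have jc (G : T -> V -> R) : continuous (fun z => G z.1 z.2) ->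
      continuous (fun z : T * R => G z.1 (upd p j z.2)).
    move=> cG; apply: (@cts_comp _ _ _ (fun z : T * R => (z.1, upd p j z.2)) (fun z => G z.1 z.2)) => //.
    apply: cts_pair; first by move=> z; exact: cvg_fst.
    by apply: cts_upd; [move=> z; exact: cvg_cst|move=> z; exact: cvg_snd].
  have := @blf_derive _ _ _ _ _ cK bL (fun z t => F z (upd p j t))
    (fun z t => D j (F z) (upd p j t)) (p 0 j) (jc F cF)
    (jc (fun z => D j (F z)) (cDF j)).
  rewrite upd_id; apply=> z t; exact: C1_upd.
have DE j : D j (fun p => L (F ^~ p)) = fun p => L (fun z => D j (F z) p).
  by apply/funext => p; case: (dL j p).
split=> //; apply: C1_partial => [j p|j]; first by case: (dL j p).
by rewrite DE; exact: (blf_continuous cK bL (cDF j)).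
Qed.

(** The increment of [f] in direction [j] is an integral of [D j f]. Applying [D i] under that
    integral and then differentiating in the upper limit gives the mixed derivative in the other
    order. *)
Lemma schwarz f i j : C2 f -> D i (D j f) = D j (D i f).
Proof.
move=> c2f; have [->//|ij] := eqVneq i j; apply/funext => x.
(* Any base point to the left of [b] would do: the inequality [a <= t] then holds for all [t] near
   [b]. *)
pose a := x 0 j - 1; pose b := x 0 j.
have ib : a < b by rewrite /a /b gtrDl oppr_lt0.
have cji : continuous (D i (D j f)) by apply/C1_D/C2_D.
have c1i : C1 (D i f) by exact: C2_D.
have c1j : C1 (D j f) by exact: C2_D.
have E t : a <= t -> D i f (upd x j t) - D i f (upd x j a) =
    int a t (fun u => D i (D j f) (upd x j u)).
  move=> at_.
  have Ef y : int a t (fun u => D j f (upd y j u)) = f (upd y j t) - f (upd y j a).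
    apply: (intE _ _ _ (fun u => C1_upd y j u (C2_C1 c2f))).
    by apply: cts_updt; apply: C1_D; case: c2f.
  have jc (G : V -> R) : continuous G ->
      continuous (fun z : R * R => G (upd (upd x j z.1) i z.2)).
    move=> cG; apply: (@cts_comp _ _ _ (fun z : R * R => upd (upd x j z.1) i z.2)) => //.
    apply: cts_upd; last by move=> z; exact: cvg_snd.
    by apply: cts_upd; [move=> z; exact: cvg_cst|move=> z; exact: cvg_fst].
  have dI : is_derive (x 0 i) 1
      (fun s => int a t (fun u => D j f (upd (upd x j u) i s)))
      (int a t (fun u => D i (D j f) (upd (upd x j u) i (x 0 i)))).
    apply: (@blf_derive _ _ _ _ _ (@segment_compact _ a t) (int_functional at_)
      (fun u s => D j f (upd (upd x j u) i s))
      (fun u s => D i (D j f) (upd (upd x j u) i s))).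
    - by apply: jc; exact: C1_cts.
    - exact: jc.
    - by move=> u s; exact: C1_upd.
  have xu u : upd (upd x j u) i (x 0 i) = upd x j u.
    by rewrite -(updC _ _ _ ij) upd_id.
  have E1 : (fun s => int a t (fun u => D j f (upd (upd x j u) i s))) =
      fun s => f (upd (upd x j t) i s) - f (upd (upd x j a) i s).
    apply/funext => s; rewrite -!(updC _ s _ ij) -Ef; congr int; apply/funext => u.
    by rewrite (updC _ _ _ ij).
  move: dI; rewrite E1.
  have -> : (fun u => D i (D j f) (upd (upd x j u) i (x 0 i))) =
            fun u => D i (D j f) (upd x j u) by apply/funext => u; rewrite xu.
  move=> [_ <-].
  have c1f := C2_C1 c2f.
  have d1 := @C1_upd _ _ f (upd x j t) i (x 0 i) c1f.
  have d2 := @C1_upd _ _ f (upd x j a) i (x 0 i) c1f.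
  have [_ ->] := is_deriveB d1 d2.
  by rewrite !xu.
have d1 := @C1_upd _ _ (D i f) x j b c1i.
have d2 : is_derive b 1 (fun t => int a t (fun u => D i (D j f) (upd x j u)))
    (D i (D j f) (upd x j b)).
  exact/is_derive_int/cts_updt.
have d3 : is_derive b 1 (fun t => D i f (upd x j t)) (D i (D j f) (upd x j b)).
  have d4 : is_derive b 1 (fun t => D i f (upd x j a) + int a t (fun u => D i (D j f) (upd x j u)))
     (D i (D j f) (upd x j b)).
    by rewrite -[X in is_derive _ _ _ X]add0r; apply: is_deriveD.
  have ne : \forall t \near b, D i f (upd x j a) +
      int a t (fun u => D i (D j f) (upd x j u)) = D i f (upd x j t).
    near=> t; rewrite -E ?subrKC //; apply: ltW; near: t.
    exact: lt_nbhsr.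
  exact: near_eq_is_derive ne d4.
have [_ e1] := d1; have [_ e3] := d3.
have e : D i (D j f) (upd x j b) = D j (D i f) (upd x j b) := etrans (esym e3) e1.
by move: e; rewrite upd_id.
Unshelve. all: by end_near. Qed.

End Calculus.

(** * A twice differentiable step function *)

Section SmoothStep.
Variable R : realType.
Implicit Types (t u s M : R).

(** The square of the positive part has a continuous derivative. Hence so has [bump], which is
    [t^2 (1 - t)^2] on the unit interval, and its normalised primitive [step] has two. *)
Definition pos_sq t : R := (Num.max 0 t) ^+ 2.

Lemma cts_max0 : continuous (fun t => Num.max 0 t).
Proof.
have -> : (fun t => Num.max 0 t) = fun t => (t + `|t|) / 2.
  apply/funext => t; have [t0|/ltW t0] := leP 0 t.
    by rewrite ger0_norm //; lra.
  by rewrite ler0_norm //; lra.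
apply: ctsM; last exact: ctsC.
by apply: ctsD; [exact: cts_id|apply: cts_norm; exact: cts_id].
Qed.

Lemma pos_sq_deriv : deriv_of pos_sq (fun t => 2 * Num.max 0 t).
Proof.
move=> t; apply: is_derive_eps => e e0; exists e => // h he.
have key : `|pos_sq (t + h) - pos_sq t - h * (2 * Num.max 0 t)| <= `|h| * `|h|.
  rewrite /pos_sq -normrM ger0_norm ?sqr_ge0 -?expr2 ?sqr_ge0 // ler_norml.
  have [a0|/ltW a0] := leP 0 t; have [b0|/ltW b0] := leP 0 (t + h).
  - by apply/andP; split; nra.
  - by apply/andP; split; nra.
  - by apply/andP; split; nra.
  - by apply/andP; split; nra.
by apply: (le_trans key); rewrite ler_wpM2r // ltW.
Qed.

Definition bump t : R := pos_sq t * pos_sq (1 - t).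
Definition dbump t : R :=
  2 * Num.max 0 t * pos_sq (1 - t) - pos_sq t * (2 * Num.max 0 (1 - t)).

Lemma bump_deriv : deriv_of bump dbump.
Proof.
move=> t; have d1 := pos_sq_deriv t.
have d2 : is_derive t 1 (fun t => pos_sq (1 - t)) (- (2 * Num.max 0 (1 - t))).
  rewrite -[X in is_derive _ _ _ X]mulr1 mulNr -mulrN.
  apply: (@is_derive1_comp _ pos_sq (fun t => 1 - t)); first exact: pos_sq_deriv.
  by rewrite -[X in is_derive _ _ _ X]add0r; apply: is_deriveD; apply: is_deriveN.
have := is_deriveM d1 d2; rewrite /dbump.
have -> : pos_sq t *: - (2 * Num.max 0 (1 - t)) + pos_sq (1 - t) *: (2 * Num.max 0 t) =
  2 * Num.max 0 t * pos_sq (1 - t) - pos_sq t * (2 * Num.max 0 (1 - t)).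
  by rewrite scalerN addrC [_ *: (2 * _)]mulrC.
exact.
Qed.

Lemma cts_bump : continuous bump.
Proof. by move=> t; exact: is_derive_cont (bump_deriv t). Qed.

Lemma cts_dbump : continuous dbump.
Proof.
have c1 : continuous (fun t => 1 - t) by apply: ctsB; [exact: ctsC|exact: cts_id].
have cp : continuous pos_sq by move=> t; exact: is_derive_cont (pos_sq_deriv t).
apply: ctsB; apply: ctsM.
- by apply: ctsM; [exact: ctsC|exact: cts_max0].
- exact: (@cts_comp _ _ _ (fun t => 1 - t)).
- exact: cp.
- apply: ctsM; first exact: ctsC.
  by apply: (@cts_comp _ _ _ (fun t => 1 - t) (fun t => Num.max 0 t)) => //; exact: cts_max0.
Qed.

Lemma bump_ge0 t : 0 <= bump t.
Proof. by rewrite mulr_ge0 // sqr_ge0. Qed.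

Lemma bump_eq0 t : t <= 0 \/ 1 <= t -> bump t = 0.
Proof.
rewrite /bump /pos_sq => -[t0|t1]; first by rewrite (max_idPl t0) expr0n mul0r.
have h : 1 - t <= 0 by rewrite subr_le0.
by rewrite (max_idPl h) expr0n mulr0.
Qed.

Lemma bump_le1 t : bump t <= 1.
Proof.
have [t0|t0] := leP t 0; first by rewrite bump_eq0 //; left.
have [t1|t1] := leP 1 t; first by rewrite bump_eq0 //; right.
have h : 0 <= 1 - t by rewrite subr_ge0 ltW.
rewrite /bump /pos_sq (max_idPr (ltW t0)) (max_idPr h) -exprMn exprn_ile1 //.
  by rewrite mulr_ge0 // ltW.
nra.
Qed.

Definition mass : R := int 0 1 bump.

Lemma mass_gt0 : 0 < mass.
Proof.
rewrite /mass (int_split (1/4)) [X in _ + X](int_split (3/4)).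
have h1 : 0 <= int 0 (1/4) bump.
  by apply: int_ge0; [exact: cts_bump|lra|move=> *; exact: bump_ge0].
have h3 : 0 <= int (3/4) 1 bump.
  by apply: int_ge0; [exact: cts_bump|lra|move=> *; exact: bump_ge0].
(* On the middle half [t (1 - t)] is at least 1/16, so [bump] is at least 1/256 there. *)
have h2 : 0 <= int (1/4) (3/4) (fun t => bump t + (-1) * (1/256)).
  apply: int_ge0; [|lra|].
    by apply: ctsD; [exact: cts_bump|exact: ctsC].
  move=> t /andP[t1 t2]; rewrite /bump /pos_sq.
  have p1 : 0 <= t by lra.
  have p2 : 0 <= 1 - t by lra.
  rewrite (max_idPr p1) (max_idPr p2) -exprMn.
  have : 1/16 <= t * (1 - t) by nra.
  by nra.
move: h2; rewrite intD; [|exact: cts_bump|exact: ctsC].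
by rewrite int_cst; lra.
Qed.

Definition step t : R := int 0 t bump / mass.
Definition dstep t : R := bump t / mass.
Definition ddstep t : R := dbump t / mass.

Lemma step_deriv : deriv_of step dstep.
Proof.
move=> t; have -> : step = mass^-1 *: (int 0 ^~ bump).
  by apply/funext => u; rewrite /step mulrC.
by rewrite /dstep mulrC; apply: is_deriveZ; apply: is_derive_int; exact: cts_bump.
Qed.

Lemma dstep_deriv : deriv_of dstep ddstep.
Proof.
move=> t; have -> : dstep = mass^-1 *: bump.
  by apply/funext => u; rewrite /dstep mulrC.
by rewrite /ddstep mulrC; apply: is_deriveZ; exact: bump_deriv.
Qed.

Lemma cts_ddstep : continuous ddstep.
Proof. by apply: ctsM; [exact: cts_dbump|exact: ctsC]. Qed.

Lemma cts_dstep : continuous dstep.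
Proof. by move=> t; exact: is_derive_cont (dstep_deriv t). Qed.

Lemma dstep_ge0 t : 0 <= dstep t.
Proof. by rewrite divr_ge0 ?bump_ge0 // ltW // mass_gt0. Qed.

Lemma dstep_le t : dstep t <= mass^-1.
Proof. by rewrite -[leRHS]mul1r ler_wpM2r ?bump_le1 // invr_ge0 ltW // mass_gt0. Qed.

Lemma dstep_eq0 t : t <= 0 \/ 1 <= t -> dstep t = 0.
Proof. by move=> /bump_eq0 e; rewrite /dstep e mul0r. Qed.

Lemma int_dstep a b : int a b dstep = step b - step a.
Proof. exact: (intE _ _ cts_dstep step_deriv). Qed.

Lemma step_homo s t : s <= t -> step s <= step t.
Proof.
move=> st; rewrite -subr_ge0 -int_dstep; apply: int_ge0 => //; first exact: cts_dstep.
by move=> *; exact: dstep_ge0.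
Qed.

Lemma step_eq0 t : t <= 0 -> step t = 0.
Proof.
move=> t0; have : int t 0 dstep = int t 0 (fun=> 0).
  apply: eq_int => //; [exact: cts_dstep|exact: ctsC|].
  by move=> u /andP[_ u0]; rewrite dstep_eq0 //; left.
rewrite int_dstep int_cst mul0r => /eqP; rewrite subr_eq0 => /eqP <-.
by rewrite /step /int subrr mul0r.
Qed.

Lemma step_eq1 t : 1 <= t -> step t = 1.
Proof.
move=> t1; have : int 1 t dstep = int 1 t (fun=> 0).
  apply: eq_int => //; [exact: cts_dstep|exact: ctsC|].
  by move=> u /andP[u0 _]; rewrite dstep_eq0 //; right.
rewrite int_dstep int_cst mul0r => /eqP; rewrite subr_eq0 => /eqP ->.
by rewrite /step divff // gt_eqF // mass_gt0.
Qed.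

Lemma step_ge0 t : 0 <= step t.
Proof.
have [t0|/ltW t0] := leP t 0; first by rewrite step_eq0.
by rewrite -(step_eq0 (lexx 0)) step_homo.
Qed.

Lemma step_le1 t : step t <= 1.
Proof.
have [t1|/ltW t1] := leP 1 t; first by rewrite step_eq1.
by rewrite -(step_eq1 (lexx 1)) step_homo.
Qed.

Lemma deriv_of_affine (g g' : R -> R) (a b : R) : deriv_of g g' ->
  deriv_of (fun t => g (a * t + b)) (fun t => a * g' (a * t + b)).
Proof.
move=> dg t; rewrite mulrC.
apply: (@is_derive1_comp _ g (fun t => a * t + b)); first exact: dg.
rewrite -[X in is_derive _ _ _ X]addr0; apply: is_deriveD.
rewrite -[X in is_derive _ _ _ X]mulr1.
by apply: (@is_deriveZ _ _ _ id); exact: is_derive_id.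
Qed.

Lemma deriv_of_scale (g g' : R -> R) (a : R) : deriv_of g g' ->
  deriv_of (fun t => a * g t) (fun t => a * g' t).
Proof. by move=> dg t; apply: (@is_deriveZ _ _ _ g). Qed.

End SmoothStep.

(** * Poisson brackets *)

Section Poisson.
Variables (R : realType) (m : nat) (J : 'M[R]_m).
Hypothesis JT : J^T = - J.
Local Notation V := 'rV[R]_m.
Implicit Types (x : V) (i j k l : 'I_m) (M : R) (f g h a b : V -> R).

Definition grad f x : 'cV[R]_m := \col_i D i f x.
Definition hess f x : 'M[R]_m := \matrix_(i, j) D i (D j f) x.
Definition pb f g x : R := ((grad f x)^T *m J *m grad g x) 0 0.

Lemma J_anti i j : J i j = - J j i.
Proof. by have /matrixP/(_ j i) := JT; rewrite !mxE. Qed.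

Lemma pbE f g x : pb f g x = \sum_k \sum_l J k l * (D k f x * D l g x).
Proof.
rewrite /pb mxE exchange_big /=; apply: eq_bigr => l _.
rewrite !mxE mulr_suml; apply: eq_bigr => k _.
by rewrite !mxE; ring.
Qed.

Lemma scalar_trmx (A : 'M[R]_1) : A^T 0 0 = A 0 0.
Proof. by rewrite mxE. Qed.

Lemma pb_sumE f g : pb f g = fun x => \sum_k \sum_l J k l * (D k f x * D l g x).
Proof. by apply/funext => x; exact: pbE. Qed.

Lemma pb_cts f g : C1 f -> C1 g -> continuous (pb f g).
Proof.
move=> cf cg; rewrite pb_sumE; apply: cts_sum => k _; apply: cts_sum => l _.
by apply: ctsM; [exact: ctsC|apply: ctsM; exact: C1_D].
Qed.

Lemma C1_pb_term f g k l : C2 f -> C2 g ->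
  C1 (fun x => J k l * (D k f x * D l g x)).
Proof.
by move=> cf cg; apply: C1_mul; [exact: C1_cst|apply: C1_mul; exact: C2_D].
Qed.

Lemma pb_C1 f g : C2 f -> C2 g -> C1 (pb f g).
Proof.
move=> cf cg; rewrite pb_sumE; apply: (proj1 (C1_sum _ _)) => k.
by apply: (proj1 (C1_sum _ _)) => l; exact: C1_pb_term.
Qed.

Lemma hess_sym f x : C2 f -> (hess f x)^T = hess f x.
Proof. by move=> cf; apply/matrixP => i j; rewrite !mxE schwarz. Qed.

Lemma grad_pb f g x : C2 f -> C2 g ->
  grad (pb f g) x = hess f x *m J *m grad g x - hess g x *m J *m grad f x.
Proof.
move=> cf cg; apply/colP => i; rewrite !mxE pb_sumE.
have c1 k : C1 (fun x => \sum_l J k l * (D k f x * D l g x)).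
  by apply: (proj1 (C1_sum _ _)) => l; exact: C1_pb_term.
rewrite (proj2 (C1_sum _ c1) i).
have E k : D i (fun x => \sum_l J k l * (D k f x * D l g x)) x =
  \sum_l (J k l * (D i (D k f) x * D l g x) + J k l * (D k f x * D i (D l g) x)).
  rewrite (proj2 (C1_sum _ (fun l => C1_pb_term k l cf cg)) i); apply: eq_bigr => l _.
  rewrite D_mul; [|exact: C1_cst|apply: C1_mul; exact: C2_D].
  rewrite D_cst mul0r add0r D_mul; [|exact: C2_D|exact: C2_D].
  by rewrite mulrDr.
under eq_bigr do rewrite E big_split /=.
rewrite big_split /=; congr (_ + _).
  rewrite exchange_big /=; apply: eq_bigr => l _.
  rewrite !mxE mulr_suml; apply: eq_bigr => k _.
  by rewrite !mxE; ring.
rewrite -sumrN; apply: eq_bigr => k _.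
rewrite !mxE mulr_suml -sumrN; apply: eq_bigr => l _.
by rewrite !mxE (J_anti k l); ring.
Qed.

(** The two terms that contain [HF] are transposes of each other, hence equal as scalars, and
    cancel; the remaining ones are those of the right side. *)
Lemma jacobi_mx (F A B : 'cV[R]_m) (HF HA HB : 'M[R]_m) :
  HF^T = HF -> HA^T = HA -> HB^T = HB ->
  ((HF *m J *m A - HA *m J *m F)^T *m J *m B) 0 0 -
  ((HF *m J *m B - HB *m J *m F)^T *m J *m A) 0 0 =
  (F^T *m J *m (HA *m J *m B - HB *m J *m A)) 0 0.
Proof.
move=> sF sA sB.
have e : (A^T *m J *m HF *m J *m B) 0 0 = (B^T *m J *m HF *m J *m A) 0 0.
  rewrite -scalar_trmx !trmx_mul trmxK sF JT !(mulNmx, mulmxN) opprK.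
  by rewrite !mulmxA.
rewrite !raddfB /= !trmx_mul sF sA sB JT !mulmxBl.
rewrite !(mulNmx, mulmxN) !mulmxA.
move: e; set p := A^T *m J *m HF *m J *m B; set q := B^T *m J *m HF *m J *m A.
set r := F^T *m J *m HA *m J *m B; set s := F^T *m J *m HB *m J *m A.
by clearbody p q r s => e; rewrite !mxE e; ring.
Qed.

Lemma jacobi f a b x : C2 f -> C2 a -> C2 b ->
  pb (pb f a) b x - pb (pb f b) a x = pb f (pb a b) x.
Proof.
move=> cf ca cb; rewrite [pb (pb f a) b x]/pb [pb (pb f b) a x]/pb [RHS]/pb.
rewrite (grad_pb x cf ca) (grad_pb x cf cb) (grad_pb x ca cb).
by apply: jacobi_mx; exact: hess_sym.
Qed.

Lemma pb_mull f g h x : C1 f -> C1 g ->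
  pb (fun x => f x * g x) h x = f x * pb g h x + g x * pb f h x.
Proof.
move=> cf cg; have -> : pb (fun x => f x * g x) h x =
   ((f x *: grad g x + g x *: grad f x)^T *m J *m grad h x) 0 0.
  rewrite /pb; congr ((_^T *m _ *m _) 0 0); apply/colP => i.
  by rewrite !mxE D_mul //; ring.
rewrite raddfD /= !linearZ /= !mulmxDl -!scalemxAl /pb.
by rewrite !mxE.
Qed.

(** The bracket is the divergence of [J k l * (f * D l g)]: the terms with second derivatives of [g]
    cancel because [J] is antisymmetric and the derivatives commute. *)
Lemma IT_pb f g M : 0 <= M -> C1 f -> C2 g -> vanish M f -> IT M (pb f g) = 0.
Proof.
move=> M0 cf cg vf.
have cT k l : C1 (fun x => J k l * (f x * D l g x)).
  by apply: C1_mul; [exact: C1_cst|apply: C1_mul => //; exact: C2_D].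
have E : pb f g = fun x => \sum_k \sum_l D k (fun x => J k l * (f x * D l g x)) x.
  apply/funext => x; rewrite pbE.
  have S : \sum_k \sum_l J k l * (f x * D k (D l g) x) = 0.
    set T := LHS; have : T = - T.
      rewrite {1}/T exchange_big /= -sumrN; apply: eq_bigr => k _.
      rewrite -sumrN; apply: eq_bigr => l _.
      by rewrite (J_anti l k) (schwarz _ _ cg) mulNr.
    by lra.
  transitivity (\sum_k \sum_l J k l * (D k f x * D l g x) +
                \sum_k \sum_l J k l * (f x * D k (D l g) x)); first by rewrite S addr0.
  rewrite -big_split /=; apply: eq_bigr => k _.
  rewrite -big_split /=; apply: eq_bigr => l _.
  rewrite D_mul; [|exact: C1_cst|apply: C1_mul => //; exact: C2_D].
  rewrite D_cst mul0r add0r D_mul //; last exact: C2_D.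
  by rewrite mulrDr.
rewrite E IT_sum //; last by move=> k _; apply: cts_sum => l _; exact: C1_D.
rewrite big1 // => k _; rewrite IT_sum //; last by move=> l _; exact: C1_D.
rewrite big1 // => l _; apply: IT_D => //.
by move=> x /vf ->; rewrite mul0r mulr0.
Qed.

(** The Hamiltonian field of [g] is skew-adjoint, by the Leibniz rule and [IT_pb] for the product
    [f * h]. *)
Lemma IT_pb_parts f g h M : 0 <= M -> C1 f -> C1 h -> C2 g -> vanish M f ->
  IT M (fun x => f x * pb h g x) = - IT M (fun x => h x * pb f g x).
Proof.
move=> M0 cf ch cg vf; apply/eqP; rewrite -subr_eq0 opprK.
have cg1 := C2_C1 cg.
rewrite -ITD //; try by apply: ctsM; [exact: C1_cts|exact: pb_cts].
rewrite -[X in _ == X](IT_pb M0 (C1_mul cf ch) cg (vanishM _ vf)).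
by apply/eqP; congr IT; apply/funext => x; rewrite pb_mull.
Qed.

End Poisson.

(** * Closed forms integrated against radial weights *)

Section Rotations.
Variables (R : realType) (m : nat).
Local Notation V := 'rV[R]_m.
Implicit Types (x : V) (i j k l : 'I_m) (M : R).

(* The rotation vector fields generate a perfect Lie algebra as soon as there
   is a third coordinate [k]: for closed [b],
   [x_i b_j - x_j b_i = rot_ik (b(rot_kj)) - rot_kj (b(rot_ik))]. *)
Lemma IT_rotation_closed (w : V -> R) (b : 'I_m -> V -> R) M i j k :
  0 <= M -> i != j -> k != i -> k != j ->
  C1 w -> vanish M w -> (forall l, C1 (b l)) ->
  (forall p q x, x 0 p * D q w x = x 0 q * D p w x) ->
  (forall p q x, w x != 0 -> D p (b q) x = D q (b p) x) ->
  IT M (fun x => w x * (x 0 i * b j x - x 0 j * b i x)) = 0.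
Proof.
move=> M0 ij ki kj cw vw cb rw clb.
pose B p q x := x 0 p * b q x - x 0 q * b p x.
have cB p q : C1 (B p q).
  by apply: C1_sub; apply: C1_mul; by [exact: C1_coord|exact: cb].
have DB l p q x : D l (B p q) x = (l == p)%:R * b q x + x 0 p * D l (b q) x
    - ((l == q)%:R * b p x + x 0 q * D l (b p) x).
  rewrite D_add; last first.
  - by apply: C1_opp; apply: C1_mul; [exact: C1_coord|exact: cb].
  - by apply: C1_mul; [exact: C1_coord|exact: cb].
  rewrite D_opp; last by apply: C1_mul; [exact: C1_coord|exact: cb].
  rewrite D_mul; [|exact: C1_coord|exact: cb].
  rewrite D_mul; [|exact: C1_coord|exact: cb].
  by rewrite !D_coord.
(* The weight [w] is invariant under rotations, so the rotational derivative of any [g] against it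
   integrates to 0. *)
have rot (g : V -> R) p q : p != q -> C1 g ->
    IT M (fun x => w x * (x 0 p * D q g x - x 0 q * D p g x)) = 0.
  move=> pq cg; pose u p x := x 0 p * (w x * g x).
  have cu p' : C1 (u p') by apply: C1_mul; [exact: C1_coord|exact: C1_mul].
  have vu p' : vanish M (u p') by move=> x /vw wx; rewrite /u wx mul0r mulr0.
  have Du p' l x : D l (u p') x = (l == p')%:R * (w x * g x) +
      x 0 p' * (D l w x * g x + w x * D l g x).
    rewrite D_mul; [|exact: C1_coord|exact: C1_mul].
    by rewrite D_coord D_mul.
  have -> : (fun x => w x * (x 0 p * D q g x - x 0 q * D p g x)) =
            fun x => D q (u p) x - D p (u q) x.
    apply/funext => x; rewrite !Du (negbTE pq) eq_sym (negbTE pq).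
    have := rw p q x; move: (D q w x) (D p w x) (D q g x) (D p g x) => a c a' c' e.
    have -> : 0%:R * (w x * g x) + x 0 p * (a * g x + w x * a') -
      (0%:R * (w x * g x) + x 0 q * (c * g x + w x * c')) =
      (x 0 p * a - x 0 q * c) * g x + w x * (x 0 p * a' - x 0 q * c').
      by ring.
    by rewrite e subrr mul0r add0r.
  by rewrite ITB ?IT_D ?subrr //; exact: C1_D.
have E : (fun x => w x * (x 0 i * b j x - x 0 j * b i x)) =
  fun x => w x * (x 0 i * D k (B k j) x - x 0 k * D i (B k j) x) -
           w x * (x 0 k * D j (B i k) x - x 0 j * D k (B i k) x).
  apply/funext => x; have [->|wx] := eqVneq (w x) 0; first by rewrite !mul0r subrr.
  rewrite -mulrBr; congr (_ * _); rewrite !DB !eqxx.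
  rewrite (negbTE kj) (negbTE ki) (negbTE ij) ![_ == k]eq_sym (negbTE kj) (negbTE ki).
  rewrite [j == i]eq_sym (negbTE ij).
  rewrite (clb k j x wx) (clb k i x wx) (clb i j x wx) /=.
  move: (D j (b k) x) (D i (b k) x) (D j (b i) x) (D k (b k) x) (b i x) (b j x) (b k x).
  by move=> *; ring.
have cr (g : V -> R) p q : C1 g -> continuous (fun x => w x * (x 0 p * D q g x - x 0 q * D p g x)).
  move=> cg; apply: ctsM; first exact: C1_cts.
  by apply: ctsB; apply: ctsM; by [exact: cts_coord|exact: C1_D].
rewrite E ITB //; [|exact: cr|exact: cr].
by rewrite !rot ?subrr // eq_sym.
Qed.

(** By the previous lemma the moments [I k l] are symmetric; contracted with the antisymmetric [J]
    they give 0. *)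
Lemma IT_closed_hopf (J : 'M[R]_m) (w : V -> R) (b : 'I_m -> V -> R) M :
  J^T = - J -> (3 <= m)%N -> 0 <= M ->
  C1 w -> vanish M w -> (forall l, C1 (b l)) ->
  (forall p q x, x 0 p * D q w x = x 0 q * D p w x) ->
  (forall p q x, w x != 0 -> D p (b q) x = D q (b p) x) ->
  IT M (fun x => \sum_k \sum_l J k l * (w x * x 0 k * b l x)) = 0.
Proof.
move=> JT m3 M0 cw vw cb rw clb.
have cp p q : continuous (fun x => w x * x 0 p * b q x).
  by apply: ctsM; [apply: ctsM; [exact: C1_cts|exact: cts_coord]|exact: C1_cts].
have ct k l : continuous (fun x => J k l * (w x * x 0 k * b l x)).
  by apply: ctsM; [exact: ctsC|exact: cp].
pose I k l := IT M (fun x => w x * x 0 k * b l x).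
have I0 i j : I i j = I j i.
  apply/eqP; rewrite -subr_eq0.
  have [->|ij] := eqVneq i j; first by rewrite subrr.
  have [k /andP[ki kj]] : exists k, (k != i) && (k != j).
    apply/existsP; apply: contraT; rewrite negb_exists => /forallP H.
    have : (#|'I_m| <= size [:: i; j])%N.
      apply: leq_trans (card_size [:: i; j]).
      apply: subset_leq_card; apply/fintype.subsetP => k _.
      by have := H k; rewrite negb_and !negbK !inE.
    by rewrite card_ord => /(leq_trans m3).
  rewrite -ITB // -[X in _ == X](IT_rotation_closed M0 ij ki kj cw vw cb rw clb).
  by apply/eqP; congr IT; apply/funext => x; ring.
have E : IT M (fun x => \sum_k \sum_l J k l * (w x * x 0 k * b l x)) =
  \sum_k \sum_l J k l * I k l.
  rewrite IT_sum //; last by move=> k _; apply: cts_sum => l _; exact: ct.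
  apply: eq_bigr => k _; rewrite IT_sum //.
  by apply: eq_bigr => l _; rewrite ITZ.
rewrite E; set S := LHS; have : S = - S.
  rewrite {1}/S exchange_big /= -sumrN; apply: eq_bigr => k _.
  rewrite -sumrN; apply: eq_bigr => l _.
  have /matrixP/(_ k l) := JT; rewrite !mxE => ->.
  by rewrite I0 mulNr.
by lra.
Qed.

End Rotations.

(** * Symplectic maps and the push-forward of a radial differential *)

Section SymplecticMap.
Variables (R : realType) (m : nat) (J : 'M[R]_m).
Hypotheses (JT : J^T = - J) (JJ : J *m J = - 1%:M) (m3 : (3 <= m)%N).
Local Notation V := 'rV[R]_m.
Implicit Types (x p : V) (i j k l a b : 'I_m).
Variables (phi : V -> V) (Om : set V) (M : R).
Local Notation ph a := (fun x : V => phi x 0 a).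
Hypotheses (M0 : 0 <= M) (cphi : forall a, C2 (ph a)) (oOm : open Om)
  (OmM : forall x, Om x -> `|x| < M)
  (symp : forall x a b, Om x -> pb J (ph a) (ph b) x = J a b).
Variables (chi w : V -> R).
Hypotheses (cchi : C2 chi) (vchi : vanish M chi) (cw : C1 w)
  (Dchi : forall i x, D i chi x = w x * x 0 i)
  (wOm : forall x, ~ Om x -> w x = 0)
  (rw : forall k l x, x 0 k * D l w x = x 0 l * D k w x).

(** Rows are indexed by the variable and columns by the component, so the differential acts on row
    vectors by right multiplication. *)
Definition jac x : 'M[R]_m := \matrix_(l, b) D l (ph b) x.

Lemma grad_ph a x : grad (ph a) x = col a (jac x).
Proof. by apply/colP => i; rewrite !mxE. Qed.

Lemma pb_ph a b x : pb J (ph a) (ph b) x = ((jac x)^T *m J *m jac x) a b.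
Proof.
rewrite pbE mxE exchange_big /=; apply: eq_bigr => l _.
rewrite !mxE mulr_suml; apply: eq_bigr => k _.
by rewrite !mxE; ring.
Qed.

Lemma jacTJ x : Om x -> (jac x)^T *m J *m jac x = J.
Proof. by move=> Ox; apply/matrixP => a b; rewrite -pb_ph symp. Qed.

Lemma jac_inv x : Om x -> jac x *m (- (J *m (jac x)^T *m J)) = 1%:M.
Proof.
move=> /jacTJ e; apply: mulmx1C.
rewrite mulNmx -!mulmxA [(jac x)^T *m _]mulmxA e.
by rewrite JJ opprK.
Qed.

Lemma jacJT x : Om x -> jac x *m J *m (jac x)^T = J.
Proof.
move=> /jac_inv; rewrite mulmxN !mulmxA => /(congr1 (fun A => A *m J)).
rewrite mulNmx -mulmxA JJ mulmxN mulmx1 opprK mul1mx.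
exact.
Qed.

(** Determinants in [jacTJ] give a square equal to 1. The modulus is what the linear change of
    variables uses. *)
Lemma det_jac x : Om x -> `|\det (jac x)| = 1.
Proof.
move=> /jacTJ/(congr1 determinant); rewrite !det_mulmx det_tr.
have dJ : \det J != 0.
  have := congr1 determinant JJ; rewrite det_mulmx => e.
  apply: contraTneq isT => d0; move/eqP: e.
  rewrite d0 mul0r -scaleN1r detZ det1 mulr1 eq_sym expf_eq0 oppr_eq0.
  by rewrite oner_eq0 andbF.
rewrite -mulrA mulrCA -[RHS]mulr1 => /(mulfI dJ) e.
have : `|\det (jac x)| ^+ 2 == 1 by rewrite -normrX expr2 e normr1.
by rewrite sqrp_eq1 // => /eqP.
Qed.

Lemma grad_chi0 x : ~ Om x -> grad chi x = 0.
Proof. by move=> /wOm w0; apply/colP => i; rewrite !mxE Dchi w0 mul0r. Qed.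

Lemma pb_chi0 (f : V -> R) x : ~ Om x -> pb J chi f x = 0.
Proof. by move=> /grad_chi0 g0; rewrite /pb g0 trmx0 !mul0mx mxE. Qed.

Lemma not_Om x : M <= `|x| -> ~ Om x.
Proof. by move=> Mx /OmM; rewrite ltNge Mx. Qed.

(** The coefficient of [d phi_i] in [d chi]. Written with brackets, the coefficients are [C1] on the
    whole space and vanish off [Om], with no inverse of the Jacobian in the formula. *)
Definition alpha i x : R := - \sum_b pb J chi (ph b) x * J b i.

Lemma alpha0 i x : ~ Om x -> alpha i x = 0.
Proof.
by move=> nO; rewrite /alpha big1 ?oppr0 // => b _; rewrite pb_chi0 // mul0r.
Qed.

Lemma C1_pb_chi b : C1 (pb J chi (ph b)).
Proof. exact (pb_C1 J cchi (cphi b)). Qed.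

Lemma vanish_pb_chi b : vanish M (pb J chi (ph b)).
Proof. by move=> x /not_Om; exact: pb_chi0. Qed.

Lemma C1_alpha i : C1 (alpha i).
Proof.
apply: C1_opp; apply: (proj1 (C1_sum _ _)) => b.
by apply: C1_mul; [exact: C1_pb_chi|exact: C1_cst].
Qed.

Lemma D_chi_alpha l x : D l chi x = \sum_i alpha i x * D l (ph i) x.
Proof.
have [Ox|nO] := pselect (Om x); last first.
  by rewrite Dchi wOm // mul0r big1 // => i _; rewrite alpha0 // mul0r.
have aE : \col_i alpha i x = - (J *m (jac x)^T *m J *m grad chi x).
  apply/colP => i; rewrite mxE [RHS]mxE; congr (- _).
  transitivity (((grad chi x)^T *m J *m jac x *m J) 0 i).
    rewrite mxE; apply: eq_bigr => b _; congr (_ * _).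
    by rewrite /pb grad_ph colE mulmxA -colE mxE.
  transitivity (((grad chi x)^T *m J *m jac x *m J)^T i 0); first by rewrite [RHS]mxE.
  by rewrite !trmx_mul trmxK JT !(mulNmx, mulmxN) opprK !mulmxA.
have -> : \sum_i alpha i x * D l (ph i) x = (jac x *m \col_i alpha i x) l 0.
  by rewrite mxE; apply: eq_bigr => i _; rewrite !mxE mulrC.
rewrite aE mulmxN !mulmxA jacJT // JJ mulNmx mul1mx opprK.
by rewrite mxE.
Qed.

(** By the Jacobi identity the difference is a bracket of [chi] with the bracket of two components
    of [phi], which is locally constant on [Om]; off [Om] the gradient of [chi] is 0. *)
Lemma pb_swap_Om a b x :
  pb J (pb J chi (ph a)) (ph b) x = pb J (pb J chi (ph b)) (ph a) x.
Proof.
apply/eqP; rewrite -subr_eq0; apply/eqP.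
apply: (etrans (jacobi JT x cchi (cphi a) (cphi b))).
have [Ox|nO] := pselect (Om x); last by rewrite pb_chi0.
rewrite /pb (_ : grad (pb J (ph a) (ph b)) x = 0) ?mulmx0 ?mxE //.
apply/colP => i; rewrite !mxE.
have e : \forall y \near x, pb J (ph a) (ph b) y = cst (J a b) y.
  have : nbhs x Om by exact: open_nbhs_nbhs.
  by apply: filterS => y Oy; rewrite symp.
by rewrite /D (near_eq_derive _ e) derive_cst.
Qed.

Lemma IT_pb_swap (G : V -> R) a b : C1 G ->
  IT M (fun x => pb J chi (ph a) x * pb J G (ph b) x) =
  IT M (fun x => pb J chi (ph b) x * pb J G (ph a) x).
Proof.
move=> cG; have cB := C1_pb_chi; have vB := vanish_pb_chi.
rewrite (IT_pb_parts JT M0 (cB a) cG (cphi b) (@vB a)).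
rewrite (IT_pb_parts JT M0 (cB b) cG (cphi a) (@vB b)).
by congr (- IT _ _); apply/funext => x; rewrite pb_swap_Om.
Qed.

(** On [Om] the symplectic relation solves the chain rule for the derivatives of [K], which turns
    them into brackets with the components of [phi]. *)
Lemma D_comp_phi (K : V -> R) j x : C1 K -> Om x ->
  D j K (phi x) = - \sum_b pb J (fun x => K (phi x)) (ph b) x * J b j.
Proof.
move=> cK Ox; have [cG DG] := chain_map cK (fun a => C2_C1 (cphi a)).
have gE : grad (fun x => K (phi x)) x = jac x *m grad K (phi x).
  apply/colP => i; rewrite !mxE DG; apply: eq_bigr => l _.
  by rewrite !mxE.
have pE b : pb J (fun x => K (phi x)) (ph b) x = ((grad K (phi x))^T *m J) 0 b.
  rewrite /pb gE grad_ph trmx_mul colE mulmxA -colE mxE -!mulmxA.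
  by rewrite (mulmxA _ J) jacTJ.
under eq_bigr do rewrite pE.
have -> : \sum_b ((grad K (phi x))^T *m J) 0 b * J b j =
   ((grad K (phi x))^T *m J *m J) 0 j by rewrite [RHS]mxE.
by rewrite -mulmxA JJ mulmxN mulmx1 !mxE opprK.
Qed.

(** The push-forward of [d chi] under [phi] is closed in the weak sense, tested against [K]. This is
    what makes [pot] below a potential. *)
Lemma IT_alpha_D (K : V -> R) i j : C1 K ->
  IT M (fun x => alpha i x * D j K (phi x)) =
  IT M (fun x => alpha j x * D i K (phi x)).
Proof.
move=> cK; have [cG _] := chain_map cK (fun a => C2_C1 (cphi a)).
pose G x := K (phi x).
have E i' j' : (fun x => alpha i' x * D j' K (phi x)) =
   fun x => \sum_a \sum_b J a i' * J b j' * (pb J chi (ph a) x * pb J G (ph b) x).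
  apply/funext => x; have [Ox|nO] := pselect (Om x); last first.
    rewrite alpha0 // mul0r big1 // => a _; rewrite big1 // => b _.
    by rewrite pb_chi0 // mul0r mulr0.
  rewrite (D_comp_phi _ cK) // /alpha mulrNN mulr_suml; apply: eq_bigr => a _.
  by rewrite mulr_sumr; apply: eq_bigr => b _; rewrite -/G; ring.
have ct a b : continuous (fun x => pb J chi (ph a) x * pb J G (ph b) x).
  by apply: ctsM; [exact (C1_cts (C1_pb_chi a))|exact (@pb_cts _ _ J _ _ cG (C2_C1 (cphi b)))].
have I i' j' : IT M (fun x => alpha i' x * D j' K (phi x)) =
   \sum_a \sum_b J a i' * J b j' * IT M (fun x => pb J chi (ph a) x * pb J G (ph b) x).
  have ct' a b c : continuous (fun x => c * (pb J chi (ph a) x * pb J G (ph b) x)).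
    by apply: ctsM => //; exact: ctsC.
  rewrite E IT_sum //; last by move=> a _; apply: cts_sum => b _; exact: ct'.
  apply: eq_bigr => a _; rewrite IT_sum //.
  by apply: eq_bigr => b _; rewrite ITZ.
rewrite !I exchange_big /=; apply: eq_bigr => a _; apply: eq_bigr => b _.
by rewrite IT_pb_swap // [J b i * _]mulrC.
Qed.

Lemma IT_alpha i : IT M (alpha i) = 0.
Proof.
have -> : alpha i = fun x => \sum_b (- J b i) * pb J chi (ph b) x.
  apply/funext => x; rewrite /alpha -sumrN; apply: eq_bigr => b _.
  by rewrite mulNr mulrC.
rewrite IT_sum //; last first.
  by move=> b _; apply: ctsM; [exact: ctsC|apply: C1_cts; exact: C1_pb_chi].
rewrite big1 // => b _; rewrite ITZ //; last by apply: C1_cts; exact: C1_pb_chi.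
by rewrite (IT_pb JT M0 (C2_C1 cchi) (cphi b) vchi) mulr0.
Qed.

(** The test function [p_i p_j] in [IT_alpha_D]. *)
Lemma IT_alpha_phi_eq i j :
  IT M (fun x => alpha i x * phi x 0 i) = IT M (fun x => alpha j x * phi x 0 j).
Proof.
have [->//|ij] := eqVneq i j.
pose K (p : V) : R := p 0 i * p 0 j.
have cK : C1 K by apply: C1_mul; exact: C1_coord.
have DK l p : D l K p = (l == i)%:R * p 0 j + p 0 i * (l == j)%:R.
  by rewrite D_mul ?D_coord //; exact: C1_coord.
have := IT_alpha_D i j cK.
have -> : (fun x => alpha i x * D j K (phi x)) = fun x => alpha i x * phi x 0 i.
  by apply/funext => x; rewrite DK eqxx eq_sym (negbTE ij) mul0r add0r mulr1.
have -> // : (fun x => alpha j x * D i K (phi x)) = fun x => alpha j x * phi x 0 j.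
by apply/funext => x; rewrite DK eqxx (negbTE ij) mulr0 addr0 mul1r.
Qed.

(** The coefficients of the pull-back under [phi] of the linear form with coefficients
    [sum_i J b i * p_i], a primitive of a multiple of the symplectic form; [std] is the same form
    without pull-back. *)
Definition pulled l x : R := \sum_b \sum_i J b i * (phi x 0 i * D l (ph b) x).

Lemma C1_pulled l : C1 (pulled l).
Proof.
apply: (proj1 (C1_sum _ _)) => b; apply: (proj1 (C1_sum _ _)) => i.
exact (C1_mul (C1_cst m (J b i)) (C1_mul (C2_C1 (cphi i)) (C2_D l (cphi b)))).
Qed.

Lemma D_pulled k l x : D k (pulled l) x =
  (jac x *m J *m (jac x)^T) l k +
  \sum_b \sum_i J b i * (phi x 0 i * D k (D l (ph b)) x).
Proof.
have c1 b i : C1 (fun x => J b i * (phi x 0 i * D l (ph b) x)).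
  exact (C1_mul (C1_cst m (J b i)) (C1_mul (C2_C1 (cphi i)) (C2_D l (cphi b)))).
have c2 b : C1 (fun x => \sum_i J b i * (phi x 0 i * D l (ph b) x)).
  exact: (proj1 (C1_sum _ _)).
rewrite (proj2 (C1_sum _ c2) k).
transitivity (\sum_b \sum_i (J b i * (D k (ph i) x * D l (ph b) x) +
   J b i * (phi x 0 i * D k (D l (ph b)) x))).
  apply: eq_bigr => b _; rewrite (proj2 (C1_sum _ (c1 b)) k); apply: eq_bigr => i _.
  have cp := C2_C1 (cphi i); have cD := C2_D l (cphi b).
  rewrite (@D_mul _ _ _ _ k (C1_cst m (J b i)) (C1_mul cp cD)).
  by rewrite D_cst mul0r add0r (@D_mul _ _ _ _ k cp cD) mulrDr.
under eq_bigr do rewrite big_split /=.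
rewrite big_split /=; congr (_ + _); rewrite mxE exchange_big /=.
apply: eq_bigr => i _; rewrite mxE mulr_suml; apply: eq_bigr => b _.
by rewrite !mxE; ring.
Qed.

Definition std l x : R := \sum_i J l i * x 0 i.

Lemma C1_std l : C1 (std l).
Proof.
apply: (proj1 (C1_sum _ _)) => i.
by apply: C1_mul; [exact: C1_cst|exact: C1_coord].
Qed.

Lemma D_std k l x : D k (std l) x = J l k.
Proof.
have c1 i : C1 (fun x : V => J l i * x 0 i).
  by apply: C1_mul; [exact: C1_cst|exact: C1_coord].
rewrite (proj2 (C1_sum _ c1) k) (bigD1 k) //= big1 ?addr0.
  rewrite D_mul; [|exact: C1_cst|exact: C1_coord].
  by rewrite D_cst D_coord eqxx mul0r add0r mulr1.
move=> i ik; rewrite D_mul; [|exact: C1_cst|exact: C1_coord].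
by rewrite D_cst D_coord eq_sym (negbTE ik) mul0r mulr0 addr0.
Qed.

(** The forms [pulled] and [std] differ by a form closed on [Om], so [IT_closed_hopf] lets one
    replace the other in the integral against [d chi]. With [pulled] the integral is minus the sum
    over [i] of the left sides, which are all equal; with [std] it is [m] times the integral of
    [chi]. *)
Lemma IT_alpha_phi i : IT M (fun x => alpha i x * phi x 0 i) = - IT M chi.
Proof.
pose beta l x := pulled l x - std l x.
have cbeta l : C1 (beta l) by apply: C1_sub; [exact: C1_pulled|exact: C1_std].
have Dbeta k l x : D k (beta l) x = D k (pulled l) x - J l k.
  rewrite D_add; [|exact: C1_pulled|apply: C1_opp; exact: C1_std].
  by rewrite D_opp ?D_std //; exact: C1_std.
have cl k0 q x : w x != 0 -> D k0 (beta q) x = D q (beta k0) x.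
  move=> wx; have Ox : Om x by apply: contrapT => /wOm /eqP; rewrite (negbTE wx).
  rewrite !Dbeta !D_pulled jacJT // [LHS]addrAC subrr add0r [RHS]addrAC subrr add0r.
  apply: eq_bigr => b _; apply: eq_bigr => k _.
  by rewrite (schwarz _ _ (cphi b)).
have vw : vanish M w by move=> x /not_Om /wOm.
have H := IT_closed_hopf JT m3 M0 cw vw cbeta rw cl.
have cwx k : C1 (fun x => w x * x 0 k) by apply: C1_mul => //; exact: C1_coord.
have c1 (g : 'I_m -> V -> R) : (forall l, C1 (g l)) ->
    continuous (fun x => \sum_k \sum_l J k l * (w x * x 0 k * g l x)).
  move=> cg; apply: cts_sum => k _; apply: cts_sum => l _.
  apply: ctsM; first exact: ctsC.
  by apply: ctsM; apply: C1_cts.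
have E1 : IT M (fun x => \sum_k \sum_l J k l * (w x * x 0 k * beta l x)) =
   IT M (fun x => \sum_k \sum_l J k l * (w x * x 0 k * pulled l x)) -
   IT M (fun x => \sum_k \sum_l J k l * (w x * x 0 k * std l x)).
  rewrite -ITB //; [|exact/c1/C1_pulled|exact/c1/C1_std].
  congr IT; apply/funext => x; rewrite -sumrB; apply: eq_bigr => k _.
  rewrite -sumrB; apply: eq_bigr => l _.
  by rewrite /beta; ring.
have E2 : (fun x => \sum_k \sum_l J k l * (w x * x 0 k * pulled l x)) =
   fun x => \sum_i (- 1) * (alpha i x * phi x 0 i).
  apply/funext => x.
  transitivity (\sum_b \sum_i J b i * phi x 0 i * pb J chi (ph b) x).
    under eq_bigr => k _ do under eq_bigr => l _ do
      (rewrite -Dchi /pulled mulr_sumr mulr_sumr).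
    have -> : \sum_k \sum_l \sum_b J k l * (D k chi x * (\sum_i J b i * (phi x 0 i * D l (ph b) x))) =
      \sum_b \sum_k \sum_l J k l * (D k chi x * (\sum_i J b i * (phi x 0 i * D l (ph b) x))).
      under eq_bigr do rewrite exchange_big /=.
      by rewrite exchange_big.
    apply: eq_bigr => b _; rewrite pbE.
    have -> : \sum_i J b i * phi x 0 i * (\sum_k \sum_l J k l * (D k chi x * D l (ph b) x)) =
      (\sum_i J b i * phi x 0 i) * (\sum_k \sum_l J k l * (D k chi x * D l (ph b) x)).
      by rewrite mulr_suml.
    rewrite mulr_sumr; apply: eq_bigr => k _; rewrite mulr_sumr; apply: eq_bigr => l _.
    have -> : \sum_i J b i * (phi x 0 i * D l (ph b) x) = (\sum_i J b i * phi x 0 i) * D l (ph b) x.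
      by rewrite mulr_suml; apply: eq_bigr => i' _; ring.
    by ring.
  rewrite exchange_big /=; apply: eq_bigr => i' _.
  rewrite mulN1r -mulNr /alpha opprK mulr_suml; apply: eq_bigr => b _.
  by ring.
have cx k : C1 (fun x : V => x 0 k) by exact: C1_coord.
have E3 : IT M (fun x => \sum_k \sum_l J k l * (w x * x 0 k * std l x)) =
   m%:R * IT M chi.
  have c2 : C1 chi := C2_C1 cchi.
  (* Integration by parts, since [w x * x 0 k] is [D k chi]. *)
  have I k j : IT M (fun x => w x * x 0 k * x 0 j) = - ((k == j)%:R * IT M chi).
    have z : IT M (D k (fun x => chi x * x 0 j)) = 0.
      apply: IT_D => //; first exact: C1_mul.
      exact: vanishM.
    move: z; rewrite D_mul // D_coord.
    have -> : (fun x => D k chi x * x 0 j + chi x * (k == j)%:R) =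
      fun x => w x * x 0 k * x 0 j + (k == j)%:R * chi x.
      by apply/funext => x; rewrite Dchi [chi x * _]mulrC.
    have cc : continuous chi := C1_cts c2.
    rewrite ITD //; last 2 first.
    - by apply: ctsM; [exact: C1_cts|exact: cts_coord].
    - by apply: ctsM => //; exact: ctsC.
    by rewrite ITZ // => /eqP; rewrite addr_eq0 => /eqP.
  have ct k l : continuous (fun x => J k l * (w x * x 0 k * std l x)).
    apply: ctsM; first exact: ctsC.
    by apply: ctsM; [exact: C1_cts|apply: C1_cts; exact: C1_std].
  have ct3 k j : continuous (fun x => w x * x 0 k * x 0 j).
    by apply: ctsM; [exact: C1_cts|exact: cts_coord].
  rewrite IT_sum //; last by move=> k _; apply: cts_sum => l _; exact: ct.
  have S k : IT M (fun x => \sum_l J k l * (w x * x 0 k * std l x)) = IT M chi.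
    rewrite IT_sum //.
    transitivity (\sum_l \sum_j J k l * J l j * IT M (fun x => w x * x 0 k * x 0 j)).
      apply: eq_bigr => l _.
      have -> : (fun x => J k l * (w x * x 0 k * std l x)) =
         fun x => \sum_j J k l * J l j * (w x * x 0 k * x 0 j).
        apply/funext => x; rewrite /std !mulr_sumr; apply: eq_bigr => j _.
        by ring.
      rewrite IT_sum //; last by move=> j _; apply: ctsM; [exact: ctsC|exact: ct3].
      by apply: eq_bigr => j _; rewrite ITZ.
    rewrite exchange_big /= (bigD1 k) //= [X in _ + X]big1 ?addr0.
      rewrite -mulr_suml I eqxx mul1r.
      have -> : \sum_l J k l * J l k = -1.
        by have /matrixP/(_ k k) := JJ; rewrite !mxE eqxx.
      by rewrite mulrNN mul1r.
    move=> j jk; rewrite big1 // => l _; rewrite I eq_sym (negbTE jk).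
    by rewrite mul0r oppr0 mulr0.
  under eq_bigr do rewrite S.
  by rewrite sumr_const card_ord mulr_natl.
have ca i' : continuous (fun x => alpha i' x * phi x 0 i').
  by apply: ctsM; [exact (C1_cts (C1_alpha i'))|exact (C1_cts (C2_C1 (cphi i')))].
move: H; rewrite E1 E2 E3 IT_sum //; last by move=> k _; apply: ctsM => //; exact: ctsC.
under eq_bigr do rewrite ITZ // (IT_alpha_phi_eq _ i).
rewrite sumr_const card_ord -[X in X - _]mulr_natl => /eqP.
rewrite subr_eq0 => /eqP e.
have m0 : m%:R != 0 :> R by rewrite pnatr_eq0 -lt0n; apply: leq_trans m3.
by rewrite -(mulfI m0 e) mulN1r opprK.
Qed.

End SymplecticMap.

(** * Integrals of products of functions of one coordinate *)

Section ProductIntegrals.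
Variables (R : realType) (m : nat).
Local Notation V := 'rV[R]_m.
Implicit Types (x p q : V) (i j k : 'I_m).

Lemma D_indep (f : V -> R) i : (forall x t, f (upd x i t) = f x) ->
  D i f = fun=> 0.
Proof.
move=> fi; apply/funext => x; apply: (proj2 (D_upd (k := f) _)).
have -> : (fun t => f (upd x i t)) = fun=> f x by apply/funext => t.
exact: is_derive_cst.
Qed.

Lemma C1_prod (I : Type) (s : seq I) (P : pred I) (F : I -> V -> R) :
  (forall l, C1 (F l)) -> C1 (fun x => \prod_(l <- s | P l) F l x).
Proof.
move=> cF; elim: s => [|k s IH].
  have -> : (fun x => \prod_(k <- [::] | P k) F k x) = fun=> 1.
    by apply/funext => x; rewrite big_nil.
  exact: C1_cst.
have -> : (fun x => \prod_(k <- k :: s | P k) F k x) =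
    fun x => (if P k then F k x else 1) * \prod_(l <- s | P l) F l x.
  by apply/funext => x; rewrite big_cons; case: ifP => //; rewrite mul1r.
by apply: C1_mul => //; case: (P k) => //; exact: C1_cst.
Qed.

Lemma IT_prod (N : R) (g : 'I_m -> R -> R) : 0 <= N -> (forall i, continuous (g i)) ->
  IT N (fun p => \prod_i g i (p 0 i)) = \prod_i int (- N) N (g i).
Proof.
move=> N0 cg; rewrite /IT.
suff H s x : uniq s -> ItS N s (fun p => \prod_i g i (p 0 i)) x =
   \prod_i (if i \in s then int (- N) N (g i) else g i (x 0 i)).
  by rewrite H ?enum_uniq //; apply: eq_bigr => i _; rewrite mem_enum.
elim: s x => [|i s IH] x; first by move=> _; apply: eq_bigr => i _.
move=> /= /andP[is_ us]; rewrite /Int.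
pose c := \prod_(j | j != i) (if j \in s then int (- N) N (g j) else g j (x 0 j)).
have -> : (fun t => ItS N s (fun p => \prod_i g i (p 0 i)) (upd x i t)) =
    fun t => c * g i t.
  apply/funext => t; rewrite IH // (bigD1 i) //= (negbTE is_) updE eqxx mulrC.
  by congr (_ * _); apply: eq_bigr => j ji; rewrite updE (negbTE ji).
rewrite intZ // [RHS](bigD1 i) //= in_cons eqxx mulrC; congr (_ * _).
by apply: eq_bigr => j ji; rewrite in_cons (negbTE ji).
Qed.

End ProductIntegrals.

(** * One-dimensional mollifiers *)

Section Kernels.
Variable R : realType.
Implicit Types (s t u : R).

(** For [s > 0], [theta s] is a kernel of mass one on [[0, s]] and [Theta s] a smoothed indicator of
    the negative half-line with derivative [- theta s]. The summand 0 gives the arguments the shape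
    expected by [deriv_of_affine]. *)
Definition theta s u := s^-1 * dstep (s^-1 * u + 0).
Definition Theta s u := 1 - step (s^-1 * u + 0).
Definition dtheta s u := s^-1 * (s^-1 * ddstep (s^-1 * u + 0)).

Lemma theta_deriv s : deriv_of (theta s) (dtheta s).
Proof. exact/deriv_of_scale/deriv_of_affine/dstep_deriv. Qed.

Lemma Theta_deriv s : deriv_of (Theta s) (fun u => - theta s u).
Proof.
move=> u; rewrite -[X in is_derive _ _ _ X]add0r; apply: is_deriveD.
by apply: is_deriveN; exact: (deriv_of_affine _ _ (@step_deriv R)).
Qed.

Lemma cts_theta s : continuous (theta s).
Proof. by move=> u; exact: is_derive_cont (theta_deriv s u). Qed.

Lemma cts_Theta s : continuous (Theta s).
Proof. by move=> u; exact: is_derive_cont (Theta_deriv s u). Qed.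

Lemma cts_dtheta s : continuous (dtheta s).
Proof.
apply: ctsM; first exact: ctsC.
apply: ctsM; first exact: ctsC.
apply: (@cts_comp _ _ _ (fun u => s^-1 * u + 0)); last exact: cts_ddstep.
apply: ctsD; last exact: ctsC.
by apply: ctsM; [exact: ctsC|exact: cts_id].
Qed.

Lemma theta_ge0 s u : 0 < s -> 0 <= theta s u.
Proof. by move=> s0; rewrite mulr_ge0 ?dstep_ge0 // invr_ge0 ltW. Qed.

Lemma theta_eq0 s u : 0 < s -> u <= 0 \/ s <= u -> theta s u = 0.
Proof.
move=> s0 us; rewrite /theta dstep_eq0 ?mulr0 // addr0 mulrC.
by case: us => us; [left|right];
   rewrite ?ler_pdivlMr ?ler_pdivrMr ?mul1r ?mul0r.
Qed.

Lemma theta_le s u : 0 < s -> theta s u <= s^-1 * (mass R)^-1.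
Proof. by move=> s0; rewrite ler_wpM2l ?dstep_le // invr_ge0 ltW. Qed.

Lemma Theta_eq1 s u : 0 < s -> u <= 0 -> Theta s u = 1.
Proof.
by move=> s0 u0; rewrite /Theta step_eq0 ?subr0 // addr0 pmulr_rle0 // invr_gt0.
Qed.

Lemma Theta_eq0 s u : 0 < s -> s <= u -> Theta s u = 0.
Proof.
move=> s0 su; rewrite /Theta step_eq1 ?subrr // addr0 mulrC.
by rewrite ler_pdivlMr // mul1r.
Qed.

Lemma int_reflect (g : R -> R) (a b c : R) : continuous g ->
  int a b (fun t => g (c - t)) = int (c - b) (c - a) g.
Proof.
move=> cg; have := @int_scale _ (fun t => g (t + c)) (-1) a b.
have cgc : continuous (fun t => g (t + c)).
  by apply: (@cts_comp _ _ _ (fun t => t + c)) => //; apply: ctsD; [exact: cts_id|exact: ctsC].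
move=> /(_ cgc); rewrite int_shift // !mulN1r => e.
have -> : (fun t => g (c - t)) = fun t => g (-1 * t + c).
  by apply/funext => t; rewrite mulN1r addrC.
by rewrite -[LHS]opprK e [RHS]intC ![c - _]addrC.
Qed.

Lemma int_theta s a N : 0 < s -> `|a| + s <= N ->
  int (- N) N (fun t => theta s (a - t)) = 1.
Proof.
move=> s0 aN; rewrite int_reflect; last exact: cts_theta.
have ht : deriv_of (fun u => - Theta s u) (theta s).
  by move=> u; rewrite -[theta s u]opprK; apply: is_deriveN; exact: Theta_deriv.
have := ler_norm a; have := ler_norm (- a); rewrite normrN => h1 h2.
rewrite (intE _ _ (@cts_theta s) ht) opprK Theta_eq0 ?Theta_eq1 //; last first.
- by lra.
- by lra.
by rewrite oppr0 opprK add0r.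
Qed.

(** The value is affine in [a] with slope -1. Its constant term disappears later because [alpha i0]
    has integral 0. *)
Lemma int_Theta s a N : 0 < s -> `|a| + s <= N ->
  int (- N) N (fun t => Theta s (a - t)) = N + int 0 s (Theta s) - a.
Proof.
move=> s0 aN; rewrite int_reflect; last exact: cts_Theta.
have := ler_norm a; have := ler_norm (- a); rewrite normrN => h1 h2.
rewrite (int_split 0) (int_split s _ 0).
have -> : int (a - N) 0 (Theta s) = int (a - N) 0 (fun=> 1).
  apply: eq_int; [exact: cts_Theta|exact: ctsC|lra|].
  by move=> u /andP[_ u0]; rewrite Theta_eq1.
have -> : int s (a - - N) (Theta s) = int s (a - - N) (fun=> 0).
  apply: eq_int; [exact: cts_Theta|exact: ctsC|lra|].
  by move=> u /andP[u0 _]; rewrite Theta_eq0.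
by rewrite !int_cst; lra.
Qed.

End Kernels.

(** * The mollified push-forward and its potential *)

Section Mollified.
Variables (R : realType) (m : nat).
Local Notation V := 'rV[R]_m.
Implicit Types (x p q : V) (i j k : 'I_m).
Variables (phi : V -> V) (Om : set V) (M : R) (alpha : 'I_m -> V -> R) (i0 : 'I_m).
Hypotheses (M0 : 0 <= M) (cphi : forall a, C1 (fun x => phi x 0 a))
  (calpha : forall i, C1 (alpha i))
  (alpha0 : forall i x, ~ Om x -> alpha i x = 0)
  (IT_alpha_D : forall (K : V -> R) i j, C1 K ->
     IT M (fun x => alpha i x * D j K (phi x)) =
     IT M (fun x => alpha j x * D i K (phi x)))
  (IT_alpha0 : IT M (alpha i0) = 0).

Definition eta (s : R) q : R := \prod_i theta s (q 0 i).
(** The density at [p] of the push-forward of [alpha j] under [phi], smoothed at scale [s]. *)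
Definition moll (s : R) j p : R := IT M (fun x => alpha j x * eta s (phi x - p)).
(** A primitive of [- eta s] in the direction [i0]; integrating against it amounts to integrating
    [moll s i0] up to [p] along that axis. *)
Definition slab (s : R) q : R :=
  Theta s (q 0 i0) * \prod_(i | i != i0) theta s (q 0 i).
(* A smoothed extension of [chi o phi^-1] from the image of [phi] to the whole
   space. *)
Definition pot (s : R) p : R := IT M (fun x => alpha i0 x * slab s (phi x - p)).

Lemma C1_theta s i : C1 (fun q : V => theta s (q 0 i)).
Proof.
by apply: (@C1_comp _ _ (theta s) (dtheta s) (fun q : V => q 0 i));
  [exact: theta_deriv|exact: cts_dtheta|exact: C1_coord].
Qed.

Lemma C1_Theta s i : C1 (fun q : V => Theta s (q 0 i)).
Proof.
apply: (@C1_comp _ _ (Theta s) (fun u => - theta s u) (fun q : V => q 0 i)).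
- exact: Theta_deriv.
- by apply: ctsN; exact: cts_theta.
- exact: C1_coord.
Qed.

Lemma C1_eta s : C1 (eta s).
Proof. by apply: C1_prod => i; exact: C1_theta. Qed.

Lemma C1_slab s : C1 (slab s).
Proof.
by apply: C1_mul; [exact: C1_Theta|apply: C1_prod => i; exact: C1_theta].
Qed.

Lemma D_slab s q : D i0 (slab s) q = - eta s q.
Proof.
have cP : C1 (fun q : V => \prod_(i | i != i0) theta s (q 0 i)).
  by apply: C1_prod => i; exact: C1_theta.
rewrite D_mul //; last exact: C1_Theta.
rewrite (D_indep (f := fun q : V => \prod_(i | i != i0) theta s (q 0 i))).
  rewrite mulr0 addr0 (D_comp _ (Theta_deriv s)); last exact: C1_coord.
  by rewrite D_coord eqxx mulr1 mulNr /eta [in RHS](bigD1 i0).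
by move=> x t; apply: eq_bigr => i ii; rewrite updE (negbTE ii).
Qed.

Lemma C1_shift (f : V -> R) p : C1 f ->
  C1 (fun q => f (q - p)) /\ forall j, D j (fun q => f (q - p)) = fun q => D j f (q - p).
Proof.
move=> cf; have cl l : C1 (fun q : V => (q - p) 0 l).
  have -> : (fun q : V => (q - p) 0 l) = fun q => q 0 l + - p 0 l.
    by apply/funext => q; rewrite !mxE.
  by apply: C1_add; [exact: C1_coord|exact: C1_cst].
have [c1 DE] := chain_map cf cl; split=> // j; rewrite DE; apply/funext => q.
rewrite (bigD1 j) //= big1 ?addr0.
  rewrite (_ : D j _ q = 1) ?mul1r //.
  have -> : (fun q : V => (q - p) 0 j) = fun q => q 0 j + - p 0 j.
    by apply/funext => q'; rewrite !mxE.
  by rewrite D_add ?D_coord ?D_cst ?eqxx ?addr0 //; [exact: C1_coord|exact: C1_cst].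
move=> l lj; rewrite (_ : D j _ q = 0) ?mul0r //.
have -> : (fun q : V => (q - p) 0 l) = fun q => q 0 l + - p 0 l.
  by apply/funext => q'; rewrite !mxE.
by rewrite D_add ?D_coord ?D_cst ?addr0 1?eq_sym ?(negbTE lj) //; [exact: C1_coord|exact: C1_cst].
Qed.

Lemma C1_reflect (f : V -> R) y : C1 f ->
  C1 (fun p => f (y - p)) /\ forall j, D j (fun p => f (y - p)) = fun p => - D j f (y - p).
Proof.
move=> cf; have E l : (fun p : V => (y - p) 0 l) = fun p => y 0 l + - p 0 l.
  by apply/funext => q; rewrite !mxE.
have cl l : C1 (fun p : V => (y - p) 0 l).
  by rewrite E; apply: C1_add; [exact: C1_cst|apply: C1_opp; exact: C1_coord].
have DE' j l p : D j (fun p : V => (y - p) 0 l) p = - (j == l)%:R.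
  rewrite E D_add; [|exact: C1_cst|apply: C1_opp; exact: C1_coord].
  by rewrite D_cst D_opp ?D_coord ?add0r //; exact: C1_coord.
have [c1 DE] := chain_map cf cl; split=> // j; rewrite DE; apply/funext => p.
rewrite (bigD1 j) //= big1 ?addr0; first by rewrite DE' eqxx mulN1r.
by move=> l lj; rewrite DE' eq_sym (negbTE lj) oppr0 mul0r.
Qed.

Lemma cts_phi : continuous phi.
Proof. by apply: cts_rV => a; exact: C1_cts. Qed.

Lemma cts_phi_sub : continuous (fun z : V * V => phi z.1 - z.2).
Proof.
move=> z; apply: cvgB; last exact: cvg_snd.
by apply: (@continuous_comp _ _ _ fst phi); [exact: cvg_fst|exact: cts_phi].
Qed.

Lemma cts_fst (f : V -> R) : continuous f -> continuous (fun z : V * V => f z.1).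
Proof. by move=> cf; apply: (@cts_comp _ _ _ fst f) => // z; exact: cvg_fst. Qed.

Lemma cts_kernel i (f : V -> R) : continuous f ->
  continuous (fun z : V * V => alpha i z.1 * f (phi z.1 - z.2)).
Proof.
move=> cf; apply: ctsM; first by apply: cts_fst; exact: C1_cts.
by apply: (@cts_comp _ _ _ (fun z : V * V => phi z.1 - z.2)) => //; exact: cts_phi_sub.
Qed.

(** The weak closedness [IT_alpha_D], tested with the translated slab, moves the derivative from
    direction [j] to direction [i0], where the slab differentiates to [- eta s]. *)
Lemma pot_C1 s : C1 (pot s) /\ forall j, D j (pot s) = moll s j.
Proof.
have cs := C1_slab s.
pose F x p := alpha i0 x * slab s (phi x - p).
have DF j x p : D j (F x) p = alpha i0 x * - D j (slab s) (phi x - p).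
  have [c1 DE] := C1_reflect (phi x) cs.
  rewrite D_mul //; last exact: C1_cst.
  by rewrite D_cst mul0r add0r DE.
have [|||c1 DE] := @C1_blf R m V (box M) _ (IT M) F (@box_compact R m M) (IT_functional m M0).
- exact: cts_kernel (C1_cts cs).
- move=> x; apply: C1_mul; first exact: C1_cst.
  exact: (proj1 (C1_reflect (phi x) cs)).
- move=> j; have -> : (fun z : V * V => D j (F z.1) z.2) =
    fun z => alpha i0 z.1 * (fun q => - D j (slab s) q) (phi z.1 - z.2).
    by apply/funext => z; rewrite DF.
  by apply: (@cts_kernel i0 (fun q => - D j (slab s) q)); apply: ctsN; exact: C1_D.
- split=> // j; rewrite DE; apply/funext => p.
  have ck k l : continuous (fun x => alpha k x * D l (slab s) (phi x - p)).
    apply: (@section_cts _ _ _ (fun x p => alpha k x * D l (slab s) (phi x - p))).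
    by apply: (@cts_kernel k (D l (slab s))); exact: C1_D.
  have [c2 DE2] := C1_shift p cs.
  have := IT_alpha_D i0 j c2; rewrite !DE2 => e.
  have -> : (fun x => D j (F x) p) = fun x => -1 * (alpha i0 x * D j (slab s) (phi x - p)).
    by apply/funext => x; rewrite DF mulN1r mulrN.
  rewrite (ITZ (-1) M0 (ck i0 j)) e -(ITZ (-1) M0 (ck j i0)); congr IT; apply/funext => x.
  by rewrite D_slab; ring.
Qed.

Lemma moll_eq0 s j p : 0 < s -> (forall x, Om x -> s <= `|phi x - p|) ->
  moll s j p = 0.
Proof.
move=> s0 far; rewrite -(IT0 m M0); congr IT; apply/funext => x.
have [Ox|/alpha0 ->] := pselect (Om x); last by rewrite mul0r.
have [i /negP ni] : exists i, ~~ ((0 < (phi x - p) 0 i) && ((phi x - p) 0 i < s)).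
  apply/existsP; rewrite -negb_forall; apply/negP => /forallP H.
  have := far x Ox; rewrite leNgt norm_rV_lt // => /negP; apply; apply/forallP => i.
  by have /andP[h1 h2] := H i; rewrite gtr0_norm.
rewrite /eta (bigD1 i) //= theta_eq0 ?mul0r ?mulr0 //.
have [u0|u0] := leP ((phi x - p) 0 i) 0; [by left|right].
by rewrite leNgt; apply/negP => us; apply: ni; rewrite u0.
Qed.

(** After Fubini the inner integral over [p] is a constant minus [phi x 0 i0], for [x] in [Om]; the
    constant is killed by [IT_alpha0]. *)
Lemma IT_pot s N : 0 < s -> (forall x, Om x -> `|phi x| + s <= N) -> 0 <= N ->
  IT N (pot s) = - IT M (fun x => alpha i0 x * phi x 0 i0).
Proof.
move=> s0 big N0.
have cF : continuous (fun z : V * V => alpha i0 z.1 * slab s (phi z.1 - z.2)).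
  exact: cts_kernel (C1_cts (C1_slab s)).
have -> : IT N (pot s) = IT M (fun x => IT N (fun p => alpha i0 x * slab s (phi x - p))).
  by rewrite /IT; apply/esym; exact: (blf_ItS _ _ _ (@box_compact R m M) (IT_functional m M0) cF).
pose c := int 0 s (Theta s).
have E x : IT N (fun p => alpha i0 x * slab s (phi x - p)) =
   (N + c) * alpha i0 x + -1 * (alpha i0 x * phi x 0 i0).
  have cs : continuous (fun p => slab s (phi x - p)).
    exact: C1_cts (proj1 (C1_reflect (phi x) (C1_slab s))).
  rewrite ITZ //; have [Ox|/alpha0 ->] := pselect (Om x); last by rewrite !mul0r !mulr0 addr0.
  pose g i t := if i == i0 then Theta s (phi x 0 i - t) else theta s (phi x 0 i - t).
  have sE : (fun p => slab s (phi x - p)) = fun p => \prod_i g i (p 0 i).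
    apply/funext => p; rewrite /slab [RHS](bigD1 i0) //= /g eqxx !mxE; congr (_ * _).
    by apply: eq_bigr => i /negbTE ->; rewrite !mxE.
  have cg i : continuous (g i).
    have cc : continuous (fun t => phi x 0 i - t) by apply: ctsB; [exact: ctsC|exact: cts_id].
    rewrite /g; case: (i == i0); apply: (@cts_comp _ _ _ (fun t => phi x 0 i - t)) => //.
      exact: cts_Theta.
    exact: cts_theta.
  have b i : `|phi x 0 i| + s <= N.
    by apply: le_trans (big x Ox); rewrite lerD2r coord_le.
  rewrite sE IT_prod // (bigD1 i0) //= big1 ?mulr1.
    rewrite /g eqxx int_Theta // -/c; ring.
  by move=> i /negbTE ii; rewrite /g ii int_theta.
have -> : (fun x => IT N (fun p => alpha i0 x * slab s (phi x - p))) =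
   fun x => (N + c) * alpha i0 x + -1 * (alpha i0 x * phi x 0 i0).
  by apply/funext => x; exact: E.
have ca : continuous (alpha i0) by exact: C1_cts.
have cap : continuous (fun x => alpha i0 x * phi x 0 i0) by apply: ctsM => //; exact: C1_cts.
rewrite ITD //; try by apply: ctsM => //; exact: ctsC.
by rewrite !ITZ // IT_alpha0 mulr0 add0r mulN1r.
Qed.

End Mollified.

(** * Affine changes of variables and strict differentiability *)

Section AffineChange.
Variables (R : realType) (m : nat).
Local Notation V := 'rV[R]_m.
Implicit Types (x v u : V) (i j k : 'I_m) (f g : V -> R) (M s : R).

Lemma cts_affine v s : continuous (fun u : V => v + s *: u).
Proof.
apply: cts_rV => i; have -> : (fun u : V => (v + s *: u) 0 i) = fun u => v 0 i + s * u 0 i.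
  by apply/funext => u; rewrite !mxE.
by apply: ctsD; [exact: ctsC|apply: ctsM; [exact: ctsC|exact: cts_coord]].
Qed.

Lemma cts_addv v : continuous (fun x : V => x + v).
Proof.
have -> : (fun x : V => x + v) = fun x => v + 1 *: x.
  by apply/funext => x; rewrite scale1r addrC.
exact: cts_affine.
Qed.

Lemma IT_shift1 M f (c : R) i : 0 <= M -> continuous f -> vanish M f ->
  vanish M (fun x => f (x + c *: delta_mx 0 i)) ->
  IT M (fun x => f (x + c *: delta_mx 0 i)) = IT M f.
Proof.
move=> M0 cf vf vfc.
have cfc : continuous (fun x => f (x + c *: delta_mx 0 i)).
  apply: (@cts_comp _ _ _ (fun x => x + c *: delta_mx 0 i)) => //.
  exact: cts_addv.
apply: (@eq_IT_Int _ _ _ i) => //; apply/funext => x; rewrite /Int.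
have E t : f (upd x i t + c *: delta_mx 0 i) = f (upd x i (1 * t + c)).
  by rewrite addrC upd_shift mul1r addrC.
have -> : (fun t => f (upd x i t + c *: delta_mx 0 i)) = fun t => f (upd x i (1 * t + c)).
  by apply/funext => t; exact: E.
have un t : M <= `|t| -> M <= `|upd x i t|.
  by move=> Mt; apply: le_trans Mt _; have := coord_le (upd x i t) i; rewrite updE eqxx.
have cg : continuous (fun t => f (upd x i t)) by exact: cts_updt.
have := int_affine (a := 1) (c := c) cg (oner_neq0 _) M0.
rewrite normr1 mul1r; apply=> t /un; first exact: vf.
by move=> /vfc; rewrite E.
Qed.

Lemma IT_shift M f v : 0 <= M -> continuous f -> vanish M f ->
  IT (M + `|v|) (fun x => f (x + v)) = IT M f.
Proof.
move=> M0 cf vf; pose N := M + `|v|.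
have MN : M <= N by rewrite lerDl.
have N0 := le_trans M0 MN.
pose w (s : seq 'I_m) : V := \sum_(i <- s) v 0 i *: delta_mx 0 i.
suff H (r : seq 'I_m) : uniq r -> IT N (fun x => f (x + w r)) = IT N f.
  rewrite -(IT_widen M0 MN cf vf) -(H (index_enum 'I_m)) ?index_enum_uniq //.
  by congr IT; apply/funext => x; rewrite /w -row_sum_delta.
have wE (q : seq 'I_m) j : uniq q -> w q 0 j = if j \in q then v 0 j else 0.
  elim: q => [_|i q IH /= /andP[is_ us]]; first by rewrite /w big_nil mxE.
  rewrite /w big_cons mxE [X in X + _]mxE [X in _ * X]mxE -/(w q) IH // eqxx /= in_cons.
  case: (eqVneq j i) => [->|ji] /=; first by rewrite (negbTE is_) mulr1 addr0.
  by rewrite mulr0 add0r.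
have wv (q : seq 'I_m) : uniq q -> vanish N (fun x => f (x + w q)).
  move=> us x Nx; apply: vf; have h : `|w q| <= `|v|.
    rewrite norm_rV_le //; apply/forallP => j; rewrite wE //.
    by case: ifP; rewrite ?normr0 // coord_le.
  have : `|x| <= `|x + w q| + `|w q|.
    by rewrite -{1}[x](addrK (w q)) (le_trans (ler_normB _ _)).
  by move: Nx; rewrite /N; lra.
have cw (q : seq 'I_m) : continuous (fun x => f (x + w q)).
  apply: (@cts_comp _ _ _ (fun x => x + w q)) => //.
  exact: cts_addv.
elim: r => [_|i r IH /= /andP[is_ us]].
  by congr IT; apply/funext => x; rewrite /w big_nil addr0.
rewrite -IH // -(IT_shift1 (c := v 0 i) (i := i) N0 (cw r) (wv r us)).
  by congr IT; apply/funext => x; rewrite /w big_cons addrA.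
have := wv (i :: r); rewrite /= is_ us => /(_ isT) h x /h.
by rewrite /w big_cons addrA.
Qed.

Lemma IT_affine M L f v s : 0 <= M -> 0 <= L -> 0 < s -> continuous f ->
  vanish M f -> vanish L (fun u => f (v + s *: u)) ->
  IT M f = s ^+ m * IT L (fun u => f (v + s *: u)).
Proof.
move=> M0 L0 s0 cf vf vL.
pose N := M + `|v|; pose N' := Num.max L (s * N).
have MN : M <= N by rewrite lerDl.
have N0 := le_trans M0 MN.
have cg : continuous (fun x => f (x + v)).
  apply: (@cts_comp _ _ _ (fun x => x + v)) => //.
  exact: cts_addv.
have cgs : continuous (fun u => f (v + s *: u)).
  apply: (@cts_comp _ _ _ (fun u => v + s *: u)) => //.
  exact: cts_affine.
have vg : vanish N (fun x => f (x + v)).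
  move=> x Nx; apply: vf.
  have : `|x| <= `|x + v| + `|v|.
    by rewrite -{1}[x](addrK v) (le_trans (ler_normB _ _)).
  by move: Nx; rewrite /N; lra.
pose P := Num.max N L.
have NP : N <= P by rewrite le_max lexx.
have LP : L <= P by rewrite le_max lexx orbT.
have P0 := le_trans N0 NP.
have vgs : vanish P (fun u => f (v + s *: u)) by exact: vanish_le vL.
have e1 : IT M f = IT P (fun x => f (x + v)).
  by rewrite -(IT_shift v M0 cf vf) -(IT_widen N0 NP cg vg).
have e2 : IT L (fun u => f (v + s *: u)) = IT P (fun u => f (v + s *: u)).
  by rewrite -(IT_widen L0 LP cgs vL).
have si : 0 < s^-1 by rewrite invr_gt0.
rewrite e1 e2.
have E : (fun u => f (v + s *: u)) = fun u => (fun x => f (x + v)) (s^-1^-1 *: u).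
  by apply/funext => u; rewrite invrK addrC.
have vg' := vanish_le NP vg.
rewrite E in vgs *; rewrite (IT_dilate si P0 cg vg' vgs).
by rewrite mulrA -exprMn divff ?gt_eqF // expr1n mul1r.
Qed.

Lemma is_derive_segment f x v (t : R) : C1 f ->
  is_derive t 1 (fun t => f (x + t *: v)) (\sum_i v 0 i * D i f (x + t *: v)).
Proof.
move=> cf; apply: (@chain_curve _ _ f (fun t => x + t *: v)); first by case: cf.
move=> i; have -> : (fun t => (x + t *: v) 0 i) = fun t => x 0 i + t * v 0 i.
  by apply/funext => a; rewrite !mxE.
rewrite -[X in is_derive _ _ _ X]add0r; apply: is_deriveD.
have -> : (fun t => t * v 0 i) = v 0 i *: id by apply/funext => a; rewrite mulrC.
rewrite -[X in is_derive _ _ _ X]mulr1; apply: is_deriveZ.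
Qed.

(** Strict differentiability: both points vary near [x0], by the mean value inequality on the
    segment between them. This form is what the compactness arguments can patch together. *)
Lemma C1_local f x0 (e : R) : 0 < e -> C1 f -> exists2 r, 0 < r &
  forall x y, `|x - x0| < r -> `|y - x0| < r ->
    `|f x - f y - \sum_i (x - y) 0 i * D i f x0| <= e * `|x - y|.
Proof.
move=> e0 cf; pose d := e / (m%:R + 1).
have m1 : 0 < (m%:R + 1 : R) by rewrite ltr_wpDl.
have d0 : 0 < d by rewrite divr_gt0.
have Hi i : \forall y \near x0, `|D i f y - D i f x0| <= d.
  have /cvgrPdist_le/(_ _ d0) := @C1_D _ _ f i cf x0.
  by apply: filterS => y; rewrite distrC.
have H : \forall y \near x0, forall i, `|D i f y - D i f x0| <= d.
  by apply: (@filter_forall _ _ (fun i y => `|D i f y - D i f x0| <= d) (nbhs x0)).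
have [r /= r0 rH] := (nbhs_ballP _ _).1 H; exists r => // x y xr yr.
pose v := x - y; pose c := \sum_i v 0 i * D i f x0.
have dF (t : R) : is_derive t 1 (fun t => f (y + t *: v) - t * c)
    (\sum_i v 0 i * D i f (y + t *: v) - c).
  apply: is_deriveB; first exact: is_derive_segment.
  have -> : (fun t => t * c) = c *: id by apply/funext => a; rewrite mulrC.
  by rewrite -[X in is_derive _ _ _ X]mulr1; apply: is_deriveZ.
have := increment_le (a := 0) (b := 1) (C := e * `|v|) dF _ ler01.
rewrite !scale1r !scale0r mul1r mul0r addr0 subr0 subr0 mulr1 /v subrKC -/v.
have -> : f x - c - f y = f x - f y - c by ring.
apply=> t /andP[t0 t1].
have tr : ball x0 r (y + t *: v).
  rewrite -ball_normE /=.
  have -> : x0 - (y + t *: v) = - (t *: (x - x0) + (1 - t) *: (y - x0)).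
    by rewrite /v; apply/rowP => i; rewrite !mxE; ring.
  rewrite normrN; apply: (le_lt_trans (ler_normD _ _)).
  rewrite !normrZ ger0_norm // [`|1 - t|]ger0_norm ?subr_ge0 //.
  have [t1'|t1'] := eqVneq t 1; first by rewrite t1' subrr mul1r mul0r addr0.
  have : t < 1 by rewrite lt_neqAle t1'.
  by move: xr yr; move: `|x - x0| `|y - x0| => a b; nra.
rewrite /c -sumrB; apply: (le_trans (ler_norm_sum _ _ _)).
apply: (@le_trans _ _ (\sum_(i < m) `|v| * d)).
  apply: ler_sum => i _; rewrite -mulrBr normrM ler_pM ?coord_le //.
  exact: (rH _ tr i).
rewrite sumr_const card_ord -[leLHS]mulr_natl.
have -> : e * `|v| = (m%:R + 1) * (`|v| * d).
  by rewrite /d; field; rewrite gt_eqF.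
by rewrite ler_wpM2r ?lerDl // mulr_ge0 // ltW.
Qed.

End AffineChange.

(** * Estimates for the mollified push-forward *)

Lemma compact_bounded_fun (R : realType) (T : topologicalType) (K : set T) (f : T -> R) :
  compact K -> continuous f -> exists2 A, 0 <= A & forall x, K x -> `|f x| <= A.
Proof.
move=> /compact_near_coveringP cov cf.
have H : \forall A \near (pinfty_nbhs R), K `<=` (fun x => `|f x| <= A).
  apply: (cov R (pinfty_nbhs R) (fun A x => `|f x| <= A)) => x _.
  have c : \forall x' \near x, `|f x'| < `|f x| + 1.
    by apply: (cvgr_lt `|f x|); [exact: (cts_norm cf)|rewrite ltrDl].
  exists ([set x' | `|f x'| < `|f x| + 1], [set A | `|f x| + 1 <= A]).
    by split => //; exact: nbhs_pinfty_ge.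
  by move=> [x' A] /= [h1 h2]; apply: le_trans (ltW h1) h2.
near (pinfty_nbhs R) => A; exists A; last by near: A.
by near: A; apply: nbhs_pinfty_ge; rewrite num_real.
Unshelve. all: by end_near. Qed.

Section Estimates.
Variables (R : realType) (m : nat).
Local Notation V := 'rV[R]_m.
Implicit Types (x y p q v : V) (i j k a : 'I_m).
Variables (phi : V -> V) (K : set V) (M c : R) (alpha : 'I_m -> V -> R).
Local Notation ph a := (fun x : V => phi x 0 a).
Hypotheses (M0 : 0 <= M) (cphi : forall a, C1 (ph a)) (cK : compact K)
  (inj : forall x y, K x -> K y -> phi x = phi y -> x = y)
  (c0 : 0 < c) (low : forall x v, K x -> c * `|v| <= `|v *m jac phi x|)
  (calpha : forall i, C1 (alpha i))
  (alpha0 : forall i x, ~ K x -> alpha i x = 0)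
  (KM : forall x, K x -> `|x| < M).

Lemma phi_cts : continuous phi.
Proof. by apply: cts_rV => a; exact (C1_cts (cphi a)). Qed.

Lemma phi_local x0 (e : R) : 0 < e -> exists2 r, 0 < r &
  forall x y, `|x - x0| < r -> `|y - x0| < r ->
    `|phi x - phi y - (x - y) *m jac phi x0| <= e * `|x - y|.
Proof.
move=> e0.
have Ha a : \forall r \near 0^'+, forall x y, `|x - x0| < r -> `|y - x0| < r ->
    `|phi x 0 a - phi y 0 a - \sum_i (x - y) 0 i * D i (ph a) x0| <= e * `|x - y|.
  have [r r0 rH] := C1_local x0 e0 (cphi a).
  near=> r' => x y xr yr; apply: rH.
    by apply: (lt_le_trans xr); near: r'; exact: nbhs_right_le.
  by apply: (lt_le_trans yr); near: r'; exact: nbhs_right_le.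
have H := @filter_forall _ _ (fun a r => forall x y, `|x - x0| < r -> `|y - x0| < r ->
  `|phi x 0 a - phi y 0 a - \sum_i (x - y) 0 i * D i (ph a) x0| <= e * `|x - y|)
  _ _ Ha.
near (0 : R)^'+ => r; exists r; first by near: r; exact: nbhs_right_gt.
have rH : forall a x y, `|x - x0| < r -> `|y - x0| < r ->
  `|phi x 0 a - phi y 0 a - \sum_i (x - y) 0 i * D i (ph a) x0| <= e * `|x - y|.
  by near: r; exact: H.
move=> x y xr yr; rewrite norm_rV_le; last by rewrite mulr_ge0 // ltW.
apply/forallP => a; rewrite !mxE.
have := rH a x y xr yr.
congr (`| _ - _ | <= _); apply: eq_bigr => i _; by rewrite !mxE.
Unshelve. all: by end_near. Qed.

(** Compactness of [K x K]: near a diagonal point half of the bound [c] on the differential survives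
    the linearisation error, and away from the diagonal injectivity keeps the images apart. *)
Lemma lower_lipschitz : exists2 d, 0 < d &
  forall x y, K x -> K y -> d * `|x - y| <= `|phi x - phi y|.
Proof.
pose P (d : R) (z : V * V) := K z.1 -> K z.2 -> d * `|z.1 - z.2| <= `|phi z.1 - phi z.2|.
have cKK : compact (K `*` K) by exact: compact_setX.
have cphid : continuous (fun z : V * V => `|phi z.1 - phi z.2|).
  move=> z; apply: cvg_norm; apply: cvgB.
    by apply: (@continuous_comp _ _ _ fst phi); [exact: cvg_fst|exact: phi_cts].
  by apply: (@continuous_comp _ _ _ snd phi); [exact: cvg_snd|exact: phi_cts].
have cd : continuous (fun z : V * V => `|z.1 - z.2|).
  by move=> z; apply: cvg_norm; apply: cvgB; [exact: cvg_fst|exact: cvg_snd].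
have H : \forall d \near (0 : R)^'+, K `*` K `<=` P d.
  apply: (compact_near_coveringP _).1 cKK _ _ _ _ _ => -[x0 y0] [/= Kx Ky].
  have [e|ne] := eqVneq x0 y0.
    subst y0; have c20 : 0 < c / 2 by rewrite divr_gt0.
    have [r r0 rH] := phi_local x0 c20.
    exists ([set z | `|z.1 - x0| < r /\ `|z.2 - x0| < r], [set d | d <= c / 2]).
      split=> /=; last exact: nbhs_right_le.
      exists (ball x0 r, ball x0 r) => /=; first by split; exact: nbhsx_ballx.
      by move=> [u v] /= []; rewrite -ball_normE /= !(distrC x0).
    move=> [[x y] d] /= [[xr yr] dc] _ _; have := rH _ _ xr yr.
    have := low (x - y) Kx.
    have : `|(x - y) *m jac phi x0| <= `|phi x - phi y - (x - y) *m jac phi x0| + `|phi x - phi y|.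
      by rewrite distrC -lerBlDr; exact: lerB_dist.
    have : d * `|x - y| <= c / 2 * `|x - y| by rewrite ler_wpM2r.
    lra.
  have d0 : 0 < `|phi x0 - phi y0|.
    rewrite normr_gt0 subr_eq0; apply: contra_neq ne; exact: inj.
  (* [B] bounds the distance of points near [(x0, y0)], which turns the gap between the images into
     a linear bound. *)
  pose e := `|phi x0 - phi y0|; pose B := `|x0 - y0| + 1.
  have B0 : 0 < B by rewrite ltr_wpDl.
  exists ([set z | e / 2 < `|phi z.1 - phi z.2| /\ `|z.1 - z.2| < B], [set d | d <= e / 2 / B]).
    split=> /=; last by apply: nbhs_right_le; rewrite !divr_gt0.
    have h1 : e / 2 < `|phi (x0, y0).1 - phi (x0, y0).2| by have := d0; rewrite /= -/e; lra.
    have h2 : `|(x0, y0).1 - (x0, y0).2| < B by rewrite /= /B ltrDl.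
    exact: (filterI (cvgr_gt _ (cphid (x0, y0)) _ h1) (cvgr_lt _ (cd (x0, y0)) _ h2)).
  move=> [[x y] d] /= [[h1 h2] dB] _ _.
  apply: le_trans (ltW h1); apply: (@le_trans _ _ (e / 2 / B * `|x - y|)).
    by rewrite ler_wpM2r.
  rewrite mulrAC ler_pdivrMr // ler_wpM2l ?ltW // divr_gt0 //.
near (0 : R)^'+ => d; have dP : K `*` K `<=` P d by near: d; exact: H.
exists d; first by near: d; exact: nbhs_right_gt.
by move=> x y Kx Ky; exact: (dP (x, y)).
Unshelve. all: by end_near. Qed.

Lemma eta_eq0 (s : R) q : 0 < s -> s <= `|q| -> eta s q = 0.
Proof.
move=> s0 sq; have [i /negP ni] : exists i, ~~ ((0 < q 0 i) && (q 0 i < s)).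
  apply/existsP; rewrite -negb_forall; apply/negP => /forallP H.
  move: sq; rewrite leNgt norm_rV_lt // => /negP; apply; apply/forallP => i.
  by have /andP[h1 h2] := H i; rewrite gtr0_norm.
rewrite /eta (bigD1 i) //= theta_eq0 ?mul0r //.
have [u0|u0] := leP (q 0 i) 0; [by left|right].
by rewrite leNgt; apply/negP => us; apply: ni; rewrite u0.
Qed.

Lemma eta_scale (s : R) q : eta s q = s^-1 ^+ m * eta 1 (s^-1 *: q).
Proof.
rewrite /eta -[in s^-1 ^+ _](card_ord m) -prodr_const -big_split /=.
apply: eq_bigr => i _; rewrite /theta !mxE; congr (_ * _).
by rewrite invr1 !mul1r !addr0.
Qed.

Lemma eta1_ge0 q : 0 <= eta 1 q.
Proof. by apply: prodr_ge0 => i _; exact: theta_ge0. Qed.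

Lemma eta1_le q : `|eta 1 q| <= (mass R)^-1 ^+ m.
Proof.
rewrite ger0_norm ?eta1_ge0 // -[in leRHS](card_ord m) -prodr_const.
apply: ler_prod => i _; rewrite theta_ge0 //=.
by apply: le_trans (theta_le _ ltr01) _; rewrite invr1 mul1r.
Qed.

Lemma cts_eta s : continuous (eta s : V -> R).
Proof. exact (C1_cts (@C1_eta R m s)). Qed.

Lemma IT_eta1 L : 1 <= L -> IT L (eta 1 : V -> R) = 1.
Proof.
move=> L1; have -> : (eta 1 : V -> R) = fun q => \prod_i theta 1 (q 0 i) by [].
rewrite (IT_prod (g := fun _ => theta 1)); [|lra|by move=> i; exact: cts_theta].
rewrite big1 // => i _.
have ht : deriv_of (fun u => - Theta 1 u) (theta (1 : R)).
  by move=> u; rewrite -[theta 1 u]opprK; apply: is_deriveN; exact: Theta_deriv.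
rewrite (intE _ _ (@cts_theta R 1) ht) Theta_eq0 // Theta_eq1 //; last lra.
by rewrite oppr0 opprK add0r.
Qed.

(** The substitution [x = y + s v] cancels the factor [s^-m] of the kernel, so that the integrand
    stays bounded as [s] tends to 0. *)
Lemma moll_rescale (s L : R) j p y : 0 < s -> 0 <= L ->
  vanish L (fun v => alpha j (y + s *: v) * eta 1 (s^-1 *: (phi (y + s *: v) - p))) ->
  moll phi M alpha s j p =
  IT L (fun v => alpha j (y + s *: v) * eta 1 (s^-1 *: (phi (y + s *: v) - p))).
Proof.
move=> s0 L0 vL.
have cf : continuous (fun x => alpha j x * eta s (phi x - p)).
  apply: ctsM; first exact (C1_cts (calpha j)).
  apply: (@cts_comp _ _ _ (fun x => phi x - p)); last exact: cts_eta.
  by apply: (@cts_comp _ _ _ phi (fun x => x + - p)); [exact: phi_cts|exact: cts_addv].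
have E : (fun v => alpha j (y + s *: v) * eta s (phi (y + s *: v) - p)) =
  fun v => s^-1 ^+ m * (alpha j (y + s *: v) * eta 1 (s^-1 *: (phi (y + s *: v) - p))).
  by apply/funext => v; rewrite eta_scale mulrCA.
have vM : vanish M (fun x => alpha j x * eta s (phi x - p)).
  by move=> x Mx; rewrite alpha0 ?mul0r // => /KM; rewrite ltNge Mx.
have vL' : vanish L (fun v => alpha j (y + s *: v) * eta s (phi (y + s *: v) - p)).
  by move=> v /vL; rewrite (congr1 (@^~ v) E) => ->; rewrite mulr0.
rewrite /moll (IT_affine M0 L0 s0 cf vM vL') E ITZ //.
  by rewrite mulrA -exprMn divff ?gt_eqF // expr1n mul1r.
have cs1 : s^-1 ^+ m != 0 by rewrite expf_neq0 // invr_neq0 // gt_eqF.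
have -> : (fun v => alpha j (y + s *: v) * eta 1 (s^-1 *: (phi (y + s *: v) - p))) =
  fun v => s ^+ m * (fun x => alpha j x * eta s (phi x - p)) (y + s *: v).
  apply/funext => v; rewrite (congr1 (@^~ v) E) mulrA -exprMn divff ?gt_eqF //.
  by rewrite expr1n mul1r.
apply: ctsM; first exact: ctsC.
apply: (@cts_comp _ _ _ (fun v => y + s *: v) (fun x => alpha j x * eta s (phi x - p))) => //.
exact: cts_affine.
Qed.

Lemma alpha_bounded : exists2 A, 0 <= A & forall j x, `|alpha j x| <= A.
Proof.
have H j : \forall A \near (pinfty_nbhs R), forall x, `|alpha j x| <= A.
  have [A A0 KA] := compact_bounded_fun cK (C1_cts (calpha j)).
  near=> B => x; have [Kx|nK] := pselect (K x).
    by apply: (le_trans (KA x Kx)); near: B; apply: nbhs_pinfty_ge; exact: num_real.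
  by rewrite alpha0 // normr0; near: B; apply: nbhs_pinfty_ge; exact: num_real.
have H' := @filter_forall _ _ (fun j A => forall x, `|alpha j x| <= A) _ _ H.
near (pinfty_nbhs R) => A; exists A; last by near: A; exact: H'.
by near: A; apply: nbhs_pinfty_ge; exact: num_real.
Unshelve. all: by end_near. Qed.

Lemma moll_bound : exists2 C, 0 <= C & forall s j p, 0 < s -> `|moll phi M alpha s j p| <= C.
Proof.
have [d d0 dH] := lower_lipschitz; have [A A0 HA] := alpha_bounded.
(* If [phi x] and [phi y] are both within [s] of [p], then [|x - y| < 2 s / d]; in the rescaled
   variable this window does not depend on [s]. *)
pose L := 2 / d; have L0 : 0 <= L by rewrite divr_ge0 // ltW.
pose E := (mass R)^-1 ^+ m.
have E0 : 0 <= E by rewrite exprn_ge0 // invr_ge0 ltW // mass_gt0.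
exists ((L + L) ^+ m * (A * E)).
  by rewrite mulr_ge0 ?exprn_ge0 ?addr_ge0 // mulr_ge0.
move=> s j p s0.
have [[y [Ky yp]]|far] := pselect (exists y, K y /\ `|phi y - p| < s); last first.
  rewrite (@moll_eq0 _ _ phi K M alpha M0 alpha0 s j p s0) ?normr0.
    by rewrite mulr_ge0 ?exprn_ge0 ?addr_ge0 // mulr_ge0.
  move=> x Kx; rewrite leNgt; apply/negP => xs; apply: far; by exists x.
have vL : vanish L (fun v => alpha j (y + s *: v) * eta 1 (s^-1 *: (phi (y + s *: v) - p))).
  move=> v Lv; have [Kv|/alpha0 ->] := pselect (K (y + s *: v)); last by rewrite mul0r.
  rewrite eta_eq0 ?mulr0 // normrZ gtr0_norm ?invr_gt0 // mulrC ler_pdivlMr // mul1r.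
  have := dH _ _ Kv Ky; rewrite addrC addKr normrZ gtr0_norm // => h.
  have h2 : s + s <= d * (s * `|v|).
    have -> : s + s = d * (s * L) by rewrite /L; field; rewrite gt_eqF.
    by rewrite !ler_pM2l.
  have : `|phi (y + s *: v) - phi y| <= `|phi (y + s *: v) - p| + `|phi y - p|.
    by rewrite [`|phi y - p|]distrC ler_distD.
  lra.
rewrite (moll_rescale s0 L0 vL); apply: IT_bound => //.
- apply: ctsM.
    apply: (@cts_comp _ _ _ (fun v => y + s *: v) (alpha j)); first exact: cts_affine.
    exact (C1_cts (calpha j)).
  have -> : (fun v => eta 1 (s^-1 *: (phi (y + s *: v) - p))) =
            fun v => eta 1 (0 + s^-1 *: (phi (y + s *: v) - p)).
    by apply/funext => v; rewrite add0r.
  apply: (@cts_comp _ _ _ (fun v => phi (y + s *: v) - p) (fun q => eta 1 (0 + s^-1 *: q))).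
    apply: (@cts_comp _ _ _ (fun v => phi (y + s *: v)) (fun x => x + - p)).
      by apply: (@cts_comp _ _ _ (fun v => y + s *: v) phi); [exact: cts_affine|exact: phi_cts].
    exact: cts_addv.
  apply: (@cts_comp _ _ _ (fun q => 0 + s^-1 *: q)); first exact: cts_affine.
  exact: cts_eta.
- by rewrite mulr_ge0.
- by move=> v _; rewrite normrM ler_pM // eta1_le.
Qed.

Lemma jac_cts a : continuous (fun z : V * V => (z.2 *m jac phi z.1) 0 a).
Proof.
have -> : (fun z : V * V => (z.2 *m jac phi z.1) 0 a) =
   fun z => \sum_i z.2 0 i * D i (ph a) z.1.
  by apply/funext => z; rewrite mxE; apply: eq_bigr => i _; rewrite mxE.
apply: cts_sum => i _; apply: ctsM.
  by apply: (@cts_comp _ _ _ snd (fun x : V => x 0 i)); [move=> z; exact: cvg_snd|exact: cts_coord].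
by apply: (@cts_comp _ _ _ fst (D i (ph a))); [move=> z; exact: cvg_fst|exact (@C1_D _ _ _ i (cphi a))].
Qed.

(** Convergence is joint in base point, direction and scale, as needed for uniformity over the
    compact product of [K] with a box. *)
Lemma difference_quotient_cvg x0 v0 :
  (fun w : (V * V) * R => w.2^-1 *: (phi (w.1.1 + w.2 *: w.1.2) - phi w.1.1))
    @ filter_prod (nbhs (x0, v0)) ((0 : R)^'+) --> v0 *m jac phi x0.
Proof.
set F2 := filter_prod _ _.
have FF : Filter F2 by exact: filter_prod_filter.
have w0 : (fun w : (V * V) * R => w.1) @ F2 --> (x0, v0) by exact: cvg_fst.
have w1 : (fun w : (V * V) * R => w.1.1) @ F2 --> x0.
  by apply: (@continuous_cvg _ _ _ _ _ _ (@fst V V) (x0, v0) _ w0); exact: cvg_fst.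
have w2 : (fun w : (V * V) * R => w.1.2) @ F2 --> v0.
  by apply: (@continuous_cvg _ _ _ _ _ _ (@snd V V) (x0, v0) _ w0); exact: cvg_snd.
have w3 : (fun w : (V * V) * R => w.2) @ F2 --> (0 : R).
  apply: (@cvg_trans _ ((0 : R)^'+)); first exact: cvg_snd.
  exact: cvg_within.
have w4 : (fun w : (V * V) * R => w.1.1 + w.2 *: w.1.2) @ F2 --> x0.
  rewrite -[X in _ --> X]addr0 -(scale0r v0).
  by apply: cvgD => //; apply: cvgZ.
apply/cvgrPdist_le => e e0.
pose e1 := e / 2 / (`|v0| + 1).
have v1 : 0 < `|v0| + 1 by rewrite ltr_wpDl.
have e10 : 0 < e1 by rewrite !divr_gt0.
have e20 : 0 < e / 2 by rewrite divr_gt0.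
have [r r0 rH] := phi_local x0 e10.
have n1 : \forall w \near F2, `|x0 - w.1.1| < r.
  exact: ((cvgrPdist_lt _ _).1 w1 _ r0).
have n2 : \forall w \near F2, `|x0 - (w.1.1 + w.2 *: w.1.2)| < r.
  exact: ((cvgrPdist_lt _ _).1 w4 _ r0).
have n3 : \forall w \near F2, `|w.1.2| < `|v0| + 1.
  by apply: (cvgr_lt `|v0|); [exact: cvg_norm|rewrite ltrDl].
have n4 : \forall w \near F2, 0 < w.2.
  have cc : (fun w : (V * V) * R => w.2) @ F2 --> (0 : R)^'+ by exact: cvg_snd.
  exact: (cc _ (nbhs_right_gt 0)).
have n5 : \forall w \near F2, `|v0 *m jac phi x0 - w.1.2 *m jac phi x0| <= e / 2.
  have cc : (fun w : (V * V) * R => w.1.2 *m jac phi x0) @ F2 --> v0 *m jac phi x0.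
    by apply: (@continuous_cvg _ _ _ _ _ _ (fun v : V => v *m jac phi x0) v0 _ w2); exact: cts_mulmx.
  exact: ((cvgrPdist_le _ _).1 cc _ e20).
suff key x v (s : R) : `|x0 - x| < r -> `|x0 - (x + s *: v)| < r -> `|v| < `|v0| + 1 ->
    0 < s -> `|v0 *m jac phi x0 - v *m jac phi x0| <= e / 2 ->
    `|v0 *m jac phi x0 - s^-1 *: (phi (x + s *: v) - phi x)| <= e.
  near=> w; apply: key; near: w; [exact: n1|exact: n2|exact: n3|exact: n4|exact: n5].
move=> h1 h2 h3 h4 h5.
have := rH (x + s *: v) x; rewrite !(distrC _ x0) => /(_ h2 h1).
have -> : x + s *: v - x = s *: v by rewrite addrC addKr.
move=> h; have E : s^-1 *: (phi (x + s *: v) - phi x) - v *m jac phi x0 =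
   s^-1 *: (phi (x + s *: v) - phi x - (s *: v) *m jac phi x0).
  by rewrite [RHS]scalerBr -scalemxAl scalerA mulVf ?gt_eqF // scale1r.
have h6 : `|s^-1 *: (phi (x + s *: v) - phi x) - v *m jac phi x0| <= e / 2.
  rewrite E normrZ gtr0_norm ?invr_gt0 // mulrC ler_pdivrMr //.
  apply: (le_trans h); rewrite normrZ gtr0_norm //.
  have -> : e1 * (s * `|v|) = (e1 * `|v|) * s by ring.
  rewrite ler_wpM2r ?(ltW h4) // /e1 mulrAC ler_pdivrMr //.
  by apply: ler_wpM2l; exact: ltW.
rewrite (splitr e) -(subrKA (v *m jac phi x0)); apply: (le_trans (ler_normD _ _)).
by rewrite lerD // distrC.
Unshelve. all: by end_near. Qed.

Hypothesis detK : forall x, K x -> `|\det (jac phi x)| = 1.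

(** The rescaled integrand tends uniformly to [alpha j x * eta 1 (v *m jac phi x)]. Its integral in
    [v] is [alpha j x], because the linear map preserves volume. *)
Lemma moll_cvg (e : R) : 0 < e -> exists2 s0, 0 < s0 &
  forall s j x, 0 < s -> s < s0 -> K x ->
    `|moll phi M alpha s j (phi x) - alpha j x| <= e.
Proof.
move=> e0; have [d d0 dH] := lower_lipschitz.
(* The summand [1/d] confines the rescaled integrand to the cube, [1/c] its limit, and 1 the support
   of [eta 1]. *)
pose L := d^-1 + c^-1 + 1.
have di : 0 < d^-1 by rewrite invr_gt0.
have ci : 0 < c^-1 by rewrite invr_gt0.
have L0 : 0 <= L by rewrite /L; lra.
have L1 : 1 <= L by rewrite /L; lra.
pose N := (L + L) ^+ m + 1.
have N0 : 0 < N by rewrite ltr_wpDl // exprn_ge0 // addr_ge0.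
have e1 : 0 < e / N by rewrite divr_gt0.
pose f1 j (s : R) (z : V * V) :=
  alpha j (z.1 + s *: z.2) * eta 1 (s^-1 *: (phi (z.1 + s *: z.2) - phi z.1)).
pose f2 j (z : V * V) := alpha j z.1 * eta 1 (z.2 *m jac phi z.1).
have cf2 j : continuous (f2 j).
  apply: ctsM.
    by apply: (@cts_comp _ _ _ fst (alpha j)); [move=> z; exact: cvg_fst|exact (C1_cts (calpha j))].
  apply: (@cts_comp _ _ _ (fun z : V * V => z.2 *m jac phi z.1)); last exact: cts_eta.
  by apply: cts_rV => a; exact: jac_cts.
have l3 j (x0 v0 : V) : (fun w : (V * V) * R => `|f1 j w.2 w.1 - f2 j w.1|)
    @ filter_prod (nbhs (x0, v0)) ((0 : R)^'+) --> (0 : R).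
  set F2 := filter_prod _ _.
  have FF : Filter F2 by exact: filter_prod_filter.
  have w0 : (fun w : (V * V) * R => w.1) @ F2 --> (x0, v0) by exact: cvg_fst.
  have w4 : (fun w : (V * V) * R => w.1.1 + w.2 *: w.1.2) @ F2 --> x0.
    rewrite -[X in _ --> X]addr0 -(scale0r v0); apply: cvgD.
      by apply: (@continuous_cvg _ _ _ _ _ _ (@fst V V) (x0, v0) _ w0); exact: cvg_fst.
    apply: cvgZ.
      apply: (@cvg_trans _ ((0 : R)^'+)); first exact: cvg_snd.
      exact: cvg_within.
    by apply: (@continuous_cvg _ _ _ _ _ _ (@snd V V) (x0, v0) _ w0); exact: cvg_snd.
  have l1 : (fun w : (V * V) * R => f1 j w.2 w.1) @ F2 --> f2 j (x0, v0).
    apply: cvgM.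
      by apply: (@continuous_cvg _ _ _ _ _ _ (alpha j) x0 _ w4); exact: (C1_cts (calpha j)).
    have dq := @difference_quotient_cvg x0 v0.
    by apply: (@continuous_cvg _ _ _ _ _ _ (eta 1 : V -> R) (v0 *m jac phi x0) _ dq); exact: cts_eta.
  have l2 : (fun w : (V * V) * R => f2 j w.1) @ F2 --> f2 j (x0, v0).
    by apply: (@continuous_cvg _ _ _ _ _ _ (f2 j) (x0, v0) _ w0); exact: cf2.
  by rewrite -(normr0 R) -(subrr (f2 j (x0, v0))); apply: cvg_norm; apply: cvgB.
have cKB : compact (K `*` (box L : set V)) by apply: compact_setX => //; exact: box_compact.
have H j : \forall s \near (0 : R)^'+, K `*` (box L : set V) `<=` (fun z => `|f1 j s z - f2 j z| <= e / N).
  apply: ((compact_near_coveringP _).1 cKB _ _ (fun s z => `|f1 j s z - f2 j z| <= e / N)) => -[x0 v0] _.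
  have FF : Filter (filter_prod (nbhs (x0 : V, v0 : V)) ((0 : R)^'+)) by exact: filter_prod_filter.
  have := cvgr_le _ (l3 j x0 v0) _ e1.
  move=> [[U W] /= [nU nW] UW]; exists (U, W); first by split.
  by move=> [z s] zs; exact: (UW (z, s) zs).
have H' := @filter_forall _ _ (fun j s => K `*` (box L : set V) `<=` (fun z => `|f1 j s z - f2 j z| <= e / N))
  _ _ H.
have [s0 /= s00 sH] := H'.
exists s0 => // s j x sp ss Kx.
have sB : forall z, (K `*` (box L : set V)) z -> `|f1 j s z - f2 j z| <= e / N.
  by apply: (sH s) => //; rewrite /ball /= sub0r normrN gtr0_norm.
have v1 : vanish L (fun v => f1 j s (x, v)).
  move=> v Lv; rewrite /f1 /=.
  have [Kv|/alpha0 ->] := pselect (K (x + s *: v)); last by rewrite mul0r.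
  rewrite eta_eq0 ?mulr0 // normrZ gtr0_norm ?invr_gt0 // mulrC ler_pdivlMr // mul1r.
  have := dH _ _ Kv Kx; rewrite addrC addKr normrZ gtr0_norm //; apply: le_trans.
  rewrite mulrCA -{1}[s]mulr1 ler_pM2l // mulrC -ler_pdivrMr // mul1r.
  by move: Lv; rewrite /L; lra.
have mE : moll phi M alpha s j (phi x) = IT L (fun v => f1 j s (x, v)).
  exact (@moll_rescale s L j (phi x) x sp L0 v1).
rewrite mE.
have vA : vanish L (fun v => eta 1 (v *m jac phi x)).
  move=> v Lv; rewrite eta_eq0 //; apply: le_trans (low v Kx).
  by rewrite mulrC -ler_pdivrMr // mul1r; move: Lv; rewrite /L; lra.
have ve : vanish L (eta 1 : V -> R).
  by move=> v Lv; rewrite eta_eq0 //; exact: le_trans Lv.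
have -> : alpha j x = IT L (fun v => f2 j (x, v)).
  rewrite /f2 /= ITZ // ?(IT_mulmx (detK Kx) L0) ?IT_eta1 ?mulr1 //; first exact: cts_eta.
  by apply: (@cts_comp _ _ _ (fun v => v *m jac phi x)); [exact: cts_mulmx|exact: cts_eta].
have cA : continuous (fun v => f1 j s (x, v)).
  apply: ctsM.
    apply: (@cts_comp _ _ _ (fun v => x + s *: v) (alpha j)); first exact: cts_affine.
    exact (C1_cts (calpha j)).
  have -> : (fun v => eta 1 (s^-1 *: (phi (x + s *: v) - phi x))) =
            fun v => eta 1 (0 + s^-1 *: (phi (x + s *: v) - phi x)).
    by apply/funext => v; rewrite add0r.
  apply: (@cts_comp _ _ _ (fun v => phi (x + s *: v) - phi x) (fun q => eta 1 (0 + s^-1 *: q))).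
    apply: (@cts_comp _ _ _ (fun v => phi (x + s *: v)) (fun q => q + - phi x)).
      by apply: (@cts_comp _ _ _ (fun v => x + s *: v) phi); [exact: cts_affine|exact: phi_cts].
    exact: cts_addv.
  apply: (@cts_comp _ _ _ (fun q => 0 + s^-1 *: q)); first exact: cts_affine.
  exact: cts_eta.
have cB : continuous (fun v => f2 j (x, v)).
  apply: (@cts_comp _ _ _ (fun v => (x, v)) (f2 j)) => //.
  apply: (@cts_pair V V V (fun=> x) (fun v => v)); last exact: cts_id.
  by apply: cts_rV => i; exact: ctsC.
rewrite -(ITB L0 cA cB); apply: (@le_trans _ _ ((L + L) ^+ m * (e / N))).
  apply: IT_bound => //; [exact: ctsB|exact: ltW|].
  by move=> v Lv; apply: sB.
rewrite mulrCA -{2}[e]mulr1 ler_pM2l // ler_pdivrMr // mul1r /N.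
by rewrite lerDl.
Qed.

End Estimates.

(** * Radial cutoffs *)

Section Radial.
Variables (R : realType) (m : nat).
Local Notation V := 'rV[R]_m.
Implicit Types (x y v : V) (i j k : 'I_m).

Definition sq x : R := \sum_i x 0 i ^+ 2.

Lemma sq_ge0 x : 0 <= sq x.
Proof. by apply: sumr_ge0 => i _; rewrite sqr_ge0. Qed.

Lemma coord_sq x i : x 0 i ^+ 2 <= sq x.
Proof. by rewrite /sq (bigD1 i) //= lerDl sumr_ge0 // => j _; rewrite sqr_ge0. Qed.

Lemma norm_sq x : `|x| ^+ 2 <= sq x.
Proof.
rewrite -[leRHS]sqr_sqrtr ?sq_ge0 // ler_pXn2r ?nnegrE ?sqrtr_ge0 //.
rewrite norm_rV_le ?sqrtr_ge0 //; apply/forallP => i.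
by rewrite -sqrtr_sqr ler_sqrt ?coord_sq // sq_ge0.
Qed.

Lemma norm_sq_le x (r : R) : 0 <= r -> sq x <= r ^+ 2 -> `|x| <= r.
Proof.
move=> r0 h; rewrite -(ler_pXn2r (_ : 0 < 2)%N) ?nnegrE //.
exact: le_trans (norm_sq x) h.
Qed.

Lemma sqZ (t : R) x : sq (t *: x) = t ^+ 2 * sq x.
Proof. by rewrite /sq mulr_sumr; apply: eq_bigr => i _; rewrite mxE exprMn. Qed.

Lemma C2_sq : C2 sq.
Proof. by apply: C2_sum => i; apply: C2_mul; exact: C2_coord. Qed.

Lemma D_sq i : D i sq = fun x => 2 * x 0 i.
Proof.
have c1 k : C1 (fun x : V => x 0 k ^+ 2) by apply: C1_mul; exact: C1_coord.
apply/funext => x; rewrite (proj2 (C1_sum _ c1) i) (bigD1 i) //= big1 ?addr0.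
  rewrite (D_mul (f := fun x : V => x 0 i) (g := fun x : V => x 0 i));
    [|exact: C1_coord|exact: C1_coord].
  by rewrite D_coord eqxx mul1r mulr1 -mulr2n mulr_natl.
move=> k ki; rewrite (D_mul (f := fun x : V => x 0 k) (g := fun x : V => x 0 k));
  [|exact: C1_coord|exact: C1_coord].
by rewrite D_coord eq_sym (negbTE ki) mul0r mulr0 addr0.
Qed.

Lemma sq_cts : continuous sq.
Proof. by apply: C1_cts; case: C2_sq. Qed.

(* The affine argument of [step] is normalised so that [cutoff q b] is 1 on the
   ball of radius [q b] and 0 off the ball of radius [b]. *)
Definition slope (q b : R) : R := (b ^+ 2 * (1 - q ^+ 2))^-1.
Definition offset (q : R) : R := - (q ^+ 2 / (1 - q ^+ 2)).
Definition cutoff (q b : R) x : R := 1 - step (slope q b * sq x + offset q).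
Definition cutoff_w (q b : R) x : R :=
  - (2 * slope q b) * dstep (slope q b * sq x + offset q).

Variables (q b : R).
Hypotheses (q0 : 0 < q) (q1 : q < 1) (b0 : 0 < b).

Let q21 : 0 < 1 - q ^+ 2.
Proof. by rewrite subr_gt0 exprn_ilt1 // ltW. Qed.

Let arg_le0 x : sq x <= (q * b) ^+ 2 -> slope q b * sq x + offset q <= 0.
Proof.
move=> h; have d0 : 0 < b ^+ 2 * (1 - q ^+ 2) by rewrite mulr_gt0 ?exprn_gt0.
rewrite /slope /offset subr_le0 mulrC ler_pdivrMr //.
have -> // : q ^+ 2 / (1 - q ^+ 2) * (b ^+ 2 * (1 - q ^+ 2)) = (q * b) ^+ 2.
by field; rewrite gt_eqF.
Qed.

Let arg_ge1 x : b ^+ 2 <= sq x -> 1 <= slope q b * sq x + offset q.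
Proof.
move=> h; have d0 : 0 < b ^+ 2 * (1 - q ^+ 2) by rewrite mulr_gt0 ?exprn_gt0.
rewrite /slope /offset lerBrDr.
have -> : 1 + q ^+ 2 / (1 - q ^+ 2) = (b ^+ 2 * (1 - q ^+ 2))^-1 * b ^+ 2.
  by field; rewrite !gt_eqF.
by rewrite ler_wpM2l // invr_ge0 ltW.
Qed.

Lemma cutoff_eq1 x : sq x <= (q * b) ^+ 2 -> cutoff q b x = 1.
Proof. by move=> /arg_le0 h; rewrite /cutoff step_eq0 ?subr0. Qed.

Lemma cutoff_eq0 x : b ^+ 2 <= sq x -> cutoff q b x = 0.
Proof. by move=> /arg_ge1 h; rewrite /cutoff step_eq1 ?subrr. Qed.

Lemma cutoff_w_eq0 x : sq x <= (q * b) ^+ 2 \/ b ^+ 2 <= sq x -> cutoff_w q b x = 0.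
Proof.
by move=> h; rewrite /cutoff_w dstep_eq0 ?mulr0 //; case: h => [/arg_le0|/arg_ge1]; [left|right].
Qed.

Lemma cutoff_ge0 x : 0 <= cutoff q b x.
Proof. by rewrite subr_ge0 step_le1. Qed.

Lemma cutoff_le1 x : cutoff q b x <= 1.
Proof. by rewrite lerBlDl lerDr step_ge0. Qed.

Lemma C2_cutoff : C2 (cutoff q b).
Proof.
apply: C2_add; first exact: C2_cst.
apply: C2_opp; apply: (@C2_comp _ _ _ _ _ sq
  (deriv_of_affine (slope q b) (offset q) (@step_deriv R))
  (deriv_of_scale (slope q b) (deriv_of_affine (slope q b) (offset q) (@dstep_deriv R)))).
  apply: ctsM; first exact: ctsC.
  apply: ctsM; first exact: ctsC.
  apply: (@cts_comp _ _ _ (fun t => slope q b * t + offset q)); last exact: cts_ddstep.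
  by apply: ctsD; [apply: ctsM; [exact: ctsC|exact: cts_id]|exact: ctsC].
exact: C2_sq.
Qed.

Let C1arg : C1 (fun x => dstep (slope q b * sq x + offset q)).
Proof.
apply: (@C1_comp _ _ _ _ sq (deriv_of_affine (slope q b) (offset q) (@dstep_deriv R))).
  apply: ctsM; first exact: ctsC.
  apply: (@cts_comp _ _ _ (fun t => slope q b * t + offset q)); last exact: cts_ddstep.
  by apply: ctsD; [apply: ctsM; [exact: ctsC|exact: cts_id]|exact: ctsC].
by case: C2_sq.
Qed.

Lemma D_cutoff i x : D i (cutoff q b) x = cutoff_w q b x * x 0 i.
Proof.
have c1 : C1 sq by case: C2_sq.
have cs : C1 (fun x => step (slope q b * sq x + offset q)).
  apply: (@C1_comp _ _ _ _ sq (deriv_of_affine (slope q b) (offset q) (@step_deriv R))) => //.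
  apply: ctsM; first exact: ctsC.
  apply: (@cts_comp _ _ _ (fun t => slope q b * t + offset q)); last exact: cts_dstep.
  by apply: ctsD; [apply: ctsM; [exact: ctsC|exact: cts_id]|exact: ctsC].
rewrite (D_add (f := fun=> 1) i (C1_cst _ _) (C1_opp cs)) D_cst add0r (D_opp _ cs).
rewrite (@D_comp _ _ _ _ sq _ (deriv_of_affine (slope q b) (offset q) (@step_deriv R)) c1).
by rewrite D_sq /cutoff_w; ring.
Qed.

Lemma C1_cutoff_w : C1 (cutoff_w q b).
Proof. by apply: C1_mul; [exact: C1_cst|exact: C1arg]. Qed.

Lemma D_cutoff_w i j x : x 0 i * D j (cutoff_w q b) x = x 0 j * D i (cutoff_w q b) x.
Proof.
have c1 : C1 sq by case: C2_sq.
have E k : D k (cutoff_w q b) x = - (2 * slope q b) *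
    (slope q b * ddstep (slope q b * sq x + offset q) * (2 * x 0 k)).
  rewrite (D_mul (f := fun=> - (2 * slope q b)) k (C1_cst _ _) C1arg) D_cst mul0r add0r.
  by rewrite (@D_comp _ _ _ _ sq _ (deriv_of_affine (slope q b) (offset q) (@dstep_deriv R)) c1) D_sq.
by rewrite !E; ring.
Qed.

End Radial.

(** * Oscillation of functions on an annulus *)

Section AnnulusPaths.
Variables (R : realType) (m : nat).
Local Notation V := 'rV[R]_m.
Implicit Types (x y v : V) (i j k : 'I_m).

Definition annulus (r1 r2 : R) : set V := [set x | r1 ^+ 2 <= sq x <= r2 ^+ 2].

Definition dot x y : R := \sum_i x 0 i * y 0 i.

Lemma sq_comb (a c : R) x y : sq (a *: x + c *: y) =
  a ^+ 2 * sq x + 2 * a * c * dot x y + c ^+ 2 * sq y.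
Proof.
rewrite /sq /dot !mulr_sumr -!big_split /=; apply: eq_bigr => i _.
by rewrite !mxE; ring.
Qed.

(** Two linear conditions have a nonzero common solution in dimension at least 3. *)
Lemma orthogonal_vector x y (r : R) : (3 <= m)%N -> 0 <= r ->
  exists z, [/\ sq z = r ^+ 2, dot z x = 0 & dot z y = 0].
Proof.
move=> m3 r0; pose A := (col_mx x y)^T.
have : kermx A != 0.
  rewrite -mxrank_eq0 mxrank_ker -lt0n subn_gt0.
  by apply: leq_ltn_trans (rank_leq_col A) _.
move=> /rowV0Pn[z /sub_kermxP zA z0].
have dE (l : 'I_(1 + 1)) : (z *m A) 0 l = dot z (row l (col_mx x y)).
  by rewrite mxE; apply: eq_bigr => k _; rewrite !mxE.
have dx : dot z x = 0.
  have := dE (lshift 1 0); rewrite zA mxE => ->.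
  by rewrite /dot; apply: eq_bigr => k _; rewrite [in RHS]mxE col_mxEu.
have dy : dot z y = 0.
  have := dE (rshift 1 0); rewrite zA mxE => ->.
  by rewrite /dot; apply: eq_bigr => k _; rewrite [in RHS]mxE col_mxEd.
have s0 : 0 < sq z.
  rewrite lt_neqAle sq_ge0 andbT eq_sym; apply: contraNneq z0 => s0.
  by rewrite -normr_le0; apply: norm_sq_le; rewrite ?s0 // expr0n.
have dZ (t : R) u : dot (t *: z) u = t * dot z u.
  by rewrite /dot mulr_sumr; apply: eq_bigr => k _; rewrite mxE mulrA.
exists ((r / Num.sqrt (sq z)) *: z); split; rewrite ?dZ ?dx ?dy ?mulr0 //.
rewrite sqZ exprMn exprVn sqr_sqrtr ?sq_ge0 // divfK // gt_eqF //.
Qed.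

Variables (r1 r2 e : R) (G : V -> R).
Hypotheses (r10 : 0 < r1) (r12 : r1 <= r2) (m3 : (3 <= m)%N) (cG : C1 G)
  (DG : forall i x, annulus r1 r2 x -> `|D i G x| <= e).

Lemma quarter_turn x y : sq x = r1 ^+ 2 -> sq y = r1 ^+ 2 -> dot x y = 0 ->
  `|G y - G x| <= m%:R * (2 * r1 * e) * (pi / 2).
Proof.
move=> sx sy dxy; pose g (t : R) := cos t *: x + sin t *: y.
have dg i (t : R) : is_derive t 1 (fun t => g t 0 i) (- sin t * x 0 i + cos t * y 0 i).
  have -> : (fun t => g t 0 i) = x 0 i *: (@cos R) + y 0 i *: (@sin R).
    by apply/funext => a; rewrite !mxE mulrC [in RHS]/GRing.add /= /GRing.scale /= [sin a * _]mulrC.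
  have -> : - sin t * x 0 i + cos t * y 0 i = x 0 i *: - sin t + y 0 i *: cos t.
    by rewrite mulrC [cos t * _]mulrC.
  by apply: is_deriveD; apply: is_deriveZ.
have dF (t : R) := @chain_curve _ _ G g _ t ((proj1 cG) (g t)) (fun i => dg i t).
have gK (t : R) : annulus r1 r2 (g t).
  rewrite /annulus /= /g sq_comb sx sy dxy mulr0 addr0 -mulrDl cos2Dsin2 mul1r lexx /=.
  by rewrite ler_pXn2r ?nnegrE // ltW // (lt_le_trans r10).
have p0 : 0 <= pi / 2 :> R by rewrite divr_ge0 ?pi_ge0.
have := increment_le (a := 0) (b := pi / 2) (C := m%:R * (2 * r1 * e)) dF _ p0.
have -> : g (pi / 2) = y by rewrite /g cos_pihalf sin_pihalf scale0r add0r scale1r.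
have -> : g 0 = x by rewrite /g cos0 sin0 scale0r addr0 scale1r.
rewrite subr0; apply=> t _; apply: (le_trans (ler_norm_sum _ _ _)).
have -> : m%:R * (2 * r1 * e) = \sum_(i < m) (2 * r1 * e).
  by rewrite sumr_const card_ord mulr_natl.
apply: ler_sum => i _; rewrite normrM; apply: ler_pM => //; last exact: DG.
have cx u : sq u = r1 ^+ 2 -> `|u 0 i| <= r1.
  by move=> su; apply: le_trans (coord_le u i) _; apply: norm_sq_le; rewrite ?su // ltW.
apply: (le_trans (ler_normD _ _)); rewrite !normrM normrN.
have h1 : `|sin t| <= 1 by rewrite ler_norml sin_geN1 sin_le1.
have h2 : `|cos t| <= 1 by rewrite ler_norml cos_geN1 cos_le1.
have -> : 2 * r1 = 1 * r1 + 1 * r1 by ring.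
by apply: lerD; apply: ler_pM => //; exact: cx.
Qed.

Lemma radial_move x : annulus r1 r2 x -> exists y, sq y = r1 ^+ 2 /\
  `|G y - G x| <= m%:R * (r2 * e).
Proof.
move=> /andP[x1 x2].
have sx : 0 < sq x by apply: lt_le_trans x1; rewrite exprn_gt0.
pose l := r1 / Num.sqrt (sq x).
have s0 : 0 < Num.sqrt (sq x) by rewrite sqrtr_gt0.
have l0 : 0 < l by rewrite divr_gt0.
have ls : l ^+ 2 * sq x = r1 ^+ 2 by rewrite /l exprMn exprVn sqr_sqrtr ?ltW // divfK // gt_eqF.
have l1 : l <= 1.
  have : l ^+ 2 <= 1 by rewrite -(ler_pM2r sx) ls mul1r.
  by rewrite expr_le1 // ltW.
exists (l *: x); split; first by rewrite sqZ.
pose v := (l - 1) *: x.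
have dF (t : R) := is_derive_segment x v t cG.
have := increment_le (a := 0) (b := 1) (C := m%:R * (r2 * e)) dF _ ler01.
rewrite scale1r scale0r addr0 subr0 mulr1.
have -> : x + v = l *: x by rewrite /v scalerBl scale1r subrKC.
apply=> t /andP[t0 t1]; apply: (le_trans (ler_norm_sum _ _ _)).
have -> : m%:R * (r2 * e) = \sum_(i < m) (r2 * e).
  by rewrite sumr_const card_ord mulr_natl.
have tE : x + t *: v = (1 - t * (1 - l)) *: x.
  by rewrite /v scalerA -[X in X + _]scale1r -scalerDl; congr (_ *: _); ring.
have k1 : l <= 1 - t * (1 - l) by nra.
have k2 : 1 - t * (1 - l) <= 1 by nra.
have tK : annulus r1 r2 (x + t *: v).
  rewrite tE /annulus /= sqZ; apply/andP; split.
    by rewrite -ls ler_wpM2r ?(ltW sx) // ler_pXn2r ?nnegrE // ltW // (lt_le_trans l0).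
  apply: le_trans x2; rewrite -[leRHS]mul1r ler_wpM2r ?(ltW sx) // exprn_ile1 //.
  by apply: ltW; exact: lt_le_trans k1.
apply: ler_sum => i _; rewrite normrM; apply: ler_pM => //; last exact: DG.
rewrite mxE normrM; have x_i : `|x 0 i| <= r2.
  by apply: le_trans (coord_le x i) _; apply: norm_sq_le => //; rewrite ltW // (lt_le_trans r10).
rewrite -[leRHS]mul1r ler_pM // distrC ger0_norm ?subr_ge0 //; lra.
Qed.

Definition path_const : R := 2 * (m%:R * r2) + 2 * (m%:R * (2 * r1) * (pi / 2)).

(** The two points are joined inside the annulus by a path of bounded length: each moves radially to
    the inner sphere, and from there a quarter turn leads to a common vector orthogonal to both. *)
Lemma annulus_oscillation x y : annulus r1 r2 x -> annulus r1 r2 y ->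
  `|G y - G x| <= path_const * e.
Proof.
move=> /radial_move[x' [sx hx]] /radial_move[y' [sy hy]].
have [z [sz zx zy]] := orthogonal_vector x' y' m3 (ltW r10).
have h1 := quarter_turn sz sx zx; have h2 := quarter_turn sz sy zy.
have -> : G y - G x = (G y - G y') + (G y' - G z) + (G z - G x') + (G x' - G x) by ring.
apply: (le_trans (ler_normD _ _)).
apply: (le_trans (lerD (le_trans (ler_normD _ _) (lerD (ler_normD _ _) (lexx _))) (lexx _))).
rewrite [`|G y - _|]distrC [`|G z - _|]distrC /path_const.
apply: (le_trans (lerD (lerD (lerD hy h2) h1) hx)).
by rewrite le_eqVlt; apply/orP; left; apply/eqP; ring.
Qed.

End AnnulusPaths.

(** * Increments along segments *)

Section SegmentMoves.
Variables (R : realType) (m : nat).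
Local Notation V := 'rV[R]_m.
Implicit Types (x p v : V) (i j : 'I_m).

Lemma segment_increment (h : V -> R) x v (a b C : R) : C1 h -> a <= b ->
  (forall t, a <= t <= b -> forall i, `|D i h (x + t *: v)| <= C) ->
  `|h (x + b *: v) - h (x + a *: v)| <= m%:R * (`|v| * C) * (b - a).
Proof.
move=> ch ab hC; have dF (t : R) := is_derive_segment x v t ch.
apply: (increment_le dF) => // t tab; apply: (le_trans (ler_norm_sum _ _ _)).
have -> : m%:R * (`|v| * C) = \sum_(i < m) (`|v| * C).
  by rewrite sumr_const card_ord mulr_natl.
apply: ler_sum => i _; rewrite normrM; apply: ler_pM => //; [exact: coord_le|exact: hC].
Qed.

Lemma segment_const (h : V -> R) x v : C1 h ->
  (forall t, 0 <= t <= 1 -> forall i, D i h (x + t *: v) = 0) -> h (x + v) = h x.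
Proof.
move=> ch h0; have H : `|h (x + 1 *: v) - h (x + 0 *: v)| <= m%:R * (`|v| * 0) * (1 - 0).
  apply: segment_increment => // t /h0 ht i.
  by rewrite ht normr0.
move: H; rewrite scale1r scale0r addr0 !mulr0 mul0r normr_le0 subr_eq0.
by move=> /eqP.
Qed.

(** A direction other than [i0] is taken because only there the slab has a factor of bounded
    support; [Theta s] equals 1 on a whole half-line. *)
Lemma pot_far (phi : V -> V) (Om : set V) (M : R) (alpha : 'I_m -> V -> R) i0 j (s : R) p :
  0 <= M -> (forall i x, ~ Om x -> alpha i x = 0) -> 0 < s -> j != i0 ->
  (forall x, Om x -> s <= `|phi x 0 j - p 0 j|) -> pot phi M alpha i0 s p = 0.
Proof.
move=> M0 a0 s0 ji far; rewrite -(IT0 m M0); congr IT; apply/funext => x.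
have [Ox|/a0 ->] := pselect (Om x); last by rewrite mul0r.
rewrite /slab (bigD1 j) //= theta_eq0 ?mul0r ?mulr0 // !mxE.
have := far x Ox; have [u0|u0] := leP (phi x 0 j - p 0 j) 0; first by left.
by rewrite gtr0_norm //; right.
Qed.

End SegmentMoves.

(** * Compactness of closed annuli *)

Section Annulus.
Variables (R : realType) (m : nat).
Local Notation V := 'rV[R]_m.

Lemma open_sq (r : R) : open [set x : V | sq x < r] /\ open [set x : V | r < sq x].
Proof.
have cs := @sq_cts R m; split.
  apply: (@open_comp _ _ (@sq R m) [set t | t < r]); last exact: open_lt.
  by move=> x _; exact: cs.
apply: (@open_comp _ _ (@sq R m) [set t | r < t]); last exact: open_gt.
by move=> x _; exact: cs.
Qed.

Lemma annulus_compact (r1 r2 : R) : 0 <= r2 -> compact (annulus r1 r2 : set V).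
Proof.
move=> r20; apply: bounded_closed_compact.
  exists r2; split; first exact: num_real.
  move=> u ru x /andP[_ x2]; exact: le_trans (norm_sq_le r20 x2) (ltW ru).
have -> : (annulus r1 r2 : set V) = (~` [set x | sq x < r1 ^+ 2]) `&` (~` [set x | r2 ^+ 2 < sq x]).
  apply/seteqP; split=> x /=.
    by rewrite /annulus /= => /andP[h1 h2]; split; apply/negP; rewrite -leNgt.
  by move=> [/negP h1 /negP h2]; rewrite /annulus /= !leNgt h1.
by apply: closedI; apply: open_closedC; [exact (proj1 (open_sq _))|exact (proj2 (open_sq _))].
Qed.

End Annulus.

(** * Potentials close to a transported cutoff *)

Section Potential.
Variables (R : realType) (m : nat) (J : 'M[R]_m).
Hypotheses (JT : J^T = - J) (JJ : J *m J = - 1%:M) (m3 : (3 <= m)%N).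
Local Notation V := 'rV[R]_m.
Implicit Types (x y p q v : V) (i j k : 'I_m).
Variables (phi : V -> V) (r1 r2 a : R).
Local Notation K := (annulus r1 r2 : set V).
Hypotheses (r10 : 0 < r1) (r12 : r1 <= r2)
  (cphi : forall i, C2 (fun x => phi x 0 i))
  (symp : forall x i j, K x ->
    pb J (fun x => phi x 0 i) (fun x => phi x 0 j) x = J i j)
  (inj : forall x y, K x -> K y -> phi x = phi y -> x = y)
  (img : forall x, K x -> a ^+ 2 < sq (phi x) < 1).

Let M := r2 + 1.
Let r20 : 0 < r2. Proof. exact: lt_le_trans r12. Qed.
Let M0 : 0 <= M. Proof. by rewrite /M; have := r20; lra. Qed.
Let cK : compact K. Proof. by apply: annulus_compact; exact: ltW. Qed.
Let c1 i : C1 (fun x => phi x 0 i) := C2_C1 (cphi i).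

Let KM x : K x -> `|x| < M.
Proof.
move=> /andP[_ h]; apply: (le_lt_trans (norm_sq_le (ltW r20) h)).
by rewrite /M ltrDl.
Qed.

(** The symplectic relation gives the inverse of the Jacobian as [- J jac^T J], which is continuous
    on the whole space and hence bounded on [K]. *)
Lemma jac_lower_bound : exists2 c : R, 0 < c &
  forall x v, K x -> c * `|v| <= `|v *m jac phi x|.
Proof.
pose I x := - (J *m (jac phi x)^T *m J).
pose B x := \sum_i \sum_j `|I x i j|.
have cB : continuous B.
  apply: cts_sum => i _; apply: cts_sum => j _; apply: cts_norm.
  have -> : (fun x => I x i j) = fun x => - (\sum_l (\sum_k J i k * D l (fun x => phi x 0 k) x) * J l j).
    apply/funext => x; rewrite /I mxE [in LHS]mxE; congr (- _); apply: eq_bigr => l _.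
    by congr (_ * _); rewrite mxE; apply: eq_bigr => k _; rewrite !mxE.
  apply: ctsN; apply: cts_sum => l _; apply: ctsM; last exact: ctsC.
  by apply: cts_sum => k _; apply: ctsM; [exact: ctsC|exact (@C1_D _ _ _ l (c1 k))].
have [A A0 KA] := compact_bounded_fun cK cB.
have A1 : 0 < A + 1 by rewrite ltr_wpDl.
exists (A + 1)^-1; first by rewrite invr_gt0.
move=> x v Kx; rewrite mulrC ler_pdivrMr //.
have e := jac_inv JJ symp Kx.
have -> : `|v| = `|v *m jac phi x *m I x| by rewrite -mulmxA e mulmx1.
apply: (le_trans (mulmx_norm _ _)); rewrite ler_wpM2l //.
have := KA x Kx; rewrite ger0_norm ?sumr_ge0 //.
  by rewrite /B; lra.
by move=> i _; rewrite sumr_ge0.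
Qed.

(* [X] replaces an inverse of [phi]. It depends neither on a cutoff nor on an
   error bound, so that the potentials of several cutoffs can be compared. *)
Lemma nearest_ex : exists X : V -> V,
  forall p, K (X p) /\ forall x, K x -> `|phi (X p) - p| <= `|phi x - p|.
Proof.
have cphi' : continuous phi by apply: cts_rV => i; exact (C1_cts (c1 i)).
have K0 : exists x, K x.
  have [z [sz _ _]] := @orthogonal_vector R m 0 0 r1 m3 (ltW r10).
  by exists z; rewrite /annulus /= sz lexx /= ler_pXn2r ?nnegrE // ltW.
suff H p : exists y, K y /\ forall x, K x -> `|phi y - p| <= `|phi x - p|.
  by have [X XP] := choice H; exists X.
have cd : continuous (fun x => `|phi x - p|).
  apply: (@cts_comp _ _ _ (fun x => phi x - p) (fun z : V => `|z|)); last exact: norm_continuous.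
  by apply: (@cts_comp _ _ _ phi (fun x => x + - p)) => //; exact: cts_addv.
have [|y Ky yP] := compact_EVT_min K0 cK (f := fun x => `|phi x - p|).
  exact: continuous_subspaceT.
exists y; split; first by rewrite inE in Ky.
by move=> x Kx; apply: yP; rewrite inE.
Qed.

(** By compactness the strict bounds in [img] leave a uniform distance, below which mollification
    does not reach the inner ball or the exterior of the unit ball. *)
Lemma image_gap : exists2 g : R, 0 < g &
  forall x p, K x -> 1 <= sq p \/ sq p <= a ^+ 2 -> g <= `|phi x - p|.
Proof.
have cphi' : continuous phi by apply: cts_rV => i; exact (C1_cts (c1 i)).
have H : \forall s \near (0 : R)^'+, K `<=` (fun x => forall p,
    1 <= sq p \/ sq p <= a ^+ 2 -> s <= `|phi x - p|).
  apply: ((compact_near_coveringP _).1 cK R ((0 : R)^'+)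
    (fun s x => forall p, 1 <= sq p \/ sq p <= a ^+ 2 -> s <= `|phi x - p|)) => x0 Kx0.
  have /andP[h1 h2] := img Kx0.
  have n1 : \forall z \near phi x0, sq z < 1.
    exact: (cvgr_lt _ (@sq_cts R m (phi x0)) _ h2).
  have n2 : \forall z \near phi x0, a ^+ 2 < sq z.
    exact: (cvgr_gt _ (@sq_cts R m (phi x0)) _ h1).
  have [r /= r0 rH] := (nbhs_ballP _ _).1 (filterI n1 n2).
  have r2' : 0 < r / 2 by rewrite divr_gt0.
  exists ([set x | `|phi x0 - phi x| < r / 2], [set s | s <= r / 2]).
    split=> /=; last exact: nbhs_right_le.
    exact: (((cvgrPdist_lt _ _).1 (cphi' x0)) _ r2').
  move=> [x s] /= [xr sr] p hp; apply: le_trans sr _; rewrite leNgt; apply/negP => xp.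
  have : ball (phi x0) r p.
    rewrite -ball_normE /= -(subrKA (phi x)); apply: (le_lt_trans (ler_normD _ _)).
    by rewrite (splitr r) ltrD.
  move=> /rH /= [p1 p2]; move: p1 p2; case: hp => hp; rewrite ltNge => p1.
    by move: p1; rewrite hp.
  by rewrite ltNge hp.
have [r /= r0 rH] := H; exists (r / 2); first by rewrite divr_gt0.
move=> x p Kx hp; apply: (rH (r / 2)) => //=; last by rewrite divr_gt0.
by rewrite /ball /= sub0r normrN gtr0_norm ?divr_gt0 // ltr_pdivrMr // mulr_natr mulr2n ltrDl.
Qed.

Variables (q b : R).
Hypotheses (q0 : 0 < q) (q1 : q < 1) (b0 : 0 < b) (rqb : r1 <= q * b) (br : b <= r2).
Let chi := cutoff q b : V -> R.
Let w := cutoff_w q b : V -> R.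
Let Om : set V := [set x | r1 ^+ 2 < sq x] `&` [set x | sq x < r2 ^+ 2].
Let al := alpha J phi chi.

Let OmK x : Om x -> K x.
Proof. by move=> [/ltW h1 /ltW h2]; rewrite /annulus /= h1. Qed.

Let wOm x : ~ Om x -> w x = 0.
Proof.
move=> nO; apply: cutoff_w_eq0 => //.
have [h|h] := leP (sq x) ((q * b) ^+ 2); first by left.
right; rewrite leNgt; apply/negP => h2; apply: nO; split => /=.
  by apply: le_lt_trans h; rewrite ler_pXn2r ?nnegrE // ltW // mulr_gt0.
by apply: (lt_le_trans h2); rewrite ler_pXn2r ?nnegrE // ltW.
Qed.

Let oOm : open Om. Proof. by apply: openI; [exact (proj2 (open_sq m _))|exact (proj1 (open_sq m _))]. Qed.
Let OmM x : Om x -> `|x| < M. Proof. by move=> /OmK /KM. Qed.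
Let sympO x i j : Om x -> pb J (fun x => phi x 0 i) (fun x => phi x 0 j) x = J i j.
Proof. by move=> /OmK Kx; exact: symp. Qed.
Let cchi : C2 chi. Proof. exact: C2_cutoff. Qed.
Let vchi : vanish M chi.
Proof.
move=> x Mx; apply: cutoff_eq0 => //; apply: le_trans (norm_sq x).
rewrite ler_pXn2r ?nnegrE ?(ltW b0) //; apply: le_trans Mx.
by apply: (le_trans br); rewrite /M lerDl.
Qed.
Let cw : C1 w. Proof. exact: C1_cutoff_w. Qed.
Let Dchi i x : D i chi x = w x * x 0 i. Proof. exact: D_cutoff. Qed.
Let rw i j x : x 0 i * D j w x = x 0 j * D i w x. Proof. exact: D_cutoff_w. Qed.
Let cal i : C1 (al i) := C1_alpha J cphi cchi i.
Let al0 i x : ~ Om x -> al i x = 0 := @alpha0 _ _ J phi Om chi w Dchi wOm i x.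
Let alK i x : ~ K x -> al i x = 0.
Proof. by move=> nK; apply: al0 => /OmK. Qed.

(** On the annulus [h \o phi - chi] has small gradient, hence small oscillation. Off the image the
    gradient of [h] is bounded and vanishes at distance [s], so [h p] is close to its value at the
    nearest image point. Only differences are compared, since [h] matches [chi] up to a constant. *)
Lemma potential_close (e : R) : 0 < e -> exists h : V -> R,
  [/\ C1 h, IT 2 h = IT M chi,
      (forall p, 1 <= sq p -> h p = 0),
      (forall p, sq p <= a ^+ 2 -> h p = h 0) &
      forall X, (forall p, K (X p) /\ forall x, K x -> `|phi (X p) - p| <= `|phi x - p|) ->
      forall p p', `|(h p - chi (X p)) - (h p' - chi (X p'))| <= e].
Proof.
move=> e0; have [c c0 low] := jac_lower_bound; have [g g0 gap] := image_gap.
have detK x : K x -> `|\det (jac phi x)| = 1 by exact: (det_jac JJ symp).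
have i0 : 'I_m by exact: (Ordinal (leq_trans (isT : 0 < 3)%N m3)).
have [j0 ji] : exists j, j != i0.
  pose o0 : 'I_m := Ordinal (leq_trans (isT : 0 < 3)%N m3).
  pose o1 : 'I_m := Ordinal (leq_trans (isT : 1 < 3)%N m3).
  have [->|ne] := eqVneq i0 o0; first by exists o1.
  by exists o0; rewrite eq_sym.
have alD := IT_alpha_D JT JJ M0 cphi oOm OmM sympO cchi Dchi wOm.
have alI := IT_alpha JT M0 cphi cchi vchi i0.
have alphi := IT_alpha_phi JT JJ m3 M0 cphi oOm OmM sympO cchi vchi cw Dchi wOm rw i0.
have [C C0 mC] := moll_bound M0 c1 cK inj c0 low cal alK KM.
pose P1 := path_const m r1 r2.
have P10 : 0 <= P1.
  rewrite /P1 /path_const; have := r20; have := r10; have := pi_ge0 R => p3 p1 p2.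
  by rewrite addr_ge0 // mulr_ge0 // !mulr_ge0 // ltW.
pose f x := \sum_i \sum_l `|D i (fun x => phi x 0 l) x|.
have cf : continuous f.
  by apply: cts_sum => i _; apply: cts_sum => l _; apply: cts_norm; exact (@C1_D _ _ _ i (c1 l)).
have [B B0 KB] := compact_bounded_fun cK cf.
(* With gradients below [B * e1] and path constant [P1], the oscillation is at most [e / 2]. *)
pose e1 := e / 2 / (P1 * B + 1).
have PB : 0 < P1 * B + 1 by rewrite ltr_wpDl // mulr_ge0.
have e10 : 0 < e1 by rewrite !divr_gt0.
have [s0 s00 mcv] := moll_cvg M0 c1 cK inj c0 low cal alK KM detK e10.
pose D1 := m%:R * C + 1.
have D10 : 0 < D1 by rewrite ltr_wpDl // mulr_ge0.
(* The four bounds serve, in order: convergence in [moll_cvg]; the gap around the image; keeping the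
   smoothed image in the box of radius 2; and making a move of length [s] change [h] by at most
   [e / 4]. *)
pose s := Num.min (Num.min (s0 / 2) g) (Num.min 1 (e / 4 / D1)).
have sp : 0 < s by rewrite !lt_min !divr_gt0 // g0 ltr01.
have ss0 : s < s0.
  apply: (@le_lt_trans _ _ (s0 / 2)); last by rewrite ltr_pdivrMr // mulr_natr mulr2n ltrDl.
  by rewrite /s !ge_min lexx.
have sg : s <= g by rewrite /s !ge_min lexx orbT.
have s1 : s <= 1 by rewrite /s !ge_min lexx !orbT.
have sD : s <= e / 4 / D1 by rewrite /s !ge_min lexx !orbT.
pose h := pot phi M al i0 s.
have [ch Dh] : C1 h /\ forall j, D j h = moll phi M al s j.
  exact: (pot_C1 i0 M0 c1 cal alD s).
have Dh0 j p : 1 <= sq p \/ sq p <= a ^+ 2 -> D j h p = 0.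
  move=> hp; rewrite Dh; apply: (moll_eq0 M0 alK) => // x Kx.
  by apply: le_trans sg _; exact: gap.
exists h; split=> //.
- rewrite /h (IT_pot (i0 := i0) M0 c1 cal al0 alI sp) ?alphi ?opprK //.
  move=> x /OmK Kx; have /andP[_ h2] := img Kx.
  have : `|phi x| <= 1 by apply: norm_sq_le => //; rewrite expr1n ltW.
  by move: s1; lra.
- move=> p p1.
  (* The point [p] is pushed by 3 along the axis [j0], away from the origin, so it stays outside the
     unit ball and [h] does not change. At the end its coordinate [j0] is at distance at least 2
     from those of the image, and [pot_far] applies. *)
  pose sg0 : R := if 0 <= p 0 j0 then 1 else -1.
  pose T : R := 3.
  have sgp : 0 <= sg0 * p 0 j0.
    rewrite /sg0; case: (leP 0 (p 0 j0)) => h0; first by rewrite mul1r.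
    by rewrite mulN1r oppr_ge0 ltW.
  have sg2 : sg0 ^+ 2 = 1 by rewrite /sg0; case: ifP; rewrite ?sqrrN expr1n.
  pose v : V := (T * sg0) *: delta_mx 0 j0.
  have sqv (t : R) : 0 <= t -> 1 <= sq (p + t *: v).
    move=> t0; have -> : p + t *: v = 1 *: p + (t * T * sg0) *: delta_mx 0 j0.
      by rewrite scale1r /v scalerA mulrA.
    rewrite sq_comb expr1n mul1r mulr1.
    have -> : dot p (delta_mx 0 j0) = p 0 j0.
      rewrite /dot (bigD1 j0) //= big1 ?addr0 ?mxE ?eqxx ?mulr1 //.
      by move=> k kj; rewrite !mxE (negbTE kj) mulr0.
    have -> : sq (delta_mx 0 j0 : V) = 1.
      rewrite /sq (bigD1 j0) //= big1 ?addr0 ?mxE ?eqxx ?expr1n //.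
      by move=> k kj; rewrite !mxE (negbTE kj) expr0n.
    have h1 : 0 <= 2 * (t * T * sg0) * p 0 j0.
      have -> : 2 * (t * T * sg0) * p 0 j0 = (2 * t * T) * (sg0 * p 0 j0) by ring.
      by rewrite mulr_ge0 // !mulr_ge0.
    have h2 := sqr_ge0 (t * T * sg0).
    by move: p1 h1 h2; rewrite mulr1; lra.
  rewrite -(segment_const (x := p) (v := v) ch); last first.
    by move=> t /andP[t0 _] i; apply: Dh0; left; exact: sqv.
  apply: (pot_far (j := j0) M0 al0) => // x /OmK Kx.
  have /andP[_ h2] := img Kx.
  have hx : `|phi x 0 j0| <= 1.
    by apply: le_trans (coord_le _ _) _; apply: norm_sq_le => //; rewrite expr1n ltW.
  rewrite !mxE !eqxx /= mulr1; move: hx sgp s1; rewrite /sg0 /T ler_norml => /andP[u1 u2].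
  case: ifP => _; rewrite ?mul1r ?mulN1r => u3 u4.
    by rewrite ler_normr; apply/orP; right; lra.
  by rewrite ler_normr; apply/orP; left; lra.
- move=> p hp; rewrite -[p]add0r; apply: segment_const => // t /andP[t0 t1] i.
  apply: Dh0; right; rewrite add0r sqZ; apply: le_trans hp.
  by rewrite -[leRHS]mul1r ler_wpM2r ?sq_ge0 // exprn_ile1.
move=> X XP.
have near_h p : `|h p - h (phi (X p))| <= e / 4.
  have [KX Xmin] := XP p; pose z := phi (X p); pose v := p - z; pose d := `|v|.
  (* As [z] is an image point nearest to [p], no image point comes closer than [t * d] to the point
     at parameter [t] of the segment from [z] to [p]. Past length [s] the gradient of [h] therefore
     vanishes on it. *)
  have far t x : 0 <= t <= 1 -> K x -> t * d <= `|phi x - (z + t *: v)|.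
    move=> /andP[t0 t1] Kx.
    have h1 : d <= `|phi x - p| by rewrite /d /v distrC; exact: Xmin.
    have h2 : `|phi x - p| <= `|phi x - (z + t *: v)| + (1 - t) * d.
      have -> : phi x - p = (phi x - (z + t *: v)) - (1 - t) *: v.
        by rewrite /v; apply/rowP => i; rewrite !mxE; ring.
      apply: (le_trans (ler_normB _ _)); rewrite lerD2l normrZ ger0_norm //.
      by rewrite subr_ge0.
    lra.
  have D0 t i : 0 <= t <= 1 -> s <= t * d -> D i h (z + t *: v) = 0.
    move=> t01 st; rewrite Dh; apply: (moll_eq0 M0 alK) => // x Kx.
    by apply: le_trans st _; exact: far.
  have DC t i : `|D i h (z + t *: v)| <= C by rewrite Dh; exact: mC.
  have sC : m%:R * (s * C) <= e / 4.
    apply: (@le_trans _ _ (s * D1)); first by rewrite /D1; move: sp; nra.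
    by rewrite -ler_pdivlMr.
  have zp : z + 1 *: v = p by rewrite scale1r /v subrKC.
  have z0 : z + 0 *: v = z by rewrite scale0r addr0.
  have [ds|sd] := leP d s.
    have := segment_increment (x := z) (v := v) ch ler01 (fun t _ i => DC t i).
    rewrite zp z0 subr0 mulr1 => /le_trans; apply; apply: le_trans sC.
    by rewrite ler_wpM2l // ler_wpM2r.
  have d0 : 0 < d := lt_trans sp sd.
  pose t := s / d.
  have t0 : 0 <= t by rewrite divr_ge0 // ltW.
  have t1 : t <= 1 by rewrite ler_pdivrMr // mul1r ltW.
  have h1 := segment_increment (x := z) (v := v) ch t0 (fun t _ i => DC t i).
  have h2 : `|h (z + 1 *: v) - h (z + t *: v)| <= m%:R * (`|v| * 0) * (1 - t).
    apply: segment_increment => // u /andP[tu u1] i.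
    rewrite D0 ?normr0 // ?u1 ?andbT; first exact: le_trans tu.
    by rewrite -ler_pdivrMr.
  move: h1 h2; rewrite zp z0 subr0 !mulr0 mul0r normr_le0 subr_eq0 => h1 /eqP ->.
  apply: (le_trans h1); apply: le_trans sC.
  have -> : m%:R * (`|v| * C) * t = m%:R * (s * C).
    by rewrite /t -/d; field; rewrite gt_eqF.
  by [].
(* By the chain rule and [D_chi_alpha], the gradient of [G] is the Jacobian applied to [moll - al]
   at [phi x], which [moll_cvg] makes small. *)
pose G x := h (phi x) - chi x.
have [chp Dhp] := chain_map ch c1.
have cG : C1 G by apply: C1_sub => //; case: cchi.
have DG i x : K x -> `|D i G x| <= B * e1.
  move=> Kx; have -> : D i G x =
      \sum_l D i (fun x => phi x 0 l) x * (moll phi M al s l (phi x) - al l x).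
    rewrite (D_add i chp (C1_opp (C2_C1 cchi))) (D_opp i (C2_C1 cchi)) Dhp.
    rewrite (D_chi_alpha JT JJ sympO Dchi wOm) -sumrB; apply: eq_bigr => l _.
    by rewrite Dh -/al; ring.
  apply: (le_trans (ler_norm_sum _ _ _)).
  apply: (@le_trans _ _ (\sum_l `|D i (fun x => phi x 0 l) x| * e1)).
    by apply: ler_sum => l _; rewrite normrM ler_wpM2l // mcv.
  rewrite -mulr_suml ler_wpM2r ?(ltW e10) //.
  apply: le_trans (KB x Kx); apply: le_trans (ler_norm _).
  rewrite /f [in leRHS](bigD1 i) //= lerDl; apply: sumr_ge0 => k _.
  by apply: sumr_ge0.
have osc x y : K x -> K y -> `|G y - G x| <= e / 2.
  move=> Kx Ky; have H := annulus_oscillation r10 r12 m3 cG DG Kx Ky.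
  apply: (le_trans H).
  rewrite -/P1 mulrA /e1 mulrCA -[leRHS]mulr1 ler_wpM2l ?divr_ge0 ?(ltW e0) //.
  by rewrite ler_pdivrMr // mul1r lerDl.
move=> p p'.
have [KX _] := XP p; have [KX' _] := XP p'.
have -> : h p - chi (X p) - (h p' - chi (X p')) =
  (h p - h (phi (X p))) + (G (X p) - G (X p')) - (h p' - h (phi (X p'))).
  by rewrite /G; ring.
apply: (le_trans (ler_normB _ _)).
apply: (le_trans (lerD (le_trans (ler_normD _ _) (lerD (near_h p) (osc _ _ KX' KX))) (near_h p'))).
lra.
Qed.

End Potential.

(** * Volumes of cutoffs *)

Section CutoffVolume.
Variables (R : realType) (m : nat) (q : R).
Local Notation V := 'rV[R]_m.
Hypotheses (q0 : 0 < q) (q1 : q < 1).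

Definition cutoff_volume : R := IT 1 (cutoff q 1 : V -> R).

Lemma cutoff_vanish (b N : R) : 0 < b -> b <= N -> vanish N (cutoff q b : V -> R).
Proof.
move=> b0 bN x Nx; apply: cutoff_eq0 => //; apply: le_trans (norm_sq x).
by rewrite ler_pXn2r ?nnegrE ?(ltW b0) // (le_trans bN).
Qed.

Lemma cutoff_dilate (b : R) x : 0 < b -> cutoff q b (x : V) = cutoff q 1 (b^-1 *: x).
Proof.
move=> b0; rewrite /cutoff /slope sqZ expr1n mul1r; congr (1 - step (_ + _)).
rewrite invfM exprVn; ring.
Qed.

Lemma IT_cutoff (b N : R) : 0 < b -> b <= N ->
  IT N (cutoff q b : V -> R) = b ^+ m * cutoff_volume.
Proof.
move=> b0 bN; pose N' := Num.max N 1.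
have N0 : 0 <= N := le_trans (ltW b0) bN.
have NN : N <= N' by rewrite le_max lexx.
have N1 : 1 <= N' by rewrite le_max lexx orbT.
have cb (b' : R) : 0 < b' -> continuous (cutoff q b' : V -> R).
  by move=> b'0; apply: C1_cts; case: (C2_cutoff m q b').
rewrite -(IT_widen N0 NN (cb b b0) (cutoff_vanish b0 bN)).
rewrite /cutoff_volume -(IT_widen ler01 N1 (cb 1 ltr01) (cutoff_vanish ltr01 (lexx 1))).
have E : (cutoff q b : V -> R) = fun x => cutoff q 1 (b^-1 *: x).
  by apply/funext => x; exact: cutoff_dilate.
have vb : vanish N' (fun x : V => cutoff q 1 (b^-1 *: x)).
  by rewrite -E; apply: cutoff_vanish => //; exact: le_trans NN.
rewrite E IT_dilate //; first exact: le_trans NN.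
  exact: cb.
exact: cutoff_vanish.
Qed.

(** Comparison from below with a multiple of the product kernel on a small cube inside the ball
    where the cutoff is 1. *)
Lemma cutoff_volume_gt0 : 0 < cutoff_volume.
Proof.
(* Points of the cube of size [l] satisfy [sq x <= m l^2 <= q^2], and [k] normalises the kernel to
   be at most 1. *)
pose l := q / (m%:R + 1).
have m1 : 0 < (m%:R + 1 : R) by rewrite ltr_wpDl.
have l0 : 0 < l by rewrite divr_gt0.
have l1 : l <= 1.
  by rewrite ler_pdivrMr // mul1r (le_trans (ltW q1)) // lerDr.
pose k := (mass R) ^+ m.
have k0 : 0 < k by rewrite exprn_gt0 // mass_gt0.
have ce : continuous (fun x : V => eta 1 (l^-1 *: x)).
  have -> : (fun x : V => eta 1 (l^-1 *: x)) = fun x => eta 1 (0 + l^-1 *: x).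
    by apply/funext => x; rewrite add0r.
  by apply: (@cts_comp _ _ _ (fun x : V => 0 + l^-1 *: x)); [exact: cts_affine|exact: cts_eta].
have v1 : vanish 1 (eta 1 : V -> R) by move=> x; exact: eta_eq0.
have vl : vanish 1 (fun x : V => eta 1 (l^-1 *: x)).
  move=> x x1; apply: eta_eq0 => //; rewrite normrZ gtr0_norm ?invr_gt0 //.
  rewrite mulrC ler_pdivlMr // mul1r; exact: le_trans l1 x1.
have h : k * l ^+ m <= cutoff_volume.
  have -> : k * l ^+ m = IT 1 (fun x : V => k * eta 1 (l^-1 *: x)).
    by rewrite ITZ // (IT_dilate l0 ler01 (@cts_eta R m 1) v1 vl) IT_eta1 // mulr1.
  apply: IT_le => //.
  - by apply: ctsM => //; exact: ctsC.
  - by apply: C1_cts; case: (C2_cutoff m q 1).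
  move=> x _; have [xl|lx] := leP l `|x|.
    rewrite eta_eq0 ?mulr0 ?cutoff_ge0 // normrZ gtr0_norm ?invr_gt0 //.
    by rewrite mulrC ler_pdivlMr // mul1r.
  rewrite cutoff_eq1 //; last first.
    rewrite mulr1 /sq; apply: (@le_trans _ _ (\sum_(i < m) l ^+ 2)).
      apply: ler_sum => i _; rewrite -real_normK ?num_real // ler_pXn2r ?nnegrE ?(ltW l0) //.
      exact: le_trans (coord_le x i) (ltW lx).
    rewrite sumr_const card_ord -mulr_natr /l exprMn -mulrA -[leRHS]mulr1.
    rewrite ler_wpM2l ?exprn_ge0 ?(ltW q0) // exprVn mulrC ler_pdivrMr ?exprn_gt0 // mul1r.
    have : 0 <= (m%:R : R) by [].
    by rewrite expr2; nra.
  have := eta1_le (l^-1 *: x); rewrite ger0_norm ?eta1_ge0 // exprVn => e.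
  by rewrite mulrC -ler_pdivlMr // mul1r.
by apply: lt_le_trans h; rewrite mulr_gt0 // exprn_gt0.
Qed.

Lemma cutoff_mono (b b' : R) (x : V) : 0 < b -> b <= b' -> cutoff q b x <= cutoff q b' x.
Proof.
move=> b0 bb; rewrite /cutoff lerD2l lerN2; apply: step_homo.
have b'0 : 0 < b' := lt_le_trans b0 bb.
have q21 : 0 < 1 - q ^+ 2 by rewrite subr_gt0 exprn_ilt1 // ltW.
rewrite lerD2r ler_wpM2r ?sq_ge0 // /slope lef_pV2 ?posrE ?mulr_gt0 ?exprn_gt0 //.
by rewrite ler_pM2r // ler_pXn2r ?nnegrE // ltW.
Qed.

End CutoffVolume.

(** * The volume comparison *)

Section Squeeze.
Variables (R : realType) (m : nat) (r1 r2 a q : R).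
Local Notation V := 'rV[R]_m.
Variable X : V -> V.
Hypotheses (m0 : (0 < m)%N) (r10 : 0 < r1) (q2 : 1 / 2 <= q) (q1 : q < 1)
  (r12 : r1 <= q ^+ 3 * r2) (a0 : 0 < a) (a1 : a < 1).
Hypothesis pot_ex : forall b e : R, r1 <= q * b -> b <= r2 -> 0 < b -> 0 < e ->
  exists h : V -> R,
  [/\ continuous h, IT 2 h = IT (r2 + 1) (cutoff q b : V -> R),
      (forall p, 1 <= sq p -> h p = 0),
      (forall p, sq p <= a ^+ 2 -> h p = h 0) &
      forall p p', `|(h p - cutoff q b (X p)) - (h p' - cutoff q b (X p'))| <= e].

Let q0 : 0 < q. Proof. by apply: lt_le_trans q2; lra. Qed.
Let r20 : 0 < r2.
Proof. by rewrite -(pmulr_rgt0 _ (exprn_gt0 3 q0)); exact: lt_le_trans r12. Qed.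
Let qi0 : 0 < q^-1. Proof. by rewrite invr_gt0. Qed.
Let qi2 : q^-1 <= 2.
Proof. by rewrite -div1r ler_pdivrMr //; move: q2; lra. Qed.
Let c1 := cutoff_volume m q.
Let c10 : 0 < c1 := cutoff_volume_gt0 m q0 q1.
(** A smoothed indicator that is 1 on the unit ball, at the price of a factor [q^-m] in volume. *)
Let big : V -> R := cutoff q q^-1.

(** The vector of ones has [sq] equal to [m >= 1], so every potential vanishes there. The value of
    the cutoff at [xinf] thus fixes the free constant, as a point at infinity would. *)
Let xinf := X (const_mx 1).

Let big1 p : sq p <= 1 -> big p = 1.
Proof. by move=> p1; apply: cutoff_eq1 => //; rewrite mulfV ?gt_eqF // expr1n. Qed.

Let cts_cutoff (b : R) : continuous (cutoff q b : V -> R).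
Proof. by apply: C1_cts; case: (C2_cutoff m q b). Qed.

Let IT_big : IT 2 big = q^-1 ^+ m * c1. Proof. exact: IT_cutoff. Qed.

Let pot_inf (b e : R) : r1 <= q * b -> b <= r2 -> 0 < b -> 0 < e ->
  exists h : V -> R,
  [/\ continuous h, IT 2 h = b ^+ m * c1,
      (forall p, 1 <= sq p -> h p = 0),
      (forall p, sq p <= a ^+ 2 -> h p = h 0) &
      forall p, `|h p - (cutoff q b (X p) - cutoff q b xinf)| <= e].
Proof.
move=> h1 h2 h3 h4; have [h [ch Ih h0 hh hX]] := pot_ex h1 h2 h3 h4.
exists h; split=> //.
  by rewrite Ih IT_cutoff //; move: h2; lra.
move=> p; have := hX p (const_mx 1); rewrite (h0 (const_mx 1)).
  rewrite -/xinf; congr (`| _ | <= _); ring.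
rewrite /sq; under eq_bigr do rewrite mxE expr1n.
by rewrite sumr_const card_ord (ler_nat _ 1).
Qed.

Let small (x y : R) : (forall e, 0 < e -> x <= y + e) -> x <= y.
Proof. by move=> H; apply/ler_addgt0Pr => e e0; exact: H. Qed.

(** [H] is supported in the unit ball, at most [1 + e], and at most [e] on the ball of radius [a];
    it is compared with [(1 + e) * big] minus the cutoff of that inner ball. *)
Let upper (H : V -> R) (T e : R) : continuous H -> IT 2 H = T * c1 -> 0 < e ->
  (forall p, 1 <= sq p -> H p = 0) -> (forall p, sq p <= a ^+ 2 -> H p <= e) ->
  (forall p, H p <= 1 + e) -> T + a ^+ m <= (1 + e) * q^-1 ^+ m.
Proof.
move=> cH IH e0 H0 Ha H1.
have a2 : a <= 2 by move: a1; lra.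
have le : IT 2 H <= IT 2 (fun p => (1 + e) * big p - cutoff q a p).
  apply: IT_le => //.
  - by apply: ctsB; [apply: ctsM; [exact: ctsC|exact: cts_cutoff]|exact: cts_cutoff].
  move=> p _; have [p1|/ltW p1] := leP 1 (sq p).
    rewrite H0 // (_ : cutoff q a p = 0) ?subr0.
      by rewrite mulr_ge0 ?cutoff_ge0 //; move: e0; lra.
    apply: cutoff_eq0 => //; apply: le_trans p1.
    by rewrite exprn_ile1 // ltW.
  rewrite big1 // mulr1; have [pa|/ltW pa] := leP (sq p) (a ^+ 2).
    by apply: (le_trans (Ha p pa)); have := cutoff_le1 q a p; lra.
  by rewrite (cutoff_eq0 q0 q1 a0 pa) subr0.
have c2 : continuous (fun p => (1 + e) * big p).
  by apply: ctsM; [exact: ctsC|exact: cts_cutoff].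
move: le; rewrite IH ITB //.
rewrite ITZ //; last exact: cts_cutoff.
rewrite IT_big IT_cutoff // -/c1 => le.
by rewrite -(ler_pM2r c10) mulrDl -lerBrDr -mulrA.
Qed.

(** Infinity belongs to the outer side of the shell: otherwise the cutoff of radius [r2] would be 1
    at [xinf], and [h], close to the cutoff minus 1, would be nearly nonpositive in spite of its
    positive integral. *)
Lemma outer_point : (q * r2) ^+ 2 < sq xinf.
Proof.
rewrite ltNge; apply/negP => hx.
have r12' : r1 <= q * r2.
  apply: (le_trans r12); rewrite ler_wpM2r ?(ltW r20) //.
  by rewrite -[leRHS]expr1; apply: ler_wiXn2l => //; exact: ltW.
(* With this error the bound [h <= e * big] allows only half of the integral of [h]. *)
pose e := r2 ^+ m * q ^+ m / 2.
have e0 : 0 < e by rewrite divr_gt0 // mulr_gt0 // exprn_gt0.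
have [h [ch Ih h0 _ hX]] := pot_inf r12' (lexx r2) r20 e0.
have le : IT 2 h <= IT 2 (fun p => e * big p).
  apply: IT_le => //; first by apply: ctsM; [exact: ctsC|exact: cts_cutoff].
  move=> p _; have [p1|/ltW p1] := leP 1 (sq p).
    by rewrite h0 // mulr_ge0 ?cutoff_ge0 // ltW.
  rewrite big1 // mulr1; have := hX p.
  rewrite (@cutoff_eq1 _ _ q r2 q0 q1 r20 xinf hx) ler_norml => /andP[_].
  by have := cutoff_le1 q r2 (X p); lra.
move: le; rewrite Ih ITZ //; last exact: cts_cutoff.
rewrite IT_big mulrA ler_pM2r // /e.
have -> : r2 ^+ m * q ^+ m / 2 * q^-1 ^+ m = r2 ^+ m / 2.
  by rewrite exprVn; field; rewrite expf_neq0 // gt_eqF.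
have : 0 < r2 ^+ m by exact: exprn_gt0.
lra.
Qed.

Let inf0 (b : R) : 0 < b -> b <= q * r2 -> cutoff q b xinf = 0.
Proof.
move=> b0 bq; apply: cutoff_eq0 => //; apply: le_trans (ltW outer_point).
by rewrite ler_pXn2r ?nnegrE // ltW // mulr_gt0.
Qed.

Let qr (k : nat) : (k <= 2)%N -> r1 <= q * (q ^+ k * r2).
Proof.
move=> k2; rewrite mulrA -exprS; apply: (le_trans r12).
rewrite ler_wpM2r ?(ltW r20) //; apply: ler_wiXn2l => //; exact: ltW.
Qed.

Let qk (k : nat) : q ^+ k * r2 <= r2.
Proof.
by rewrite -[leRHS]mul1r ler_wpM2r ?(ltW r20) // exprn_ile1 // ltW.
Qed.

(** Normalised at [xinf], the potential of the cutoff of radius [q * r2] is at most [1 + e] and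
    supported in the unit ball. *)
Lemma volume_bound : q ^+ 2 * r2 <= 1.
Proof.
have h1 : r1 <= q * (q * r2) by have := @qr 1 isT; rewrite expr1.
have h2 : q * r2 <= r2 by have := @qk 1; rewrite expr1.
have h3 : 0 < q * r2 by rewrite mulr_gt0.
have H : (q * r2) ^+ m <= q^-1 ^+ m.
  apply: small => e e0.
  have e0' : 0 < e * q ^+ m by rewrite mulr_gt0 // exprn_gt0.
  have [h [ch Ih h0 _ hX]] := pot_inf h1 h2 h3 e0'.
  have le : IT 2 h <= IT 2 (fun p => (1 + e * q ^+ m) * big p).
    apply: IT_le => //; first by apply: ctsM; [exact: ctsC|exact: cts_cutoff].
    move=> p _; have [p1|/ltW p1] := leP 1 (sq p).
      by rewrite h0 // mulr_ge0 ?cutoff_ge0 //; move: e0'; lra.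
    rewrite big1 // mulr1; have := hX p.
    rewrite (inf0 h3 (lexx _)) ler_norml => /andP[_].
    by have := cutoff_le1 q (q * r2) (X p); lra.
  move: le; rewrite Ih ITZ //; last exact: cts_cutoff.
  rewrite IT_big mulrA ler_pM2r // mulrDl mul1r => /le_trans; apply.
  by rewrite lerD2l -mulrA -exprMn mulfV ?gt_eqF // expr1n mulr1.
have : q * r2 <= q^-1.
  by rewrite -(ler_pXn2r m0) ?nnegrE // ltW.
by rewrite expr2 -mulrA -(ler_pM2l q0) mulfV // gt_eqF.
Qed.

(** The radius [B] of [X 0] tells where the inner ball sits. If [B] is large, a large cutoff has
    potential near 0 on that ball, and the volumes add up. If [B] is small, a small cutoff has
    potential near 1 there, so its volume dominates that of the ball. *)
Lemma squeeze : a <= r1 / q ^+ 2 \/ (q ^+ 2 * r2) ^+ m + a ^+ m <= q^-1 ^+ m.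
Proof.
pose x0 := X 0; pose B := Num.sqrt (sq x0).
have B0 : 0 <= B by exact: sqrtr_ge0.
have sB : sq x0 = B ^+ 2 by rewrite sqr_sqrtr ?sq_ge0.
have q2i : 0 < q ^+ 2 by rewrite exprn_gt0.
(* The error is chosen as [e * q^m] so that the factor [q^-m] of [big] cancels. *)
have limit (T : R) : (forall e, 0 < e -> T + a ^+ m <= (1 + e) * q^-1 ^+ m) ->
    T + a ^+ m <= q^-1 ^+ m.
  move=> H; apply: small => e e0.
  have e0' : 0 < e * q ^+ m by rewrite mulr_gt0 // exprn_gt0.
  apply: (le_trans (H _ e0')); rewrite mulrDl mul1r lerD2l -mulrA -exprMn.
  by rewrite mulfV ?gt_eqF // expr1n mulr1.
have [Bout|Bout] := leP (q ^+ 2 * r2) B.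
  right; apply: limit => e e0.
  have b0 : 0 < q ^+ 2 * r2 by rewrite mulr_gt0.
  have bq : q ^+ 2 * r2 <= q * r2.
    by rewrite ler_wpM2r ?(ltW r20) // -[leRHS]expr1; apply: ler_wiXn2l => //; exact: ltW.
  have [h [ch Ih h0 hh hX]] := pot_inf (@qr 2 isT) (@qk 2) b0 e0.
  have hX' p : h p <= cutoff q (q ^+ 2 * r2) (X p) + e.
    by have := hX p; rewrite inf0 // ler_norml => /andP[_]; lra.
  apply: (upper ch Ih e0 h0) => p.
    move=> /hh ->; apply: (le_trans (hX' 0)).
    rewrite (@cutoff_eq0 _ _ q _ q0 q1 b0 x0) ?add0r // sB.
    by rewrite ler_pXn2r ?nnegrE // ltW.
  by apply: (le_trans (hX' p)); rewrite lerD2r cutoff_le1.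
have [Bin|Bin] := leP B (r1 / q).
  left; pose b := r1 / q ^+ 2.
  have b0 : 0 < b by rewrite divr_gt0.
  have qb : q * b = r1 / q by rewrite /b; field; rewrite gt_eqF.
  have bq : b <= q * r2.
    by rewrite ler_pdivrMr // mulrAC -exprS.
  have bqb : r1 <= q * b.
    by rewrite qb ler_pdivlMr // -[leRHS]mulr1 ler_pM2l // ltW.
  have br : b <= r2 by apply: (le_trans bq); have := @qk 1; rewrite expr1.
  rewrite -(ler_pXn2r m0) ?nnegrE ?(ltW a0) ?(ltW b0) //.
  apply: small => e e0.
  have e0' : 0 < e * q ^+ m by rewrite mulr_gt0 // exprn_gt0.
  have [h [ch Ih h0 hh hX]] := pot_inf bqb br b0 e0'.
  have hX' p : cutoff q b (X p) - e * q ^+ m <= h p.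
    by have := hX p; rewrite inf0 // ler_norml => /andP[+ _]; lra.
  have le : IT 2 (fun p => cutoff q a p - (e * q ^+ m) * big p) <= IT 2 h.
    apply: IT_le => //.
      by apply: ctsB; [exact: cts_cutoff|apply: ctsM; [exact: ctsC|exact: cts_cutoff]].
    move=> p _; have [p1|/ltW p1] := leP 1 (sq p).
      rewrite h0 // (_ : cutoff q a p = 0) ?sub0r ?oppr_le0.
        by rewrite mulr_ge0 ?cutoff_ge0 // ltW.
      apply: cutoff_eq0 => //; apply: le_trans p1.
      by rewrite exprn_ile1 // ltW.
    rewrite big1 // mulr1; have [pa|/ltW pa] := leP (sq p) (a ^+ 2).
      rewrite (hh p pa); apply: le_trans (hX' 0); rewrite lerD2r.
      rewrite (@cutoff_eq1 _ _ q b q0 q1 b0 (X 0)) ?cutoff_le1 //.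
      by rewrite -/x0 sB qb ler_pXn2r ?nnegrE // divr_ge0 // ltW.
    rewrite (cutoff_eq0 q0 q1 a0 pa) sub0r; apply: le_trans (hX' p).
    by rewrite -[leLHS]add0r lerD2r cutoff_ge0.
  have a2 : a <= 2 by move: a1; lra.
  have c3 : continuous (fun p => e * q ^+ m * big p).
    by apply: ctsM; [exact: ctsC|exact: cts_cutoff].
  move: le; rewrite Ih ITB //.
  rewrite ITZ //; last exact: cts_cutoff.
  rewrite IT_big IT_cutoff // -/c1 mulrA -mulrBl ler_pM2r //.
  by rewrite -mulrA -exprMn mulfV ?gt_eqF // expr1n mulr1 lerBlDr.
(* For [B] in the middle range, the cutoff at radius [bo] has a thin layer just outside radius [B]
   removed: the combination [bo - b2 + B] of cutoffs takes the value [1 - 1 + 0] at [X 0], stays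
   below 1, and so behaves as in the case of large [B]. *)
right; have B00 : 0 < B by apply: lt_trans Bin; rewrite divr_gt0.
pose b2 := B / q; pose bo := q * r2.
have bo0 : 0 < bo by rewrite mulr_gt0.
have b20 : 0 < b2 by rewrite divr_gt0.
have Bb2 : B <= b2 by rewrite ler_pdivlMr // -[leRHS]mulr1 ler_pM2l // ltW.
have b2o : b2 <= bo by rewrite ler_pdivrMr // /bo mulrAC -expr2 ltW.
have bor : bo <= r2 by have := @qk 1; rewrite expr1.
have qB : r1 <= q * B by rewrite mulrC -ler_pdivrMr // ltW.
have qb2 : r1 <= q * b2 by apply: (le_trans qB); rewrite ler_pM2l.
have qbo : r1 <= q * bo by have := @qr 1 isT; rewrite expr1.
(* The removed layer has volume proportional to [B^m (q^-m - 1)]. This is at most what the increase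
   of the outer radius from [q^2 r2] to [bo] gains. *)
have T1 : (q ^+ 2 * r2) ^+ m <= bo ^+ m - b2 ^+ m + B ^+ m.
  have -> : bo = (q ^+ 2 * r2) / q by rewrite /bo; field; rewrite gt_eqF.
  rewrite /b2 !expr_div_n.
  have k1 : 0 <= (q ^+ m)^-1 - 1.
    by rewrite subr_ge0 invf_ge1 ?exprn_gt0 // exprn_ile1 // ltW.
  have k2 : B ^+ m <= (q ^+ 2 * r2) ^+ m.
    by rewrite ler_pXn2r ?nnegrE // ltW // mulr_gt0.
  have : B ^+ m * ((q ^+ m)^-1 - 1) <= (q ^+ 2 * r2) ^+ m * ((q ^+ m)^-1 - 1).
    by rewrite ler_wpM2r.
  lra.
suff : bo ^+ m - b2 ^+ m + B ^+ m + a ^+ m <= q^-1 ^+ m by move: T1; lra.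
apply: limit => e e0.
have e3 : 0 < e / 3 by rewrite divr_gt0.
have [ho [cho Iho ho0 hho hXo]] := pot_inf qbo bor bo0 e3.
have [h2 [ch2 Ih2 h20 hh2 hX2]] := pot_inf qb2 (le_trans b2o bor) b20 e3.
have [h1 [ch1 Ih1 h10 hh1 hX1]] := pot_inf qB (le_trans Bb2 (le_trans b2o bor)) B00 e3.
pose H p := ho p - h2 p + h1 p.
have c12 : continuous (fun p => ho p - h2 p) by exact: ctsB.
have HX p : H p <= cutoff q bo (X p) - cutoff q b2 (X p) + cutoff q B (X p) + e.
  have := hXo p; have := hX2 p; have := hX1 p.
  rewrite !inf0 //; last exact: le_trans b2o.
  rewrite !ler_norml => /andP[_ ?] /andP[? _] /andP[_ ?].
  by rewrite /H; lra.
apply: (@upper H _ e) => //.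
- exact: ctsD.
- by rewrite ITD // ITB // Iho Ih2 Ih1; ring.
- by move=> p p1; rewrite /H ho0 // h20 // h10 // subrr addr0.
- move=> p pa; have -> : H p = H 0 by rewrite /H hho // hh2 // hh1.
  apply: (le_trans (HX 0)); rewrite -/x0.
  rewrite (@cutoff_eq1 _ _ q bo q0 q1 bo0 x0); last first.
    rewrite sB ler_pXn2r ?nnegrE // ?ltW //; last by rewrite mulr_gt0.
    by rewrite /bo mulrA -expr2.
  rewrite (@cutoff_eq1 _ _ q b2 q0 q1 b20 x0); last first.
    by rewrite sB /b2 mulrC divfK // gt_eqF.
  by rewrite (@cutoff_eq0 _ _ q B q0 q1 B00 x0) ?sB // addr0 subrr add0r.
move=> p; apply: (le_trans (HX p)); rewrite lerD2r.
have := cutoff_le1 q bo (X p).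
have := cutoff_mono q0 q1 (X p) B00 Bb2.
lra.
Qed.

End Squeeze.

(** * Globalisation of local regularity by cutoffs *)

Section CutOff.
Variables (R : realType) (m : nat).
Local Notation V := 'rV[R]_m.
Implicit Types (x v : V) (i j l : 'I_m) (f g u rho : V -> R) (S W : set V).

Definition C1_on W f := forall x, W x ->
  differentiable f x /\ forall i, {for x, continuous (D i f)}.

Lemma near_continuous f g x : (\forall y \near x, f y = g y) ->
  {for x, continuous f} -> {for x, continuous g}.
Proof.
move=> E; have e : f x = g x := nbhs_singleton E.
rewrite /prop_for /continuous_at -e => h.
apply: cvg_trans h; apply: (@near_eq_cvg _ _ (nbhs x) (nbhs_filter x)).
by apply: filterS E => y ->.
Qed.

Lemma near_D f g i x : (\forall y \near x, f y = g y) ->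
  \forall y \near x, D i f y = D i g y.
Proof.
move=> /near_join; apply: filterS => y fg; exact: near_eq_derive.
Qed.

Lemma eq_C1_on W f g : open W -> (forall x, W x -> f x = g x) -> C1_on W f -> C1_on W g.
Proof.
move=> oW fg cf x Wx; have [df cD] := cf x Wx.
have E : \forall y \near x, f y = g y.
  by apply: (filterS _ (open_nbhs_nbhs (conj oW Wx))) => y; exact: fg.
split=> [|i].
  apply: differentiable_partial => [|i].
    near=> y => i; have Wy : W y by near: y; exact: open_nbhs_nbhs.
    apply: (@near_eq_derivable _ _ _ f).
      by apply: (filterS _ (open_nbhs_nbhs (conj oW Wy))) => z; exact: fg.
    by have [dfy _] := cf y Wy; exact: diff_derivable.
  exact: near_continuous (near_D i E) (cD i).
exact: near_continuous (near_D i E) (cD i).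
Unshelve. all: by end_near. Qed.

Lemma D_eq0_off S rho i x : closed S -> (forall x, ~ S x -> rho x = 0) -> ~ S x -> D i rho x = 0.
Proof.
move=> cS r0 Sx; rewrite (_ : 0 = D i (fun=> 0 : R) x); last by rewrite D_cst.
apply: near_eq_derive; apply: (filterS _ (open_nbhs_nbhs (conj (closed_openC cS) Sx))).
by move=> y; exact: r0.
Qed.

(** At points of [S] both factors are regular; the complement of [S] is open and the product is 0 on
    it. The values of [u] off [W] are thus arbitrary. *)
Lemma C1_cutoff_mul S W rho u : closed S -> open W -> S `<=` W ->
  (forall x, ~ S x -> rho x = 0) -> C1 rho -> C1_on W u ->
  C1 (fun x => rho x * u x) /\
  forall i, D i (fun x => rho x * u x) = fun x => D i rho x * u x + rho x * D i u x.
Proof.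
move=> cS oW SW r0 c1 cu.
have off x : ~ S x -> \forall y \near x, rho y * u y = 0.
  move=> Sx; apply: (filterS _ (open_nbhs_nbhs (conj (closed_openC cS) Sx))) => y Sy.
  by rewrite r0 // mul0r.
have df x : differentiable (fun x => rho x * u x) x.
  have [Sx|Sx] := pselect (S x).
    by apply: differentiableM; [case: c1|exact: (proj1 (cu x (SW x Sx)))].
  apply: differentiable_partial => [|i].
    have := near_join (off x Sx); apply: filterS => y h i.
    apply: (@near_eq_derivable _ _ _ (fun=> 0)) => //.
    by apply: filterS h => z ->.
  have E : \forall y \near x, D i (fun=> 0) y = D i (fun x => rho x * u x) y.
    by apply: near_D; apply: filterS (off x Sx) => z ->.
  by apply: near_continuous E _; rewrite D_cst; exact: cst_continuous.
have DE i : D i (fun x => rho x * u x) = fun x => D i rho x * u x + rho x * D i u x.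
  apply/funext => x; have [Sx|Sx] := pselect (S x).
    have drho : derivable rho x (delta_mx 0 i) by exact: C1_derivable.
    have du : derivable u x (delta_mx 0 i).
      by apply: diff_derivable; exact: (proj1 (cu x (SW x Sx))).
    by rewrite {1}/D (deriveM drho du) /= addrC; congr (_ + _); rewrite mulrC.
  rewrite (D_eq0_off i cS r0 Sx) mul0r r0 // mul0r addr0.
  rewrite (_ : 0 = D i (fun=> 0 : R) x); last by rewrite D_cst.
  exact: near_eq_derive (off x Sx).
split=> //; split=> // i x; rewrite DE.
have [Sx|Sx] := pselect (S x).
  have [du cDu] := cu x (SW x Sx).
  have k1 : {for x, continuous (fun y => D i rho y * u y)}.
    apply: (@continuousM _ _ (D i rho) u); first exact: C1_D.
    exact: differentiable_continuous.
  have k2 : {for x, continuous (fun y => rho y * D i u y)}.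
    by apply: (@continuousM _ _ rho (D i u)); [exact: (C1_cts c1)|exact: cDu].
  exact: (continuousD k1 k2).
apply: (@near_continuous (fun=> 0)); last exact: cst_continuous.
apply: (filterS _ (open_nbhs_nbhs (conj (closed_openC cS) Sx))) => y Sy.
by rewrite (D_eq0_off i cS r0 Sy) mul0r r0 // mul0r addr0.
Qed.

Lemma C2_cutoff_mul S W rho u : closed S -> open W -> S `<=` W ->
  (forall x, ~ S x -> rho x = 0) -> C2 rho -> C1_on W u -> (forall i, C1_on W (D i u)) ->
  C2 (fun x => rho x * u x).
Proof.
move=> cS oW SW r0 [c1 c2] cu cDu.
have [ca DE] := C1_cutoff_mul cS oW SW r0 c1 cu.
split; [exact ca|move=> i; rewrite DE].
have k1 : C1 (fun x => D i rho x * u x).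
  apply: (proj1 (C1_cutoff_mul cS oW SW _ (c2 i) cu)) => x Sx.
  exact: D_eq0_off Sx.
have k2 := proj1 (C1_cutoff_mul cS oW SW r0 c1 (cDu i)).
exact (C1_add k1 k2).
Qed.

(** The passage from vector valued [iter_partial] to the scalar operators [D i] on components. *)
Lemma smooth_C1_on k W (F : V -> 'rV[R]_k) : open W -> smooth_on W F ->
  forall s (l : 'I_k), C1_on W (fun x => iter_partial F s x 0 l) /\
    forall i x, W x -> D i (fun x => iter_partial F s x 0 l) x = iter_partial F (i :: s) x 0 l.
Proof.
move=> oW sF.
have dF s (l : 'I_k) i x : W x -> derivable (fun x => iter_partial F s x 0 l) x (delta_mx 0 i).
  by move=> Wx; have [_ /(_ i)/derivable_mxP] := sF s x Wx; exact.
have DE s (l : 'I_k) i x : W x ->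
    D i (fun x => iter_partial F s x 0 l) x = iter_partial F (i :: s) x 0 l.
  by move=> Wx; have [_ /(_ i) h] := sF s x Wx; rewrite /= derive_mx // mxE.
move=> s l; split=> [x Wx|]; last by move=> i x; exact: DE.
have cD i : {for x, continuous (D i (fun x => iter_partial F s x 0 l))}.
  have [h _] := sF (i :: s) x Wx.
  have h' : {for x, continuous (fun y => iter_partial F (i :: s) y 0 l)}.
    exact: (@continuous_comp _ _ _ _ (fun w : 'rV[R]_k => w 0 l) _ h (@cts_coord _ _ l _)).
  apply: near_continuous h'.
  by apply: (filterS _ (open_nbhs_nbhs (conj oW Wx))) => y Wy; rewrite DE.
split=> //; apply: differentiable_partial => //.
by apply: (filterS _ (open_nbhs_nbhs (conj oW Wx))) => y Wy i; exact: dF.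
Qed.

End CutOff.
(** The hypothesis exhibits [- J A^T J] as a right inverse of the square matrix [A], hence as a left
    inverse. *)
Lemma symplectic_trmx (R : realType) (m : nat) (J A : 'M[R]_m) :
  J *m J = - 1%:M -> A *m J *m A^T = J -> A^T *m J *m A = J.
Proof.
move=> JJ e; have /mulmx1C : A *m (- (J *m A^T *m J)) = 1%:M.
  by rewrite mulmxN !mulmxA e JJ opprK.
rewrite mulNmx => /(congr1 (mulmx J)).
by rewrite mulmxN !mulmxA JJ !mulNmx mul1mx opprK mulmx1.
Qed.

(** * The matrix of the standard symplectic form *)

Section SymplecticMatrix.
Variables (R : realType) (n : nat).
Local Notation V := 'rV[R]_(n * 2).
Implicit Types (u v x : V) (i k l : 'I_(n * 2)).

Definition rot2 : 'M[R]_2 :=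
  \matrix_(i, j) (((i == 0) && (j == 1))%:R - ((i == 1) && (j == 0))%:R).
(** Through [mxvec] a row vector is an n x 2 matrix whose rows are the pairs [(x_j, y_j)]; [Jst]
    turns each of them into [(- y_j, x_j)]. *)
Definition Jst : 'M[R]_(n * 2) := lin_mulmxr rot2.

Lemma mul_rot2 (A : 'M[R]_(n, 2)) j : (A *m rot2) j 0 = - A j 1 /\ (A *m rot2) j 1 = A j 0.
Proof.
rewrite !mxE !big_ord_recl !big_ord0 !mxE /=.
have -> : lift ord0 ord0 = 1 :> 'I_2 by exact/val_inj.
by split; rewrite /=; ring.
Qed.

Lemma omega_st_mx u v : omega_st u v = (u *m Jst *m v^T) 0 0.
Proof.
rewrite /omega_st -[u in RHS]vec_mxK mul_vec_lin mxE.
pose F (i : 'I_n) (j : 'I_2) := (vec_mx u *m rot2) i j * vec_mx v i j.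
rewrite (reindex _ (curry_mxvec_bij _ _)) /=.
transitivity (\sum_i \sum_j F i j); last first.
  by rewrite pair_bigA; apply: eq_bigr => -[i j] _; rewrite /F /= mxvecE !mxE.
apply: eq_bigr => j _; rewrite !big_ord_recl big_ord0 /F.
have -> : lift ord0 ord0 = 1 :> 'I_2 by exact/val_inj.
rewrite /coord_x /coord_y; have [-> ->] := mul_rot2 (vec_mx u) j; rewrite !mxE; ring.
Qed.

Lemma omega_st_delta k l : omega_st 'e_k 'e_l = Jst k l :> R.
Proof. by rewrite omega_st_mx -rowE trmx_delta -colE !mxE. Qed.

Lemma Jst_trmx : Jst^T = - Jst.
Proof.
apply/matrixP => k l; rewrite [LHS]mxE [RHS]mxE -!omega_st_delta /omega_st -sumrN.
by apply: eq_bigr => j _; rewrite opprB.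
Qed.

Lemma Jst_sqr : Jst *m Jst = - 1%:M.
Proof.
apply/row_matrixP => k; rewrite !rowE mulmxA -[delta_mx _ _]vec_mxK !mul_vec_lin /=.
rewrite mulmxN mulmx1 -linearN; congr mxvec; apply/matrixP => i j.
have [e0 e1] := mul_rot2 (vec_mx 'e_k *m rot2) i.
have [e2 e3] := mul_rot2 (vec_mx 'e_k) i.
rewrite [RHS]mxE; case: j => [[|[|//]] jlt].
  by rewrite (_ : Ordinal jlt = 0) ?e0 ?e3 //; exact/val_inj.
by rewrite (_ : Ordinal jlt = 1) ?e1 ?e2 //; exact/val_inj.
Qed.

End SymplecticMatrix.

(** * Shells and symplectic embeddings in coordinates *)

Section ShellSetting.
Variables (R : realType) (n : nat).
Local Notation V := 'rV[R]_(n * 2).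
Implicit Types (x y v : V) (r s d : R).

Lemma eucl_normE x : eucl_norm x = Num.sqrt (sq x).
Proof. by []. Qed.

Lemma eucl_ballE s x : 0 < s -> eucl_ball s x = (sq x < s ^+ 2) :> Prop.
Proof.
move=> s0; rewrite /eucl_ball /= eucl_normE; congr is_true.
by rewrite -[RHS]ltr_sqrt ?exprn_gt0 // sqrtr_sqr gtr0_norm.
Qed.

Lemma closure_eucl_ball_le s x : 0 < s -> closure (eucl_ball s) x -> sq x <= s ^+ 2.
Proof.
move=> s0 cx; rewrite leNgt; apply/negP => sx.
have [y [yb]] := cx _ (open_nbhs_nbhs (conj (proj2 (open_sq (n * 2) (s ^+ 2))) sx)).
by rewrite eucl_ballE // in yb; rewrite /= ltNge (ltW yb).
Qed.

Lemma closed_shell_sub d r : 0 < r -> 0 < d < 1 ->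
  [set x : V | (r * (1 - d)) ^+ 2 <= sq x < r ^+ 2] `<=` closed_shell d r.
Proof.
move=> r0 /andP[d0 d1] x /= /andP[x1 x2]; split.
  by apply: subset_closure; rewrite eucl_ballE.
by rewrite eucl_ballE ?mulr_gt0 ?subr_gt0 // ltNge x1.
Qed.

Lemma sq_open_shell (e : R) x : 0 < e < 1 -> open_shell e x -> (1 - e) ^+ 2 <= sq x < 1.
Proof.
move=> /andP[e0 e1] [x1 x2]; rewrite eucl_ballE // expr1n in x1; rewrite x1 andbT leNgt.
by apply/negP => h; apply: x2; apply: subset_closure; rewrite eucl_ballE ?subr_gt0.
Qed.

Lemma smooth_coord_D (W : set V) (f : V -> V) x k l : open W -> smooth_on W f -> W x ->
  ('d f x 'e_k) 0 l = D k (fun y => f y 0 l) x.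
Proof.
move=> oW sf Wx.
have df : differentiable f x.
  by apply: differentiable_rV => i; exact: (proj1 ((smooth_C1_on oW sf [::] i).1 x Wx)).
rewrite -deriveE // derive_mx; last exact: diff_derivable.
by rewrite mxE.
Qed.

(** Invariance of the form reads [jac J jac^T = J], whereas brackets of components are the entries
    of [jac^T J jac]; [symplectic_trmx] passes from one to the other. *)
Lemma smooth_symplectic_pb (W : set V) (f : V -> V) x k l : open W -> smooth_on W f -> W x ->
  (forall u v, omega_st ('d f x u) ('d f x v) = omega_st u v) ->
  pb (Jst R n) (fun y => f y 0 k) (fun y => f y 0 l) x = Jst R n k l.
Proof.
move=> oW sf Wx symp; rewrite pb_ph; congr (fun_of_matrix _ k l).
apply: symplectic_trmx; first exact: Jst_sqr.
apply/matrixP => i j; rewrite -[RHS]omega_st_delta -symp omega_st_mx.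
have E k' : 'd f x 'e_k' = row k' (jac f x).
  by apply/rowP => l'; rewrite (smooth_coord_D _ _ oW sf Wx) !mxE.
rewrite !E tr_row -row_mul [LHS]mxE [RHS]mxE.
by apply: eq_bigr => t _; rewrite [in RHS]mxE [in X in _ = _ * X]mxE.
Qed.

Lemma pb_near_eq (f f' g g' : V -> R) x : (\forall y \near x, f y = f' y) ->
  (\forall y \near x, g y = g' y) -> pb (Jst R n) f g x = pb (Jst R n) f' g' x.
Proof.
move=> ff gg; have E h h' (e : \forall y \near x, h y = h' y) : grad h x = grad h' x.
  by apply/colP => i; rewrite !mxE; exact: near_eq_derive.
by rewrite /pb (E _ _ ff) (E _ _ gg).
Qed.

End ShellSetting.

(** * The volume alternative for an embedded shell *)

Section ShellVolume.
Variables (R : realType) (n : nat).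
Local Notation V := 'rV[R]_(n * 2).
Implicit Types (x y v : V).
Variables (d r e q : R).
Hypotheses (n2 : (2 <= n)%N) (d0 : 0 < d) (d1 : d < 1) (r0 : 0 < r) (e0 : 0 < e) (e1 : e < 1)
  (q2 : 1 / 2 <= q) (q1 : q < 1) (dq : 1 - d <= q ^+ 8)
  (emb : shell_embeds d r (@open_shell R n e)).

Let q0 : 0 < q. Proof. by apply: lt_le_trans q2; rewrite divr_gt0. Qed.
Let h := r * (1 - d).
Let h0 : 0 < h. Proof. by rewrite mulr_gt0 ?subr_gt0. Qed.
(** The shell is shrunk on both sides to leave room for the cutoff [rho]. The hypothesis [dq] is
    then exactly the inequality [r1 <= q ^+ 3 * r2] of the comparison. *)
Let r1 := h / q ^+ 2.
Let r2 := q ^+ 3 * r.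
(** Slightly less than [1 - e], so that the lower bound for points of the open shell becomes strict
    on the image. *)
Let a := q * (1 - e).

Let r10 : 0 < r1. Proof. by rewrite divr_gt0 ?exprn_gt0. Qed.
Let r20 : 0 < r2. Proof. by rewrite mulr_gt0 ?exprn_gt0. Qed.
Let r12 : r1 <= q ^+ 3 * r2.
Proof.
rewrite ler_pdivrMr ?exprn_gt0 // /h /r2 (_ : q ^+ 3 * (q ^+ 3 * r) * q ^+ 2 = r * q ^+ 8).
  by rewrite ler_pM2l.
ring.
Qed.
Let r12' : r1 <= r2.
Proof.
apply: (le_trans r12); rewrite -[leRHS]mul1r ler_wpM2r ?(ltW r20) //.
by rewrite exprn_ile1 // ltW.
Qed.
Let a0 : 0 < a. Proof. by rewrite mulr_gt0 ?subr_gt0. Qed.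
Let a1 : a < 1 - e. Proof. by rewrite -[ltRHS]mul1r ltr_pM2r ?subr_gt0. Qed.

(** Equal to 1 on the open set [O] around the annulus and to 0 off [S], so that multiplying the
    embedding by [rho] gives a map of class [C2] on the whole space that is unchanged near the
    annulus. *)
Let rho x := (1 - cutoff q (h / q) x) * cutoff q (q * r) x.
Let S : set V := annulus h (q * r).
Let O : set V := [set x | (h / q) ^+ 2 < sq x] `&` [set x | sq x < (q * (q * r)) ^+ 2].

Let hq0 : 0 < h / q. Proof. by rewrite divr_gt0. Qed.
Let qr0 : 0 < q * r. Proof. by rewrite mulr_gt0. Qed.

Let C2_rho : C2 rho.
Proof.
apply: (C2_mul (f := fun x => 1 - cutoff q (h / q) x) (g := cutoff q (q * r))).
  apply: (C2_add (f := fun=> 1) (g := fun x => - cutoff q (h / q) x)).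
    exact: C2_cst.
  exact: (C2_opp (C2_cutoff _ _ _)).
exact: C2_cutoff.
Qed.

Let rho_off x : ~ S x -> rho x = 0.
Proof.
move=> /negP; rewrite /S /annulus /= negb_and -!ltNge => /orP[|] xs; rewrite /rho.
  rewrite cutoff_eq1 ?subrr ?mul0r //; apply: (le_trans (ltW xs)).
  by rewrite (_ : q * (h / q) = h) //; field; rewrite gt_eqF.
by rewrite [cutoff q (q * r) x]cutoff_eq0 ?mulr0 // ltW.
Qed.

Let rho_on x : O x -> rho x = 1.
Proof.
move=> [/= x1 x2]; rewrite /rho cutoff_eq0 ?(ltW x1) // cutoff_eq1 ?(ltW x2) //.
by rewrite subr0 mulr1.
Qed.

Let oO : open O.
Proof. by apply: openI; [exact: (proj2 (open_sq _ _))|exact: (proj1 (open_sq _ _))]. Qed.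

Let KO x : annulus r1 r2 x -> O x.
Proof.
move=> /andP[x1 x2]; split => /=.
  apply: lt_le_trans x1; rewrite ltr_pXn2r ?nnegrE ?ltW // /r1.
  rewrite ltr_pdivrMr ?exprn_gt0 // (_ : h / q ^+ 2 * q = h / q); last by field; rewrite gt_eqF.
  by rewrite ltr_pdivlMr // -[ltRHS]mulr1 ltr_pM2l.
apply: (le_lt_trans x2); rewrite ltr_pXn2r ?nnegrE ?ltW ?mulr_gt0 // /r2.
rewrite exprS -mulrA expr2 -!mulrA -[ltRHS]mul1r ltr_pM2r // !mulr_gt0 //.
Qed.

Let clS : closed S.
Proof.
apply: compact_closed; first exact: norm_hausdorff.
by apply: annulus_compact; exact: ltW.
Qed.

Let SA : S `<=` closed_shell d r.
Proof.
move=> x /andP[x1 x2]; apply: closed_shell_sub; rewrite ?d0 //= x1 /=.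
apply: (le_lt_trans x2); rewrite ltr_pXn2r ?nnegrE ?(ltW r0) ?(ltW qr0) //.
by rewrite -[ltRHS]mul1r ltr_pM2r.
Qed.

Let KS : annulus r1 r2 `<=` S.
Proof.
move=> x /KO[/= x1 x2]; apply: contrapT => /rho_off r00.
suff : rho x = 1 by rewrite r00 => /esym/eqP; rewrite oner_eq0.
exact: rho_on.
Qed.

Lemma shell_alternative : q ^+ 5 * r <= 1 /\
  (q * (1 - e) <= r * (1 - d) / q ^+ 4 \/
   (q ^+ 5 * r) ^+ (n * 2) + (q * (1 - e)) ^+ (n * 2) <= q^-1 ^+ (n * 2)).
Proof.
have [W [f [oW SW [[sf _ [g [gf _]]] fV symp]]]] := emb.
have SW' : S `<=` W by apply: subset_trans SW.
pose phi x : V := \row_l (rho x * f x 0 l).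
have phiE l : (fun x => phi x 0 l) = fun x => rho x * f x 0 l by apply/funext => x; rewrite mxE.
have fC l := smooth_C1_on oW sf [::] l.
have cphi l : C2 (fun x => phi x 0 l).
  rewrite phiE; apply: (C2_cutoff_mul clS oW SW' rho_off C2_rho (proj1 (fC l))) => i.
  apply: (eq_C1_on oW _ (proj1 (smooth_C1_on oW sf [:: i] l))) => x Wx.
  by rewrite (proj2 (fC l) i x Wx).
have phif x : O x -> phi x = f x.
  by move=> Ox; apply/rowP => l; rewrite mxE rho_on // mul1r.
have nphi x l : annulus r1 r2 x -> \forall y \near x, phi y 0 l = f y 0 l.
  move=> /KO Ox; apply: (filterS _ (open_nbhs_nbhs (conj oO Ox))) => y Oy.
  by rewrite phif.
have KW x : annulus r1 r2 x -> W x by move=> Kx; apply/SW'/KS.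
have psymp x i j : annulus r1 r2 x ->
    pb (Jst R n) (fun y => phi y 0 i) (fun y => phi y 0 j) x = Jst R n i j.
  move=> Kx; rewrite (pb_near_eq (nphi x i Kx) (nphi x j Kx)).
  exact: (smooth_symplectic_pb _ _ oW sf (KW x Kx) (fun u v => symp x u v (KW x Kx))).
have pinj x y : annulus r1 r2 x -> annulus r1 r2 y -> phi x = phi y -> x = y.
  move=> Kx Ky; rewrite !phif; [|exact: KO|exact: KO] => exy.
  by rewrite -(gf x (KW x Kx)) exy gf //; exact: KW.
have pimg x : annulus r1 r2 x -> a ^+ 2 < sq (phi x) < 1.
  move=> Kx; rewrite phif; last exact: KO.
  have e01 : 0 < e < 1 by rewrite e0.
  have /andP[f1 f2] := sq_open_shell e01 (fV _ (ex_intro2 _ _ x (KW x Kx) erefl)).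
  rewrite f2 andbT; apply: lt_le_trans f1.
  by rewrite ltr_pXn2r ?nnegrE ?(ltW a0) // subr_ge0 ltW.
have n3 : (2 < n * 2)%N by apply: (@leq_trans (2 * 2)); rewrite ?leq_mul2r.
have n0 : (0 < n * 2)%N by apply: ltn_trans n3.
have [X HX] := nearest_ex n3 r10 r12' cphi.
have pot b eps : r1 <= q * b -> b <= r2 -> 0 < b -> 0 < eps -> exists k : V -> R,
    [/\ continuous k, IT 2 k = IT (r2 + 1) (cutoff q b : V -> R),
      (forall p, 1 <= sq p -> k p = 0),
      (forall p, sq p <= a ^+ 2 -> k p = k 0) &
      forall p p', `|(k p - cutoff q b (X p)) - (k p' - cutoff q b (X p'))| <= eps].
  move=> b1 b2 b0 eps0.
  have [k [k1 k2 k3 k4 k5]] := potential_close (Jst_trmx R n) (Jst_sqr R n) n3 r10 r12'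
    cphi psymp pinj pimg q0 q1 b0 b1 b2 eps0.
  exists k; split; [exact: C1_cts|exact: k2|exact: k3|exact: k4|exact: k5].
have a11 : a < 1 by apply: (lt_trans a1); rewrite ltrBlDr ltrDl.
have E : q ^+ 2 * r2 = q ^+ 5 * r by rewrite /r2 mulrA -exprD.
split; first by rewrite -E; exact: (volume_bound n0 r10 q2 q1 r12 pot).
have [H|H] := squeeze n0 r10 q2 q1 r12 a0 a11 pot; [left|right].
  by apply: (le_trans H); rewrite /r1 -mulrA -invfM -exprD.
by rewrite -E.
Qed.

End ShellVolume.

(** * Removal of the loss factor [q] *)

Section ShellRadius.
Variable R : realType.
Implicit Types (p : {poly R}) (c d e r s : R).

Lemma poly_gt_near_one p c : c < p.[1] -> \forall q \near (1 : R), c < p.[q].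
Proof.
by move=> cp; exact: (cvgr_gt _ (@continuous_horner R p 1) _ cp).
Qed.

Lemma near_one_lt (P : set R) : (\forall q \near (1 : R), P q) ->
  exists q, [/\ 1 / 2 <= q, q < 1 & P q].
Proof.
move=> /nbhs_ballP[t /= t0 H]; pose u := Num.min t 1 / 2.
have u0 : 0 < u by rewrite divr_gt0 // lt_min t0 ltr01.
have ut : u < t.
  apply: (@lt_le_trans _ _ (Num.min t 1)); last by rewrite ge_min lexx.
  by rewrite ltr_pdivrMr // ltr_pMr ?lt_min ?t0 ?ltr01 // ltr1n.
have u2 : u <= 1 / 2 by rewrite ler_pM2r ?invr_gt0 // ge_min lexx orbT.
exists (1 - u); split; [lra|lra|].
by apply: H; rewrite -ball_normE /= opprB addrC subrK gtr0_norm.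
Qed.

(** Continuity of the power at 1 provides an [s < 1] with [c < s^(m+1)], which stands in for the
    root of [c]. *)
Lemma root_lt1 (m : nat) c : c < 1 ->
  exists s, [/\ 0 < s, s < 1 & forall r, 0 <= r -> r ^+ m.+1 <= c -> r <= s].
Proof.
move=> c1; have h : c < ('X^(m.+1) : {poly R}).[1] by rewrite hornerXn expr1n.
have [s [s2 s1 sP]] := near_one_lt (poly_gt_near_one h).
have s0 : 0 < s by apply: lt_le_trans s2; rewrite divr_gt0.
exists s; split=> // r r0 rc.
rewrite -(ler_pXn2r (ltn0Sn m)) ?nnegrE ?(ltW s0) //; apply: (le_trans rc).
by rewrite -hornerXn ltW.
Qed.

(** If the bound failed, then by continuity at [q = 1] some [q < 1] would still satisfy the strict
    inequalities that refute both alternatives; the first one is refuted by [e < d] together with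
    [q ^+ 5 * r <= 1]. *)
Lemma shell_radius (n : nat) d e r : (2 <= n)%N -> 0 < e -> e < d -> d < 1 -> 0 < r ->
  shell_embeds d r (@open_shell R n e) -> r ^+ (n * 2) + (1 - e) ^+ (n * 2) <= 1.
Proof.
move=> n2 e0 ed d1 r0 emb; rewrite leNgt; apply/negP => big.
have d0 : 0 < d := lt_trans e0 ed.
have e1 : e < 1 := lt_trans ed d1.
(* The factor ['X^(n * 2)] clears the power of [q^-1]. The exponent 10 in [p2] comes from
   multiplying the first alternative by [q^4] and then by [q^5]. *)
pose p1 : {poly R} := (('X^5 * r%:P) ^+ (n * 2) + ('X * (1 - e)%:P) ^+ (n * 2)) * 'X^(n * 2).
pose p2 : {poly R} := 'X^10 * (1 - e)%:P.
have E1 q : p1.[q] = ((q ^+ 5 * r) ^+ (n * 2) + (q * (1 - e)) ^+ (n * 2)) * q ^+ (n * 2).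
  by rewrite /p1 !(hornerE, horner_exp).
have E2 q : p2.[q] = q ^+ 10 * (1 - e) by rewrite /p2 !(hornerE, horner_exp).
have h1 : 1 < p1.[1] by rewrite E1 !expr1n !mul1r mulr1.
have h2 : 1 - d < p2.[1] by rewrite E2 expr1n mul1r; lra.
have h3 : 1 - d < ('X^8 : {poly R}).[1] by rewrite hornerXn expr1n; lra.
have [q [q2 q1 [[]]]] := near_one_lt (filterI (filterI (poly_gt_near_one h1)
  (poly_gt_near_one h2)) (poly_gt_near_one h3)).
have q0 : 0 < q by apply: lt_le_trans q2; rewrite divr_gt0.
rewrite E1 E2 hornerXn => k1 k2 /ltW k3.
have [k4 [k5|k5]] := shell_alternative n2 d0 d1 r0 e0 e1 q2 q1 k3 emb.
  move: k2; rewrite ltNge => /negP; apply.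
  rewrite ler_pdivlMr ?exprn_gt0 // in k5.
  have k6 : q ^+ 10 * (1 - e) <= q ^+ 5 * r * (1 - d).
    rewrite -mulrA (_ : q ^+ 10 * (1 - e) = q ^+ 5 * (q * (1 - e) * q ^+ 4)).
      by rewrite ler_pM2l ?exprn_gt0.
    ring.
  apply: (le_trans k6); rewrite -[leRHS]mul1r ler_wpM2r // subr_ge0 ltW //.
move: k1; rewrite ltNge => /negP; apply.
by rewrite -ler_pdivlMr ?exprn_gt0 // mul1r -exprVn.
Qed.

End ShellRadius.

(** * Bounds for the capacity on either side of [delta] *)

Section Capacity.
Variables (R : realType) (n : nat).
Local Notation V := 'rV[R]_(n * 2).
Implicit Types (x : V) (d e r s : R).

Lemma smooth_on_id (W : set V) : smooth_on W (@id V).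
Proof.
have H (t : seq 'I_(n * 2)) : iter_partial (@id V) t = id \/
    exists c : V, iter_partial (@id V) t = cst c.
  elim: t => [|i t [IH|[c IH]]]; first by left.
    by right; exists 'e_i; rewrite /= -/(iter_partial _ _) IH; apply/funext => x; rewrite derive_id.
  by right; exists 0; rewrite /= -/(iter_partial _ _) IH; apply/funext => x; rewrite derive_cst.
move=> t x _; have [->|[c ->]] := H t.
  by split=> [|i]; [exact: cvg_id|exact: derivable_id].
by split=> [|i]; [exact: cst_continuous|exact: derivable_cst].
Qed.

Lemma shell_embeds_id d e s : 0 < e < 1 -> 0 < s < 1 -> d < 1 -> 1 - e < s * (1 - d) ->
  shell_embeds d s (@open_shell R n e).
Proof.
move=> /andP[e0 e1] /andP[s0 s1] d1 es.
exists ([set x | (1 - e) ^+ 2 < sq x] `&` [set x | sq x < 1]), id; split.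
- by apply: openI; [exact: (proj2 (open_sq _ _))|exact: (proj1 (open_sq _ _))].
- move=> x [xs xd]; split => /=.
    apply: (@lt_le_trans _ _ ((s * (1 - d)) ^+ 2)).
      by rewrite ltr_pXn2r // nnegrE ?subr_ge0 ?(ltW e1) // mulr_ge0 ?subr_ge0 // ltW.
    rewrite leNgt; apply/negP => h; apply: xd.
    by rewrite eucl_ballE // mulr_gt0 // subr_gt0.
  apply: (le_lt_trans (closure_eucl_ball_le s0 xs)).
  by rewrite exprn_ilt1 // ltW.
have di x : 'd (@id V) x = id :> (V -> V) by rewrite diff_val.
split.
- split; first exact: smooth_on_id.
    by move=> x _; rewrite di.
  by exists id; split=> //; apply: continuous_subspaceT; by move=> y; exact: cvg_id.
- move=> _ [x [/= x1 x2] <-]; split.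
    by rewrite eucl_ballE // expr1n.
  move=> /closure_eucl_ball_le; rewrite subr_gt0 => /(_ e1).
  by rewrite leNgt x1.
by move=> x u v _; rewrite di.
Qed.

Lemma capacity_ge d e s : 0 < d -> d < e -> e < 1 -> 0 < s -> s < 1 ->
  ((pi * s ^+ 2)%:E <= shell_capacity d (@open_shell R n e))%E.
Proof.
move=> d0 de e1 s0 s1; have d1 : d < 1 := lt_trans de e1.
(* A radius below 1 whose inner sphere lies outside the closed ball of radius [1 - e]: the midpoint
   between the critical ratio and 1 qualifies, and so does anything larger. *)
pose t := Num.max s ((1 + (1 - e) / (1 - d)) / 2).
have k1 : (1 - e) / (1 - d) < 1 by rewrite ltr_pdivrMr ?subr_gt0 // mul1r; lra.
have t1 : t < 1 by rewrite gt_max s1 /=; lra.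
have st : s <= t by rewrite le_max lexx.
have t0 : 0 < t := lt_le_trans s0 st.
have td : 1 - e < t * (1 - d).
  rewrite -ltr_pdivrMr ?subr_gt0 // lt_max; apply/orP; right; lra.
apply: (@le_trans _ _ (pi * t ^+ 2)%:E).
  by rewrite lee_fin ler_pM2l ?pi_gt0 // ler_pXn2r ?nnegrE // ltW.
apply: ereal_sup_ubound; exists t => //; split=> //.
by apply: shell_embeds_id; rewrite ?t0 ?(lt_trans d0 de).
Qed.

(** The bound [s] is uniform in [e < d]: there [1 - e] exceeds [1 - d], so [shell_radius] gives
    [r^(2n) <= 1 - (1 - d)^(2n)], a constant below 1. *)
Lemma capacity_le d : (2 <= n)%N -> 0 < d -> d < 1 -> exists s, [/\ 0 < s, s < 1 &
  forall e, 0 < e -> e < d -> (shell_capacity d (@open_shell R n e) <= (pi * s ^+ 2)%:E)%E].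
Proof.
move=> n2 d0 d1; pose m := (n * 2).-1.
have mE : (n * 2)%N = m.+1 by rewrite prednK // muln_gt0 (ltn_trans _ n2).
have c1 : 1 - (1 - d) ^+ m.+1 < 1 by rewrite ltrBlDr ltrDl exprn_gt0 ?subr_gt0.
have [s [s0 s1 sP]] := root_lt1 m c1; exists s; split=> // e e0 ed.
apply: ub_ereal_sup => _ [r [r0 emb] <-].
rewrite lee_fin ler_pM2l ?pi_gt0 // ler_pXn2r ?nnegrE ?(ltW r0) ?(ltW s0) //.
apply: sP; first exact: ltW.
have := shell_radius n2 e0 ed d1 r0 emb; rewrite mE => h.
rewrite lerBrDr; apply: le_trans h; rewrite lerD2l.
by rewrite ler_pXn2r ?nnegrE ?subr_ge0 ?(ltW d1) ?(ltW (lt_trans ed d1)) // lerD2l lerN2 ltW.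
Qed.

Lemma within_near_sides d (P : R -> Prop) : 0 < d -> d < 1 ->
  (\forall e \near within `]0, 1[ (nbhs d), P e) ->
  exists e1 e2, [/\ 0 < e1, e1 < d, d < e2, e2 < 1 & P e1 /\ P e2].
Proof.
move=> d0 d1 /nbhs_ballP[t /= t0 H]; pose u := Num.min t (Num.min d (1 - d)) / 2.
have k0 : 0 < Num.min t (Num.min d (1 - d)) by rewrite !lt_min t0 d0 subr_gt0.
have u0 : 0 < u by rewrite divr_gt0.
have uk : u < Num.min t (Num.min d (1 - d)).
  by rewrite ltr_pdivrMr // ltr_pMr // ltr1n.
move: uk; rewrite !lt_min => /and3P[ut ud ud1].
have e10 : 0 < d - u by rewrite subr_gt0.
have e1d : d - u < d by rewrite ltrBlDr ltrDl.
have e2d : d < d + u by rewrite ltrDl.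
have e21 : d + u < 1 by lra.
exists (d - u), (d + u); split=> //; split; apply: H.
- by rewrite -ball_normE /= opprB addrC subrK gtr0_norm.
- by rewrite /= in_itv /= e10 (lt_trans e1d).
- by rewrite -ball_normE /= opprD addrA subrr sub0r normrN gtr0_norm.
- by rewrite /= in_itv /= e21 (lt_trans d0).
Qed.

End Capacity.

Unset Implicit Arguments.

Theorem theorem1p2 (R : realType) (n : nat) (delta : R)
  (hn : (2 <= n)%N) (hdelta0 : 0 < delta) (hdelta1 : delta < 1) :
  ~ (shell_capacity delta (@open_shell R n eps)
       @[eps --> within `]0, 1[ (nbhs delta)]
     --> shell_capacity delta (@open_shell R n delta)).
Proof.
set L := shell_capacity delta (@open_shell R n delta) => cL.
have [s [s0 s1 cap_le]] := capacity_le hn hdelta0 hdelta1.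
pose s' := (1 + s) / 2.
have s'1 : s' < 1 by rewrite /s'; lra.
have ss' : s < s' by rewrite /s'; lra.
have s'0 : 0 < s' := lt_trans s0 ss'.
have ps : ((pi * s ^+ 2)%:E < (pi * s' ^+ 2)%:E)%E.
  by rewrite lte_fin ltr_pM2l ?pi_gt0 // ltr_pXn2r ?nnegrE // ltW.
(* The value [L] at [delta] lies below the larger of the two levels or above the smaller one.
   Continuity would carry this to both sides of [delta], against [capacity_ge] on the right or
   [cap_le] on the left. *)
have [Ls|sL] := ltP L (pi * s' ^+ 2)%:E.
  have oL := open_nbhs_nbhs (conj (@open_ereal_lt_ereal R (pi * s' ^+ 2)%:E) Ls).
  have [e1 [e2 [_ _ de2 e21 [_ /=]]]] := within_near_sides hdelta0 hdelta1 (cL _ oL).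
  by rewrite ltNge capacity_ge.
have oL := open_nbhs_nbhs (conj (@open_ereal_gt_ereal R (pi * s ^+ 2)%:E) (lt_le_trans ps sL)).
have [e1 [e2 [e10 ed _ _ [/= + _]]]] := within_near_sides hdelta0 hdelta1 (cL _ oL).
by rewrite ltNge cap_le.
Qed.
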